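(* Let $a\in\mathcal{AF}_D^*$ and let $\{b_{0,d}\in\mathcal{AT}_D^*: d\in D\}$ be a set of infinitesimal characters. Consider the map $\varphi$ from $D$ to (the completion of) $\mathcal{AT}_D$ with $\varphi(d)=\delta_\sigma(b_{0,d})$, let $F_D(d)=f_d$ for $d\in D$, and let $S_\varphi=F_D\circ A_\varphi\circ\delta_\sigma$. Then $$S_\varphi(a)=S(b_c^{\otimes D}\star a),$$ where $b_c^{\otimes D}=\otimes_{d\in D}b_{c,d}\iota_d$ with $b_{c,d}$ the character of $\mathcal{CF}_D$ that extends $b_{0,d}$, and $\star$ is the convolution product with respect to $\Delta_{CEM}:\mathcal{AF}_D\to\mathcal{CF}_D^{\otimes D}\otimes\mathcal{AF}_D$.
   Context: **Decorated aromatic and clumped forests.** Consider graphs $(V,E,S)$ with vertex decoration $\alpha:V\to D$: $V$ finite, $E\subset V\times V$ directed edges (loops allowed; each vertex has at most one successor; if $(v,w)\in E$, $v$ is a predecessor of $w$), $S$ a set of unordered pairs (stolons) of vertices without successor, each vertex in at most one stolon. Roots are vertices without successor and not in a stolon. Components have one root (trees) or none (aromas). Isomorphism classes are decorated aromatic forests, spanning $\mathcal{AF}_D$; those with one root span $\mathcal{AT}_D$, those without root span $\mathcal A_D$. $\mathcal{AF}_D=S_{\mathcal A_D}(\mathcal{AT}_D)$ under concatenation. $\mathcal{CF}_D:=S(\mathcal{AT}_D)$ (symmetric algebra over $\mathbb R$) has basis the clumped forests (monomials of aromatic trees, i.e. each aroma is attached to a specific rooted tree). $\sigma$ is the number of automorphisms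 and $\delta_\sigma(a)=\sum_\pi\frac{a(\pi)}{\sigma(\pi)}\pi$ (in the completion by number of vertices). $D$ is a set such that the sums over $D$-colourings below are finite (e.g. $D$ finite). **S-series.** For smooth vector fields $(f_d)_{d\in D}$ on $\mathbb R^d$, $F_D(\pi)[\phi]=\sum_{(i_v)_{v\in V}}\delta_{I_S}\big(\prod_{v\in V}f^{i_v}_{\alpha(v),I_{\Pi(v)}}\big)\phi_{I_R}$, with $R$ the roots, $\Pi(v)$ the predecessors of $v$, lower multi-indices denoting partial derivatives and $\delta_{I_S}$ identifying indices of vertices linked by a stolon. $F_D$ is extended linearly to formal sums, and $S(a)=F_D(\delta_\sigma(a))$ for $a\in\mathcal{AF}_D^*$. **$A_\varphi$.** Grafting $\tau\curvearrowright\gamma$ is the sum over all ways of attaching the root of $\tau$ to a vertex of $\gamma$; the trace/divergence $d(\tau)$ sums over all ways to attach the root of $\tau$ to one of its own vertices; $\langle\tau,\gamma\rangle$ links the two roots by a stolon. $A_\varphi$ is the unique morphism $\mathcal{AF}_D\to\mathcal{AF}_D$ (completed) of tracial commutative D-algebras with stolons sending the single vertex $\bullet_d$ to $\varphi(d)$: it is multiplicative for concatenation and commutes with $\curvearrowright$, divergence and stolon product. **Substitution.** $\mathcal{CF}_D^{\otimes D}=\bigotimes_{d\in D}\mathcal{CF}_D\iota_d$ with formal symbols $\iota_d$, and $b_c^{\otimes D}(\otimes_d\pi_d\iota_d)=\prod_db_{c,d}(\pi_d)$, where $b_{c,d}(\tau_1\cdots\tau_n)=\prod_ib_{0,d}(\tau_i)$.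 $\Delta_{CEM}(\pi)=\sum(\otimes_dp_d\iota_d)\otimes\pi/_{\otimes_dp_d\iota_d}$ for $\pi\in AF_D$, over all partitions of $\pi$ into disjoint coloured clumped subforests: choose a subset of edges and stolons of $\pi$ to keep, assign each resulting aroma to one of the resulting rooted components, and assign to each resulting aromatic tree a colour $d\in D$; $p_d$ collects those of colour $d$; the quotient contracts each aromatic tree of colour $d$ into a vertex decorated by $d$, keeping the non-chosen edges and stolons (the vertex inherits the outgoing edge, stolon or root status of the root of the contracted tree). Finally $b^{\otimes D}\star a=(b^{\otimes D}\otimes a)\circ\Delta_{CEM}$. An infinitesimal character is a functional supported on $\mathcal{AT}_D$. *)

(* Defs.v *)
From HB Require Import structures.
From mathcomp Require Import all_boot all_order all_algebra all_fingroup.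
From mathcomp Require Import finmap multiset.

Set Implicit Arguments.
Unset Strict Implicit.
Unset Printing Implicit Defensive.

Import Order.TTheory GRing.Theory Num.Theory.
Local Open Scope set_scope.
Local Open Scope ring_scope.

Section Graphs.
Variable D : finType.

(* (alpha, E, S): decorations, directed edges, stolons. *)
Definition pregraph (V : finType) : Type :=
  {ffun V -> D} * {set V * V} * {set {set V}}.

Definition wf_graph (V : finType) (G : pregraph V) : bool :=
  let: (_, E, T) := G in
  [&& [forall e in E, [forall e' in E, (e.1 == e'.1) ==> (e == e')]],
      [forall s in T, #|s| == 2%N],
      [forall s in T, [forall v in s, [forall w, (v, w) \notin E]]]
    & trivIset T].

Definition graph (V : finType) : Type := {G : pregraph V | wf_graph G}.

Section Projections.
Variables (V : finType) (G : graph V).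

Definition dec : {ffun V -> D} := (val G).1.1.
Definition edges : {set V * V} := (val G).1.2.
Definition stolons : {set {set V}} := (val G).2.
Definition preds (v : V) : {set V} := [set w | (w, v) \in edges].
Definition roots : {set V} :=
  [set v | [forall w, (v, w) \notin edges] && (v \notin cover stolons)].

End Projections.

Lemma wf_graphP (V : finType) (G : pregraph V) :
  reflect [/\ forall v w w', (v, w) \in G.1.2 -> (v, w') \in G.1.2 -> w = w',
              forall s, s \in G.2 -> #|s| = 2%N,
              forall s v w, s \in G.2 -> v \in s -> (v, w) \notin G.1.2
            & forall s t v, s \in G.2 -> t \in G.2 -> v \in s -> v \in t -> s = t]
          (wf_graph G).
Proof.
case: G => [[l E] T] /=; apply: (iffP and4P).
  case=> hE h2 h0 hS; split.
  - move=> v w w' h h'; move/forall_inP: hE => /(_ _ h) /forall_inP /(_ _ h').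
    by rewrite eqxx /= => /eqP[].
  - by move=> s hs; move/forall_inP: h2 => /(_ _ hs) /eqP.
  - move=> s v w hs hv; move/forall_inP: h0 => /(_ _ hs) /forall_inP /(_ _ hv).
    by move/forallP.
  - move=> s t v hs ht vs vt; apply/eqP; apply: contraT => nst.
    by move/trivIsetP: hS => /(_ _ _ hs ht nst) /disjoint_setI0 /setP /(_ v);
      rewrite !inE vs vt.
case=> hE h2 h0 hS; split.
- apply/forall_inP=> -[v w] h; apply/forall_inP=> -[v' w'] h'; apply/implyP => /= /eqP e.
  by rewrite -e in h' *; rewrite (hE _ _ _ h h').
- by apply/forall_inP=> s hs; rewrite h2.
- apply/forall_inP=> s hs; apply/forall_inP=> v hv; apply/forallP=> w; exact: h0 hs hv.
- apply/trivIsetP=> s t hs ht nst; rewrite -setI_eq0; apply: contraT => /set0Pn[v].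
  by rewrite inE => /andP[vs vt]; rewrite (hS _ _ _ hs ht vs vt) eqxx in nst.
Qed.

(* Pull-back along an injection: a relabelling if g is bijective, the subgraph
   induced on W if g is an inclusion. *)
Definition pull_pre (V W : finType) (g : W -> V) (G : graph V) : pregraph W :=
  ([ffun w => dec G (g w)],
   [set e | (g e.1, g e.2) \in edges G],
   [set s : {set W} | g @: s \in stolons G]).

Lemma pull_wf (V W : finType) (g : W -> V) (G : graph V) :
  injective g -> wf_graph (pull_pre g G).
Proof.
move=> ig; have /wf_graphP[hE h2 h0 hS] := valP G; apply/wf_graphP; split=> /=.
- by move=> v w w'; rewrite !inE => /hE h /h /ig.
- by move=> s; rewrite inE => /h2; rewrite card_imset.
- by move=> s v w; rewrite !inE => hs hv; apply: h0 hs (imset_f _ hv).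
- move=> s t v; rewrite !inE => hs ht vs vt.
  by apply: (imset_inj ig); apply: hS hs ht (imset_f _ vs) (imset_f _ vt).
Qed.

Definition pull (V W : finType) (g : W -> V) (ig : injective g) (G : graph V) :
  graph W := Sub (pull_pre g G) (pull_wf G ig).

Definition iso_class (n : nat) (G : graph 'I_n) : {set graph 'I_n} :=
  [set H | [exists s : 'S_n, H == pull (@perm_inj _ s) G]].

(* Aromatic forests with n vertices: isomorphism classes of graphs on 'I_n. *)
Definition forest (n : nat) :=
  {C : {set graph 'I_n} | [exists G, C == iso_class G]}.

Definition aforest := {n : nat & forest n}.

Definition nvertices (p : aforest) : nat := tag p.

Definition rep_of (n : nat) (p : forest n) : graph 'I_n :=
  xchoose (existsP (valP p)).

Definition rep (p : aforest) : graph 'I_(nvertices p) := rep_of (tagged p).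

Lemma iso_class_proof (n : nat) (G : graph 'I_n) :
  [exists H, iso_class G == iso_class H].
Proof. by apply/existsP; exists G. Qed.

Definition forest_of (n : nat) (G : graph 'I_n) : forest n :=
  exist _ (iso_class G) (iso_class_proof G).

Definition numbering (V : finType) (i : 'I_#|V|) : V := enum_val i.

Lemma numbering_inj (V : finType) : injective (@numbering V).
Proof. exact: enum_val_inj. Qed.

Definition forest_class (V : finType) (G : graph V) : aforest :=
  Tagged forest (forest_of (pull (@numbering_inj V) G)).

Definition sigma (p : aforest) : nat :=
  #|[set s : 'S_(nvertices p) | pull (@perm_inj _ s) (rep p) == rep p]|.

Definition is_tree (p : aforest) : bool := #|roots (rep p)| == 1%N.

Definition atree := {p : aforest | is_tree p}.


Section DisjointUnion.
Variables (V W : finType) (G : graph V) (H : graph W).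

Definition sum_pre : pregraph (V + W)%type :=
  ([ffun u => match u with inl v => dec G v | inr w => dec H w end],
   [set (inl e.1, inl e.2) | e in edges G] :|: [set (inr e.1, inr e.2) | e in edges H],
   [set (@inl V W) @: s | s : {set V} in stolons G]
     :|: [set (@inr V W) @: s | s : {set W} in stolons H]).

Lemma sum_wf : wf_graph sum_pre.
Proof.
have il : injective (@inl V W) by move=> ? ? [].
have ir : injective (@inr V W) by move=> ? ? [].
have /wf_graphP[hE h2 h0 hS] := valP G.
have /wf_graphP[hE' h2' h0' hS'] := valP H.
apply/wf_graphP; split=> /=.
- move=> v w w' /setUP[] /imsetP[[x y] hx [-> ->]] /setUP[] /imsetP[[x' y'] hx' [//]].
    by move=> ex ->; congr inl; rewrite -ex in hx'; exact: hE hx hx'.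
  by move=> ex ->; congr inr; rewrite -ex in hx'; exact: hE' hx hx'.
- by move=> s /setUP[] /imsetP[t ht ->]; rewrite card_imset ?h2 ?h2'.
- move=> s v w /setUP[] /imsetP[t ht ->] /imsetP[x hx ->].
    apply/negP => /setUP[] /imsetP[[x' y'] hx' [//]] ex _.
    by rewrite -ex in hx'; move: (h0 t x y' ht hx); rewrite hx'.
  apply/negP => /setUP[] /imsetP[[x' y'] hx' [//]] ex _.
  by rewrite -ex in hx'; move: (h0' t x y' ht hx); rewrite hx'.
- move=> s t v /setUP[] /imsetP[s' hs' ->] /setUP[] /imsetP[t' ht' ->]
    /imsetP[x hx ->] /imsetP[y hy //] [exy]; subst y.
    by rewrite (hS _ _ _ hs' ht' hx hy).
  by rewrite (hS' _ _ _ hs' ht' hx hy).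
Qed.

Definition gsum : graph (V + W)%type := Sub sum_pre sum_wf.

End DisjointUnion.

Section FamilyUnion.
Variables (I : finType) (V : I -> finType) (G : forall i, graph (V i)).

Definition bigsum_pre : pregraph {i : I & V i} :=
  ([ffun u => dec (G (tag u)) (tagged u)],
   \bigcup_i [set (Tagged V e.1, Tagged V e.2) | e in edges (G i)],
   \bigcup_i [set (@Tagged I i V) @: s | s : {set V i} in stolons (G i)]).

Lemma bigsum_wf : wf_graph bigsum_pre.
Proof.
have iT i : injective (@Tagged I i V) by exact: eq_from_Tagged.
apply/wf_graphP; split=> /=.
- move=> v w w' /bigcupP[i _ /imsetP[[x y] hx [-> ->]]].
  move=> /bigcupP[j _ /imsetP[[x' y'] hx' eqw]].
  have /= e := congr1 fst eqw; have /= -> := congr1 snd eqw.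
  have ij : i = j by have := congr1 tag e.
  subst j; have ex := iT _ _ _ e; subst x'.
  have /wf_graphP[hE _ _ _] := valP (G i).
  by rewrite (hE _ _ _ hx hx').
- move=> s /bigcupP[i _ /imsetP[t ht ->]].
  by have /wf_graphP[_ h2 _ _] := valP (G i); rewrite card_imset ?h2.
- move=> s v w /bigcupP[i _ /imsetP[t ht ->]] /imsetP[x hx ->].
  apply/negP => /bigcupP[j _ /imsetP[[x' y'] hx' eqw]].
  have /= e := congr1 fst eqw.
  have ij : i = j by have := congr1 tag e.
  subst j; have ex := iT _ _ _ e; subst x'.
  have /wf_graphP[_ _ h0 _] := valP (G i).
  by move: (h0 t x y' ht hx); rewrite hx'.
- move=> s t v /bigcupP[i _ /imsetP[s' hs' ->]] /bigcupP[j _ /imsetP[t' ht' ->]].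
  move=> /imsetP[x hx ->] /imsetP[y hy e].
  have ij : i = j by have := congr1 tag e.
  subst j; have ex := iT _ _ _ e; subst y.
  have /wf_graphP[_ _ _ hS] := valP (G i).
  by rewrite (hS _ _ _ hs' ht' hx hy).
Qed.

Definition bigsum : graph {i : I & V i} := Sub bigsum_pre bigsum_wf.

End FamilyUnion.

Section Modifications.
Variables (V : finType) (G : graph V).

(* Attach every root r lying in A to the vertex t r. *)
Definition attach_pre (A : {set V}) (t : V -> V) : pregraph V :=
  (dec G, edges G :|: [set (r, t r) | r in roots G :&: A], stolons G).

Lemma attach_wf (A : {set V}) (t : V -> V) : wf_graph (attach_pre A t).
Proof.
have /wf_graphP[hE h2 h0 hS] := valP G; apply/wf_graphP; split=> //=.
- move=> v w w' /setUP[] h /setUP[] h'.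
  + exact: hE h h'.
  + case/imsetP: h' h => r; rewrite !inE => /andP[/andP[/forallP/(_ w) nr _] _] [-> _] h.
    by rewrite h in nr.
  + case/imsetP: h h' => r; rewrite !inE => /andP[/andP[/forallP/(_ w') nr _] _] [-> _] h.
    by rewrite h in nr.
  + by case/imsetP: h => r _ [ev ->]; case/imsetP: h' => r' _ [ev' ->]; rewrite -ev -ev'.
- move=> s v w hs hv; apply/negP => /setUP[].
    by apply/negP; exact: h0 hs hv.
  case/imsetP=> r; rewrite !inE => /andP[/andP[_ /bigcupP nr] _] [e _].
  by apply: nr; exists s; rewrite // -e.
Qed.

Definition attach (A : {set V}) (t : V -> V) : graph V :=
  Sub (attach_pre A t) (attach_wf A t).

(* If G has exactly two roots, link them by a stolon. *)
Definition link_pre : pregraph V :=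
  (dec G, edges G, stolons G :|: [set s in [set roots G] | #|s| == 2%N]).

Lemma link_wf : wf_graph link_pre.
Proof.
have /wf_graphP[hE h2 h0 hS] := valP G; apply/wf_graphP; split=> //=.
- by move=> s /setUP[/h2 //|]; rewrite !inE => /andP[_ /eqP].
- move=> s v w /setUP[hs|]; first exact: h0 hs.
  by rewrite !inE => /andP[/eqP -> _]; rewrite inE => /andP[/forallP].
- have hr s v : s \in stolons G -> v \in s -> v \notin roots G.
    move=> hs hv; rewrite inE negb_and negbK; apply/orP; right.
    by apply/bigcupP; exists s.
  have hr2 s v : s \in [set s in [set roots G] | #|s| == 2%N] -> v \in s -> v \in roots G.
    by rewrite !inE => /andP[/eqP ->]; rewrite inE.
  move=> s t v /setUP[hs|hs] /setUP[ht|ht] vs vt.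
  + exact: hS hs ht vs vt.
  + by move: (hr2 _ _ ht vt); rewrite (negbTE (hr _ _ hs vs)).
  + by move: (hr2 _ _ hs vs); rewrite (negbTE (hr _ _ ht vt)).
  + by move: hs ht; rewrite !inE => /andP[/eqP -> _] /andP[/eqP -> _].
Qed.

Definition link : graph V := Sub link_pre link_wf.

Definition keep_pre (E : {set V * V}) (T : {set {set V}}) : pregraph V :=
  (dec G, edges G :&: E, stolons G :&: T).

Lemma keep_wf (E : {set V * V}) (T : {set {set V}}) : wf_graph (keep_pre E T).
Proof.
have /wf_graphP[hE h2 h0 hS] := valP G; apply/wf_graphP; split=> /=.
- by move=> v w w' /setIP[h _] /setIP[h' _]; exact: hE h h'.
- by move=> s /setIP[/h2].
- by move=> s v w /setIP[hs _] hv; rewrite inE (negbTE (h0 _ _ w hs hv)).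
- by move=> s t v /setIP[hs _] /setIP[ht _]; exact: hS hs ht.
Qed.

Definition keep (E : {set V * V}) (T : {set {set V}}) : graph V :=
  Sub (keep_pre E T) (keep_wf E T).

End Modifications.

Section Clumping.
Variables (V : finType) (G : graph V).

(* The chosen edges, the chosen stolons, and the map sending each vertex to the
   root of the aromatic tree that contains it.  A map constant along the chosen
   edges and stolons is a map on components; being the identity on roots, it
   amounts to the assignment of each aroma to a rooted component. *)
Definition precut : Type := {set V * V} * {set {set V}} * {ffun V -> V}.

Definition is_cut (c : precut) : bool :=
  let: (E, T, own) := c in
  let R := roots (keep G E T) in
  [&& E \subset edges G, T \subset stolons G,
      [forall v, own v \in R],
      [forall r in R, own r == r]
    & [forall e in E, own e.1 == own e.2] &&
      [forall s in T, [forall v in s, [forall w in s, own v == own w]]]].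

Definition cut : Type := {c : precut | is_cut c}.

Section Cut.
Variable c : cut.

Definition chosen_edges : {set V * V} := (val c).1.1.
Definition chosen_stolons : {set {set V}} := (val c).1.2.
Definition own : {ffun V -> V} := (val c).2.
Definition kept : graph V := keep G chosen_edges chosen_stolons.

(* The aromatic trees of the partition, represented by their roots. *)
Definition blocks : Type := {r : V | r \in roots kept}.

Definition block (r : blocks) : graph {v : V | own v == val r} :=
  pull val_inj kept.

Lemma cutP :
  [/\ chosen_edges \subset edges G, chosen_stolons \subset stolons G,
      forall v, own v \in roots kept,
      forall r, r \in roots kept -> own r = r
    & (forall v w, (v, w) \in chosen_edges -> own v = own w) /\
      (forall s v w, s \in chosen_stolons -> v \in s -> w \in s -> own v = own w)].
Proof.
rewrite /chosen_edges /chosen_stolons /own /kept /chosen_edges /chosen_stolons.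
case: c => [[[E T] o]] /= /and5P[hE hT /forallP ho /forall_inP hr].
case/andP=> /forall_inP he /forall_inP hs; split=> //.
  by move=> r hr'; apply/eqP/hr.
split; first by move=> v w /he /eqP.
by move=> s v w /hs /forall_inP h /h /forall_inP h' /h' /eqP.
Qed.

Lemma roots_block (r : blocks) : #|roots (block r)| = 1%N.
Proof.
have [hE hT hown hfix [hoE hoT]] := cutP.
have ov : own (val r) == val r by rewrite (hfix _ (valP r)).
apply/eqP/cards1P; exists (exist _ (val r) ov : {v : V | own v == val r}).
apply/setP=> v; rewrite !inE; apply/idP/eqP.
  case/andP=> /forallP nE nS; apply: val_inj => /=.
  apply: (etrans _ (eqP (valP v))); apply/esym/hfix; rewrite inE; apply/andP; split.
    apply/forallP=> w; apply/negP=> vw.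
    have ew : own w == val r.
      by move: vw; rewrite inE => /andP[_ /hoE <-]; exact: (valP v).
    by move: (nE (exist _ w ew)); rewrite !inE /=; move: vw; rewrite inE => ->.
  apply: contra nS => /bigcupP[s hs hv].
  apply/bigcupP; exists [set x : {v : V | own v == val r} | val x \in s];
    last by rewrite inE.
  rewrite inE; suff -> : val @: [set x : {v : V | own v == val r} | val x \in s] = s
    by [].
  apply/setP=> w; apply/imsetP/idP => [[x] | hw]; first by rewrite inE => hx ->.
  have hs' : s \in chosen_stolons by move: hs; rewrite inE => /andP[].
  have ew : own w == val r by rewrite -(hoT _ _ _ hs' hv hw); exact: (valP v).
  by exists (exist _ w ew); rewrite ?inE.
move=> ->; have := valP r; rewrite inE => /andP[/forallP nE nS]; apply/andP; split.
  by apply/forallP=> w; rewrite !inE /=; have := nE (val w); rewrite inE.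
apply: contra nS => /bigcupP[s]; rewrite inE => hs hv.
apply/bigcupP; exists (val @: s); first by [].
exact: (imset_f val hv).
Qed.

(* A non-chosen edge or stolon always starts from roots of kept, so the quotient
   loses none of them. *)
Definition quotient_pre (k : {ffun blocks -> D}) : pregraph blocks :=
  (k,
   [set e | [exists w, [&& (val e.1, w) \in edges G,
                           (val e.1, w) \notin chosen_edges & own w == val e.2]]],
   [set s : {set blocks} | val @: s \in stolons G :\: chosen_stolons]).

Lemma quotient_wf (k : {ffun blocks -> D}) : wf_graph (quotient_pre k).
Proof.
have /wf_graphP[hE h2 h0 hS] := valP G; apply/wf_graphP; split=> /=.
- move=> v w w'; rewrite !inE /= => /existsP[x /and3P[hx _ /eqP ex]].
  move=> /existsP[y /and3P[hy _ /eqP ey]]; apply: val_inj.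
  by rewrite /= -ex -ey (hE _ _ _ hx hy).
- by move=> s; rewrite !inE => /andP[_ /h2]; rewrite card_imset //; exact: val_inj.
- move=> s v w; rewrite !inE => /andP[_ hs] hv; apply/negP => /existsP[x /and3P[hx _ _]].
  by move: (h0 _ _ x hs (imset_f val hv)); rewrite hx.
- move=> s t v; rewrite !inE => /andP[_ hs] /andP[_ ht] vs vt.
  apply: (imset_inj val_inj).
  exact: hS hs ht (imset_f val vs) (imset_f val vt).
Qed.

Definition quotient (k : {ffun blocks -> D}) : graph blocks :=
  Sub (quotient_pre k) (quotient_wf k).

End Cut.
End Clumping.

Lemma roots_pull (V W : finType) (g : W -> V) (ig : injective g) (G : graph V) :
  bijective g -> #|roots (pull ig G)| = #|roots G|.
Proof.
case=> h gK hK; rewrite -(card_imset (mem (roots (pull ig G))) ig); apply: eq_card.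
move=> v; rewrite -[v]hK mem_imset //; set w := h v; rewrite !inE; congr (_ && ~~ _).
  apply/forallP/forallP => H x; last by have := H (g x); rewrite !inE.
  by have := H (h x); rewrite !inE /= hK.
apply/bigcupP/bigcupP => -[s].
  by rewrite inE => hs ws; exists (g @: s) => //; exact: imset_f.
move=> hs ws; exists (g @^-1: s); last by rewrite inE.
rewrite inE; suff -> : g @: (g @^-1: s) = s by [].
apply/setP=> x; apply/imsetP/idP => [[y] | hx]; first by rewrite inE => hy ->.
by exists (h x); rewrite ?inE hK.
Qed.

Lemma iso_class_refl (n : nat) (G : graph 'I_n) : G \in iso_class G.
Proof.
rewrite inE; apply/existsP; exists 1%g; apply/eqP/val_inj.
have i1 (s : {set 'I_n}) : (fun x => (1%g : 'S_n) x) @: s = s.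
  by rewrite -[RHS]imset_id; apply: eq_imset => x; rewrite perm1.
rewrite /= /pull_pre [LHS]surjective_pairing [X in (X, _) = _]surjective_pairing.
congr (_, _, _).
- by apply/ffunP=> x; rewrite ffunE perm1.
- by apply/setP=> -[x y]; rewrite inE /= !perm1.
- by apply/setP=> t; rewrite inE i1.
Qed.

Lemma rep_of_iso (n : nat) (G : graph 'I_n) :
  exists s : 'S_n, rep_of (forest_of G) = pull (@perm_inj _ s) G.
Proof.
have /eqP e := xchooseP (existsP (valP (forest_of G))).
have := iso_class_refl (rep_of (forest_of G)).
rewrite /rep_of; move: (xchoose _) e => H e.
by rewrite -[iso_class H]e inE => /existsP[s /eqP ->]; exists s.
Qed.

Lemma class_tree (V : finType) (G : graph V) :
  #|roots G| = 1%N -> is_tree (forest_class G).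
Proof.
move=> hG; set P := pull (@numbering_inj V) G.
have [s hs] := rep_of_iso P.
apply/eqP; apply: (etrans (congr1 (fun H => #|roots H|) hs)).
rewrite roots_pull; last by exists (s^-1)%g => x; rewrite (permK, permKV).
by rewrite roots_pull //; exact: enum_val_bij.
Qed.

Definition block_tree (V : finType) (G : graph V) (c : cut G) (r : blocks c) : atree :=
  exist _ (forest_class (block r)) (class_tree (roots_block r)).

(* The basis of CF_D^{(x) D}: a clumped forest, i.e. a monomial in aromatic trees,
   for each d in D. *)
Definition clumped_tensor : Type := {ffun D -> {mset atree}%mset}.

Definition cem_term (V : finType) (G : graph V) (c : cut G)
    (k : {ffun blocks c -> D}) : clumped_tensor * aforest :=
  ([ffun d => seq_mset [seq block_tree r | r <- enum {: blocks c} & k r == d]],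
   forest_class (quotient k)).

(* A sum of basis elements of CF_D^{(x) D} (x) AF_D, as the list of its terms. *)
Definition Delta_CEM (p : aforest) : seq (clumped_tensor * aforest) :=
  [seq cem_term k | c <- enum {: cut (rep p)}, k <- enum {: {ffun blocks c -> D}}].

Section Operations.

Definition empty_pre : pregraph void := ([ffun v => of_void D v], set0, set0).

Lemma empty_wf : wf_graph empty_pre.
Proof. by apply/wf_graphP; split=> /= >; rewrite !inE. Qed.

Definition empty_graph : graph void := Sub empty_pre empty_wf.

Definition empty_forest : aforest := forest_class empty_graph.

Definition vertex_pre (d : D) : pregraph unit := ([ffun => d], set0, set0).

Lemma vertex_wf (d : D) : wf_graph (vertex_pre d).
Proof. by apply/wf_graphP; split=> /= >; rewrite !inE. Qed.

Definition vertex_graph (d : D) : graph unit := Sub (vertex_pre d) (vertex_wf d).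

Definition vertex (d : D) : aforest := forest_class (vertex_graph d).

Definition concat (p q : aforest) : aforest := forest_class (gsum (rep p) (rep q)).

Definition stolon (p q : aforest) : aforest := forest_class (link (gsum (rep p) (rep q))).

Definition graft_at (p q : aforest) (v : 'I_(nvertices q)) : aforest :=
  forest_class (attach (gsum (rep p) (rep q))
    [set inl x | x : 'I_(nvertices p)] (fun => inr v)).

Definition close_at (p : aforest) (v : 'I_(nvertices p)) : aforest :=
  forest_class (attach (rep p) setT (fun => v)).

(* The root of the i-th tree is attached to the vertex v_(i+1) of the (i+1)-th one,
   cyclically. *)
Definition cycle_at (k : nat) (t : 'I_k -> aforest)
    (v : {dffun forall i : 'I_k, 'I_(nvertices (t i))}) : aforest :=
  forest_class (attach (bigsum (fun i => rep (t i))) setT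
    (fun u => Tagged (fun i => 'I_(nvertices (t i))) (v (ordS (tag u))))).

End Operations.

End Graphs.

Arguments empty_forest {D}.

From mathcomp Require Import all_classical all_reals all_analysis.
Import numFieldNormedType.Exports.

Section Series.
Variables (R : realType) (D : finType).

(* Functionals on AF_D and formal sums of aromatic forests (the completion of AF_D)
   are both families of coefficients. *)
Definition formal_series : Type := aforest D -> R.

Definition basis (p : aforest D) : formal_series := fun q => (q == p)%:R.

Definition delta_sigma (a : formal_series) : formal_series := fun p => a p / (sigma p)%:R.

Definition graft (p q : aforest D) : formal_series :=
  fun r => \sum_(v : 'I_(nvertices q)) basis (graft_at p v) r.

Definition divergence (p : aforest D) : formal_series :=
  fun r => \sum_(v : 'I_(nvertices p)) basis (close_at v) r.

Definition elem_trace (k : nat) (t : 'I_k -> aforest D) : formal_series :=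
  fun r => \sum_(v : {dffun forall i : 'I_k, 'I_(nvertices (t i))}) basis (cycle_at v) r.

(* The operations below add up numbers of vertices, so that the coefficient at r of a
   (multi)linear extension only involves forests with at most nvertices r vertices. *)
Definition upto (N : nat) : Type := {n : 'I_N.+1 & forest D n}.

Definition of_upto (N : nat) (p : upto N) : aforest D :=
  Tagged (forest D) (tagged p).

Definition lin_ext (A : aforest D -> formal_series) (x : formal_series) :
    formal_series := fun r =>
  \sum_(p : upto (nvertices r)) x (of_upto p) * A (of_upto p) r.

Definition bilin_ext (B : aforest D -> aforest D -> formal_series)
    (x y : formal_series) : formal_series :=
  fun r => \sum_(p : upto (nvertices r)) \sum_(q : upto (nvertices r))
    x (of_upto p) * y (of_upto q) * B (of_upto p) (of_upto q) r.

Definition multilin_ext (k : nat) (B : ('I_k -> aforest D) -> formal_series)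
    (x : 'I_k -> formal_series) : formal_series :=
  fun r => \sum_(p : {ffun 'I_k -> upto (nvertices r)})
    (\prod_i x i (of_upto (p i))) * B (fun i => of_upto (p i)) r.

(* A morphism AF_D -> (completion of) AF_D is given by the images of the forests.
   By tr_filtered, lin_ext A is the continuous extension of A to formal sums.
   The trace of a tracial algebra is defined on the endomorphisms generated by the
   Y |-> (Y grafted on X), X a tree: the divergence of X is the trace of the latter,
   and tr_trace deals with the compositions of such endomorphisms. They cannot be
   omitted: concatenation, grafting, divergence and stolons alone do not generate
   all aromas from the single vertices, for instance not a cycle of three vertices
   with different decorations. *)
Record tracial_morphism (A : aforest D -> formal_series) : Prop := TracialMorphism {
  tr_filtered : forall p q, (nvertices q < nvertices p)%N -> A p q = 0;
  tr_tree : forall p q, is_tree p -> ~~ is_tree q -> A p q = 0;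
  tr_unit : A empty_forest = basis empty_forest;
  tr_concat : forall p q,
    A (concat p q) = bilin_ext (fun p q => basis (concat p q)) (A p) (A q);
  tr_graft : forall p q, is_tree p ->
    lin_ext A (graft p q) = bilin_ext graft (A p) (A q);
  tr_divergence : forall p, is_tree p ->
    lin_ext A (divergence p) = lin_ext divergence (A p);
  tr_trace : forall (k : nat) (t : 'I_k.+1 -> aforest D),
    (forall i, is_tree (t i)) ->
    lin_ext A (elem_trace t) = multilin_ext (@elem_trace k.+1) (fun i => A (t i));
  tr_stolon : forall p q, is_tree p -> is_tree q ->
    A (stolon p q) = bilin_ext (fun p q => basis (stolon p q)) (A p) (A q) }.

Definition substitution_morphism (phi : D -> formal_series)
    (A : aforest D -> formal_series) : Prop :=
  tracial_morphism A /\ forall d, A (vertex d) = phi d.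

(* A functional on AT_D, seen as a functional on AF_D supported on AT_D. *)
Definition extend_tree (b : atree D -> R) : formal_series :=
  fun p => oapp b 0 (insub p).

Definition phi_of (b0 : D -> atree D -> R) : D -> formal_series :=
  fun d => delta_sigma (extend_tree (b0 d)).

Definition tree_character (b : atree D -> R) (p : {mset atree D}%mset) : R :=
  \prod_(t <- p) b t.

Definition tensor_character (b0 : D -> atree D -> R) (p : clumped_tensor D) : R :=
  \prod_d tree_character (b0 d) (p d).

Definition star (B : clumped_tensor D -> R) (a : formal_series) : formal_series :=
  fun p => \sum_(t <- Delta_CEM p) B t.1 * a t.2.

Variable n : nat.
Implicit Types (g psi : 'rV[R]_n -> R).

Definition partial (i : 'I_n) g : 'rV[R]_n -> R :=
  fun x => 'D_(delta_mx 0 i) g x.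

Definition partials (s : seq 'I_n) g : 'rV[R]_n -> R := foldr partial g s.

Definition smooth g : Prop := forall s : seq 'I_n,
  continuous (partials s g) /\
  forall (i : 'I_n) (x : 'rV[R]_n), derivable (partials s g) x (delta_mx 0 i).

Definition component (i : 'I_n) (h : 'rV[R]_n -> 'rV[R]_n) : 'rV[R]_n -> R :=
  fun x => h x 0 i.

Definition smooth_field (h : 'rV[R]_n -> 'rV[R]_n) : Prop :=
  forall i, smooth (component i h).

Definition stolon_compatible (V : finType) (G : graph D V) (i : {ffun V -> 'I_n}) : bool :=
  [forall s in stolons G, [forall v in s, [forall w in s, i v == i w]]].

Variable f : D -> 'rV[R]_n -> 'rV[R]_n.

Definition F_graph (V : finType) (G : graph D V) psi : 'rV[R]_n -> R := fun x =>
  \sum_(i : {ffun V -> 'I_n} | stolon_compatible G i)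
    (\prod_v partials [seq i w | w in preds G v] (component (i v) (f (dec G v))) x)
    * partials [seq i r | r in roots G] psi x.

Definition F_forest (p : aforest D) := F_graph (rep p).

(* F_D of a formal sum is a formal series of differential operators, graded by the
   number of vertices; its value at N is the term of degree N. *)
Definition F_series (x : formal_series) (N : nat) psi : 'rV[R]_n -> R := fun y =>
  \sum_(p : forest D N)
    x (Tagged (forest D) p) * F_forest (Tagged (forest D) p) psi y.

Definition S_series (a : formal_series) := F_series (delta_sigma a).

Definition S_subst (A : aforest D -> formal_series) (a : formal_series) :=
  F_series (lin_ext A (delta_sigma a)).

End Series.

(* Main.v *)
Require Import Defs.
From mathcomp Require Import all_boot all_order all_algebra all_fingroup.
From mathcomp Require Import finmap multiset reals.
Import Defs.

(** The two sides of the theorem apply the same map [F_series] to two formal series,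
    and these series are equal: [A_phi (delta_sigma a) = delta_sigma (b_c star a)]. This
    rests on a formula for the coefficients of the morphism [A_phi],

      [sigma H * A_phi P H = sum over c of prod over v in P of b0 (dec v) (fibre of v)],

    where c runs over the covering structures of H over P ([covers]). Such a structure
    maps the vertices of H to those of P and marks one vertex in each fibre, so that the
    links of H at the marked vertices are mapped to the links of P, while all other links
    of H stay inside the fibres. In other words, H arises from P by inserting the fibres,
    which are aromatic trees with the marked vertices as roots, at the vertices of P.

    The formula holds because both of its sides obey the same gluing rules. Given a graph
    P0 made of several pieces, and a pattern q of links between the pieces, the rule says
    that the sum of the coefficients of all graphs obtained by linking roots of P0 along q
    equals the sum, over all ways to cut H into pieces along the same pattern, of the
    products of the coefficients of the pieces. For covering sums this is the
    associativity of substitution ([cover_sum_assembles]). For the morphism it restates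
    the compatibility with concatenation, grafting, traces and stolons ([coefA_pairs],
    [coefA_cycle]); the factor sigma in the formula is what turns sums over isomorphism
    classes into sums over decompositions of a labelled graph ([sum_joined_classes]).

    The gluing rules, with the values on the empty forest and on single vertices,
    determine all coefficients. Indeed, each graph with a link or with several vertices is
    obtained by linking smaller pieces in such a way that all other graphs obtained from
    these pieces connect more pairs of vertices ([triangular]): a branch is grafted on the
    root rather than farther from it, and a cycle passes through the roots of its trees
    only. Hence an induction on the size, and downwards on the number of connected pairs
    ([coefA_cover_sum]).

    Finally, a covering structure of H over P is a partition of H into coloured aromatic
    trees together with an isomorphism from the quotient to P ([cover_sum_cuts]). Summing
    over the classes of P with the weights [a P / sigma P] cancels the number of
    isomorphisms, and leaves the sum over the terms of [Delta_CEM] ([substitution_star]). *)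

Set Implicit Arguments.
Unset Strict Implicit.
Unset Printing Implicit Defensive.

Import Order.TTheory GRing.Theory Num.Theory.
Local Open Scope set_scope.
Local Open Scope ring_scope.

(** * Graphs as partial functions on their vertices *)

Definition lmap (V W : Type) (g : V -> W) : option (bool * V) -> option (bool * W) :=
  omap (fun p => (p.1, g p.2)).

Section Out.
Variable D : finType.
Implicit Types U V W : finType.

(** A vertex has at most one successor or one stolon, never both. So a graph is
    its decoration together with this partial function, in which [true] marks the
    stolons; the sets of edges and stolons are handled through it. *)
Definition out V (G : graph D V) (v : V) : option (bool * V) :=
  if [pick w | (v, w) \in edges G] is Some w then Some (false, w)
  else if [pick w | [set v; w] \in stolons G] is Some w then Some (true, w)
  else None.

Section Basic.
Variables (V : finType) (G : graph D V).

Lemma edges_fun v w w' : (v, w) \in edges G -> (v, w') \in edges G -> w = w'.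
Proof. by have /wf_graphP[hE _ _ _] := valP G; exact: hE. Qed.

Lemma stolon_noedge v w x : [set v; w] \in stolons G -> (v, x) \notin edges G.
Proof.
by have /wf_graphP[_ _ h _] := valP G => hs; apply: h hs _; rewrite !inE eqxx.
Qed.

Lemma stolon_fun v w w' : [set v; w] \in stolons G -> [set v; w'] \in stolons G -> w = w'.
Proof.
have /wf_graphP[_ h2 _ hS] := valP G => h h'.
have e : [set v; w] = [set v; w'] by apply: (hS _ _ v) => //; rewrite !inE eqxx.
have := h2 _ h; rewrite cards2; case: eqP => // nvw _.
have : w \in [set v; w'] by rewrite -e !inE eqxx orbT.
by rewrite !inE => /orP[/eqP ew|/eqP //]; case: nvw.
Qed.

Lemma out_unique v l :
    (forall w, ((v, w) \in edges G) = (l == Some (false, w))) ->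
    (forall w, ([set v; w] \in stolons G) = (l == Some (true, w))) ->
  out G v = l.
Proof.
rewrite /out => hE hS; case: pickP => [w|nE]; first by rewrite hE => /eqP.
case: pickP => [w|nS]; first by rewrite hS => /eqP.
case: l hE hS => // -[[] w] hE hS; first by have := nS w; rewrite hS eqxx.
by have := nE w; rewrite hE eqxx.
Qed.

Lemma out_edge v w : (out G v == Some (false, w)) = ((v, w) \in edges G).
Proof.
rewrite /out; case: pickP => [x hx|nE].
  apply/eqP/idP => [[<-] //|h]; by rewrite (edges_fun hx h).
by case: pickP => [x hx|nS]; rewrite nE; apply/eqP.
Qed.

Lemma out_stolon v w : (out G v == Some (true, w)) = ([set v; w] \in stolons G).
Proof.
rewrite /out; case: pickP => [x hx|nE].
  by apply/eqP/idP => // h; have := stolon_noedge x h; rewrite hx.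
case: pickP => [x hx|nS]; last by rewrite nS; apply/eqP.
apply/eqP/idP => [[<-] //|h]; by rewrite (stolon_fun hx h).
Qed.

Lemma stolon_pair s v : s \in stolons G -> v \in s -> exists w, s = [set v; w].
Proof.
have /wf_graphP[_ h2 _ _] := valP G => /h2 /eqP /cards2P[x [y] [nxy ->]].
by rewrite !inE => /orP[] /eqP->; [exists y | exists x; rewrite setUC].
Qed.

Lemma stolonsP s :
  reflect (exists v w, s = [set v; w] /\ out G v = Some (true, w)) (s \in stolons G).
Proof.
apply: (iffP idP) => [hs|[v [w [-> /eqP]]]]; last by rewrite out_stolon.
have /wf_graphP[_ h2 _ _] := valP G.
have /eqP /cards2P[x [y] [nxy es]] := h2 _ hs.
by exists x, y; split => //; apply/eqP; rewrite out_stolon -es.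
Qed.

Lemma out_root v : (out G v == None) = (v \in roots G).
Proof.
apply/eqP/idP => [h|].
  rewrite inE; apply/andP; split.
    by apply/forallP=> w; rewrite -out_edge h.
  apply/bigcupP => -[s hs hv]; have [w es] := stolon_pair hs hv.
  by move: hs; rewrite es -out_stolon h.
rewrite inE => /andP[/forallP nE nS]; apply: out_unique => w.
  by rewrite (negbTE (nE w)).
by apply/negP => hs; case/bigcupP: nS; exists [set v; w]; rewrite // !inE eqxx.
Qed.

Lemma out_sym v w : out G v = Some (true, w) -> out G w = Some (true, v).
Proof. by move/eqP; rewrite out_stolon setUC -out_stolon => /eqP. Qed.

Lemma out_irr v w : out G v = Some (true, w) -> v != w.
Proof.
move/eqP; rewrite out_stolon; have /wf_graphP[_ h2 _ _] := valP G => /h2.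
by rewrite cards2; case: eqP.
Qed.

End Basic.

Lemma graph_ext V (G H : graph D V) : dec G =1 dec H -> out G =1 out H -> G = H.
Proof.
move=> eD eO; apply: val_inj.
have eE : edges G = edges H by apply/setP=> -[v w]; rewrite -!out_edge eO.
have eS : stolons G = stolons H.
  apply/setP=> s; apply/stolonsP/stolonsP => -[v [w [-> h]]]; exists v, w.
    by rewrite -eO.
  by rewrite eO.
move: eE eS; rewrite /edges /stolons.
have /ffunP : dec G =1 dec H by [].
rewrite /dec; case: (val G) => -[d E] S; case: (val H) => -[d' E'] S' /=.
by move=> -> -> ->.
Qed.

Section Build.
Variables (V : finType) (d : V -> D) (l : V -> option (bool * V)).
Hypothesis l_sym : forall v w, l v = Some (true, w) -> (v != w) /\ l w = Some (true, v).

Definition build_pre : pregraph D V :=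
  ([ffun v => d v], [set e | l e.1 == Some (false, e.2)],
   [set s : {set V} | [exists v, [exists w, (l v == Some (true, w)) && (s == [set v; w])]]]).

Lemma build_preS v w : ([set v; w] \in build_pre.2) = (l v == Some (true, w)).
Proof.
rewrite inE; apply/idP/idP => [|h].
  case/existsP=> x /existsP[y /andP[/eqP h /eqP e]].
  have [nxy hy] := l_sym h.
  have : v \in [set x; y] by rewrite -e !inE eqxx.
  have : x \in [set v; w] by rewrite e !inE eqxx.
  have : y \in [set v; w] by rewrite e !inE eqxx orbT.
  rewrite !inE => h1 h2 /orP[]/eqP ev; subst v.
    move: h1; rewrite eq_sym (negbTE nxy) /= => /eqP <-; exact/eqP.
  by move: h2; rewrite (negbTE nxy) /= => /eqP <-; exact/eqP.
by apply/existsP; exists v; apply/existsP; exists w; rewrite h eqxx.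
Qed.

Lemma build_wf : wf_graph build_pre.
Proof.
have pr s v : s \in build_pre.2 -> v \in s -> exists2 w, s = [set v; w] & l v = Some (true, w).
  rewrite inE; case/existsP=> x /existsP[y /andP[/eqP h /eqP ->]].
  rewrite !inE => /orP[]/eqP->; first by exists y.
  by exists x; rewrite 1?setUC //; case: (l_sym h).
apply/wf_graphP; split.
- by move=> v w w'; rewrite !inE => /eqP -> /eqP[].
- move=> s /[dup] hs; rewrite inE => /existsP[x /existsP[y /andP[/eqP h /eqP ->]]].
  by rewrite cards2; case: (l_sym h) => ->.
- by move=> s v w /pr h /h[x _ hx]; rewrite inE /= hx.
- move=> s t v /pr h /pr h' /h[x -> hx] /h'[y ->]; by rewrite hx => -[->].
Qed.

Definition build : graph D V := Sub build_pre build_wf.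

Lemma dec_build v : dec build v = d v.
Proof. by rewrite /dec ffunE. Qed.

Lemma out_build v : out build v = l v.
Proof.
apply: out_unique => w; first by rewrite inE.
exact: build_preS.
Qed.

End Build.

(** For an injective g, this says that g is an isomorphism from H onto a union of
    connected components of G. *)
Definition relabels V W (g : W -> V) (H : graph D W) (G : graph D V) : bool :=
  [forall w, (dec H w == dec G (g w)) && (out G (g w) == lmap g (out H w))].

Section Relabels.

Lemma relabelsP V W (g : W -> V) (H : graph D W) (G : graph D V) :
  reflect ((forall w, dec H w = dec G (g w)) /\ (forall w, out G (g w) = lmap g (out H w)))
          (relabels g H G).
Proof.
apply: (iffP forallP) => [h|[h1 h2] w]; last by rewrite h1 h2 !eqxx.
by split=> w; have /andP[/eqP h1 /eqP h2] := h w.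
Qed.

Lemma lmap_comp (X Y Z : Type) (g : Y -> Z) (h : X -> Y) l :
  lmap g (lmap h l) = lmap (g \o h) l.
Proof. by case: l. Qed.

Lemma eq_lmap (X Y : Type) (g h : X -> Y) : g =1 h -> lmap g =1 lmap h.
Proof. by move=> e [[s v]|] //=; rewrite e. Qed.

Lemma lmap_id (X : Type) (l : option (bool * X)) : lmap id l = l.
Proof. by case: l => [[]|]. Qed.

Lemma lmap_inj (X Y : Type) (g : X -> Y) : injective g -> injective (lmap g).
Proof. by move=> ig [[s v]|] [[t w]|] //= [-> /ig ->]. Qed.

Lemma relabels_id V (G : graph D V) : relabels id G G.
Proof. by apply/relabelsP; split=> // v; rewrite lmap_id. Qed.

Lemma eq_relabels V W (g h : W -> V) H G : g =1 h -> relabels g H G = relabels h H G.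
Proof.
by move=> e; apply: eq_forallb => w; rewrite e (eq_lmap e).
Qed.

Lemma relabels_comp U V W (g : V -> W) (h : U -> V) (F : graph D U) (G : graph D V) (H : graph D W) :
  relabels h F G -> relabels g G H -> relabels (g \o h) F H.
Proof.
move=> /relabelsP[d1 o1] /relabelsP[d2 o2]; apply/relabelsP; split=> u /=.
  by rewrite d1 d2.
by rewrite o2 o1 lmap_comp.
Qed.

Lemma relabels_can V W (g : W -> V) (h : V -> W) H G :
  cancel g h -> cancel h g -> relabels g H G -> relabels h G H.
Proof.
move=> gK hK /relabelsP[d o]; apply/relabelsP; split=> v.
  by rewrite d hK.
have := o (h v); rewrite hK => ->; rewrite lmap_comp -[LHS]lmap_id.
by apply: eq_lmap => x /=; rewrite gK.
Qed.

Lemma relabels_cancel U V W (g : V -> W) (h : U -> V) (F : graph D U) G H :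
  injective g -> relabels g G H -> relabels (g \o h) F H -> relabels h F G.
Proof.
move=> ig /relabelsP[d1 o1] /relabelsP[d2 o2]; apply/relabelsP; split=> u.
  by rewrite d2 /= d1.
by apply: (lmap_inj ig); rewrite -o1 lmap_comp; exact: o2.
Qed.

Lemma relabels_inj V W (g : W -> V) H H' G :
  injective g -> relabels g H G -> relabels g H' G -> H = H'.
Proof.
move=> ig /relabelsP[d1 o1] /relabelsP[d2 o2]; apply: graph_ext => w; first by rewrite d1 d2.
by apply: (lmap_inj ig); rewrite -o1 o2.
Qed.

Lemma relabels_surj V W (g : W -> V) (h : V -> W) H G G' :
  cancel h g -> relabels g H G -> relabels g H G' -> G = G'.
Proof.
move=> hK /relabelsP[d1 o1] /relabelsP[d2 o2]; apply: graph_ext => v; rewrite -[v]hK.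
  by rewrite -d1 d2.
by rewrite o1 o2.
Qed.

(** Pulling back along an injection keeps exactly the links between vertices of the
    image, hence nothing is lost when no link leaves the image. *)
Lemma pull_relabels V W (g : W -> V) (ig : injective g) (G : graph D V) :
    (forall w s y, out G (g w) = Some (s, y) -> exists w', y = g w') ->
  relabels g (pull ig G) G.
Proof.
move=> cl; apply/relabelsP; split=> w; first by rewrite /dec ffunE.
have -> : out (pull ig G) w =
    match out G (g w) with
    | Some (s, y) => omap (pair s) [pick w' | y == g w']
    | None => None end.
  apply: out_unique => x.
    rewrite inE -out_edge /=.
    case: (out G (g w)) (cl w) => [[[] y]|//] h; first by case: pickP.
    case: pickP => [w' /= /eqP ->|/= n].
      rewrite -(inj_eq (@Some_inj _)) /=; apply/eqP/eqP => -[]; last by move->.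
      by move/ig->.
    by have [//|w' e] := h false y; move: (n w'); rewrite e eqxx.
  rewrite inE imsetU1 imset_set1 -out_stolon.
  case: (out G (g w)) (cl w) => [[[] y]|//] h; last by case: pickP.
  case: pickP => [w' /= /eqP ->|/= n].
    by apply/eqP/eqP => -[]; [move/ig->| move->].
  by have [//|w' e] := h true y; move: (n w'); rewrite e eqxx.
case e: (out G (g w)) => [[s y]|//]; have [w' ey] := cl _ _ _ e.
case: pickP => [x /= /eqP -> //|n].
by have := n w'; rewrite /= ey eqxx.
Qed.

Lemma pull_relabels_bij V W (g : W -> V) (ig : injective g) (h : V -> W) (G : graph D V) :
  cancel h g -> relabels g (pull ig G) G.
Proof. by move=> hK; apply: pull_relabels => w s y _; exists (h y); rewrite hK. Qed.

End Relabels.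
End Out.

(** * Isomorphism classes and automorphisms *)

Section Classes.
Variable D : finType.
Implicit Types U V W : finType.

Lemma pull_perm n (G H : graph D 'I_n) (s : 'S_n) :
  (pull (@perm_inj _ s) G == H) = relabels s H G.
Proof.
have r := @pull_relabels_bij _ _ _ s (@perm_inj _ s) _ G (permKV s).
apply/eqP/idP => [<- //|h]; exact: relabels_inj (@perm_inj _ s) r h.
Qed.

Lemma iso_classP n (G H : graph D 'I_n) :
  reflect (exists s : 'S_n, relabels s H G) (H \in iso_class G).
Proof.
rewrite inE; apply: (iffP existsP) => -[s h]; exists s.
  by rewrite -pull_perm eq_sym.
by rewrite eq_sym pull_perm.
Qed.

Lemma relabels_permV n (G H : graph D 'I_n) (s : 'S_n) :
  relabels s H G -> relabels (s^-1)%g G H.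
Proof. apply: relabels_can; [exact: permK | exact: permKV]. Qed.

Lemma iso_class_eq n (G H : graph D 'I_n) (s : 'S_n) :
  relabels s H G -> iso_class H = iso_class G.
Proof.
move=> h; apply/setP=> K; apply/iso_classP/iso_classP => -[t ht].
  exists (t * s)%g; rewrite (@eq_relabels _ _ _ _ (s \o t)); first exact: relabels_comp ht h.
  by move=> x; rewrite permM.
exists (t * s^-1)%g; rewrite (@eq_relabels _ _ _ _ ((s^-1)%g \o t)).
  exact: relabels_comp ht (relabels_permV h).
by move=> x; rewrite permM.
Qed.

Lemma tagged_forest_eq m n (H : graph D 'I_m) (G : graph D 'I_n) (g : 'I_m -> 'I_n) :
    bijective g -> relabels g H G ->
  Tagged (forest D) (forest_of H) = Tagged (forest D) (forest_of G).
Proof.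
move=> bg; have := bij_eq_card bg; rewrite !card_ord => e; subst n.
move=> h; congr (Tagged _ _); apply: val_inj => /=.
apply: (@iso_class_eq _ _ _ (perm (bij_inj bg))).
by rewrite (@eq_relabels _ _ _ _ g) // => x; rewrite permE.
Qed.

Lemma numbering_relabels V (G : graph D V) :
  relabels (@numbering V) (pull (@numbering_inj V) G) G.
Proof. exact: pull_relabels_bij (@enum_rankK V). Qed.

Lemma numbering_bij V : bijective (@numbering V).
Proof. exact: enum_val_bij. Qed.

Lemma forest_class_iso V W (H : graph D W) (G : graph D V) (g : W -> V) :
  bijective g -> relabels g H G -> forest_class H = forest_class G.
Proof.
move=> bg h; have [g' gK hK] := bg.
apply: (@tagged_forest_eq _ _ _ _ (@enum_rank V \o g \o @numbering W)).
  apply: bij_comp; last exact: numbering_bij.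
  by apply: bij_comp bg; exact: enum_rank_bij.
apply: (@relabels_comp _ _ _ _ (@enum_rank V)); last first.
  apply: relabels_can (numbering_relabels G); [exact: enum_valK | exact: enum_rankK].
exact: relabels_comp (numbering_relabels H) h.
Qed.

(** The representative chosen in a class is only known up to isomorphism. *)
Lemma rep_of_class V (G : graph D V) :
  exists2 g : 'I_(nvertices (forest_class G)) -> V,
    bijective g & relabels g (rep (forest_class G)) G.
Proof.
have [s hs] := rep_of_iso (pull (@numbering_inj V) G).
exists (@numbering V \o s).
  by apply: bij_comp; [exact: numbering_bij | exists (s^-1)%g; [exact: permK | exact: permKV]].
apply: relabels_comp (numbering_relabels G).
by rewrite /rep /= -pull_perm hs.
Qed.

Lemma forest_classK (p : aforest D) : forest_class (rep p) = p.
Proof.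
transitivity (Tagged (forest D) (forest_of (rep p))).
  apply: (@tagged_forest_eq _ _ _ _ (@numbering 'I_(nvertices p))); first exact: numbering_bij.
  exact: numbering_relabels.
case: p => n p; congr (Tagged _ _); apply: val_inj => /=.
by have /eqP -> := xchooseP (existsP (valP p)).
Qed.

Lemma nvertices_class V (G : graph D V) : nvertices (forest_class G) = #|V|.
Proof. by []. Qed.

Definition isos V W (H : graph D W) (G : graph D V) : {set {ffun W -> V}} :=
  [set g : {ffun W -> V} | [&& injectiveb g, #|V| <= #|W| & relabels g H G]]%N.

Lemma isosP V W (H : graph D W) (G : graph D V) (g : {ffun W -> V}) :
  reflect (bijective g /\ relabels g H G) (g \in isos H G).
Proof.
rewrite inE; apply: (iffP and3P) => [[/injectiveP ig c r]|[bg r]].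
  by split=> //; exact: inj_card_bij.
by split=> //; [exact/injectiveP/bij_inj | rewrite (bij_eq_card bg)].
Qed.

Lemma isos_ffunP V W (H : graph D W) (G : graph D V) (h : W -> V) :
  reflect (bijective h /\ relabels h H G) ([ffun w => h w] \in isos H G).
Proof.
have e : [ffun w => h w] =1 h by move=> w; rewrite ffunE.
apply: (iffP (isosP H G _)) => -[bh rh]; split.
- exact: eq_bij bh _ e.
- by rewrite -(eq_relabels _ _ e).
- exact: eq_bij bh _ (fsym e).
- by rewrite (eq_relabels _ _ e).
Qed.

Lemma card_isos_rep (p : aforest D) : #|isos (rep p) (rep p)| = sigma p.
Proof.
rewrite /sigma.
have inj : injective (fun s : 'S_(nvertices p) => [ffun x => s x]).
  by move=> s t /ffunP e; apply/permP=> x; have := e x; rewrite !ffunE.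
rewrite -(card_imset _ inj); apply: eq_card => g; apply/isosP/imsetP.
  case=> bg hg; exists (perm (bij_inj bg)).
    by rewrite inE pull_perm (@eq_relabels _ _ _ _ g) // => x; rewrite permE.
  by apply/ffunP=> x; rewrite ffunE permE.
case=> s; rewrite inE pull_perm => hs ->; split.
  exists (s^-1)%g => x; rewrite ?ffunE; [exact: permK | exact: permKV].
by rewrite (@eq_relabels _ _ _ _ s) // => x; rewrite ffunE.
Qed.

Lemma card_isos_l V V' W (H : graph D W) (G : graph D V) (G' : graph D V') (f : V -> V') :
  bijective f -> relabels f G G' -> #|isos H G| = #|isos H G'|.
Proof.
move=> bf hf.
have inj : injective (fun g : {ffun W -> V} => [ffun x => f (g x)]).
  move=> g h /ffunP e; apply/ffunP=> x; have := e x; rewrite !ffunE.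
  exact: (bij_inj bf).
rewrite -(card_imset _ inj); apply: eq_card => g; apply/imsetP/isosP.
  case=> k /isosP[bk hk] ->; split.
    by apply: (eq_bij (bij_comp bf bk)) => x; rewrite ffunE.
  rewrite (@eq_relabels _ _ _ _ (f \o k)); first exact: relabels_comp hk hf.
  by move=> x; rewrite ffunE.
case=> bg hg; have [f' fK f'K] := bf; exists [ffun x => f' (g x)].
  have bf' : bijective f' by exists f.
  apply/isosP; split; first by apply: (eq_bij (bij_comp bf' bg)) => x; rewrite ffunE.
  rewrite (@eq_relabels _ _ _ _ (f' \o g)); last by move=> x; rewrite ffunE.
  exact: relabels_comp hg (relabels_can fK f'K hf).
by apply/ffunP=> x; rewrite !ffunE f'K.
Qed.

Lemma card_isosC V W (H : graph D W) (G : graph D V) : #|isos H G| = #|isos G H|.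
Proof.
suff le (X Y : finType) (K : graph D X) (L : graph D Y) : (#|isos K L| <= #|isos L K|)%N.
  by apply/eqP; rewrite eqn_leq !le.
have [->|[g0 g0i]] := set_0Vmem (isos K L); first by rewrite cards0.
have /isosP[bg0 hg0] := g0i; have [h0 g0K h0K] := bg0.
pose iv (g : {ffun X -> Y}) : {ffun Y -> X} :=
  [ffun y => if [pick x | g x == y] is Some x then x else h0 y].
have ivK (g : {ffun X -> Y}) : bijective g -> cancel g (iv g).
  move=> bg x; rewrite ffunE; case: pickP => [z /eqP /(bij_inj bg) //|/(_ x)].
  by rewrite eqxx.
have Kiv (g : {ffun X -> Y}) : bijective g -> cancel (iv g) g.
  by move=> bg y; have [k gK kK] := bg; rewrite -{1}(kK y) ivK // kK.
rewrite -(@card_in_imset _ _ iv).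
  apply/subset_leq_card/subsetP=> _ /imsetP[g /isosP[bg hg] ->].
  apply/isosP; split; first by exists g; [exact: Kiv | exact: ivK].
  exact: relabels_can (ivK _ bg) (Kiv _ bg) hg.
move=> g h /isosP[bg _] /isosP[bh _] e; apply/ffunP=> x.
by apply: (can_inj (Kiv _ bg)); rewrite ivK // e ivK.
Qed.

(** Composition with one isomorphism turns automorphisms into isomorphisms. All
    symmetry factors [sigma] come from this count. *)
Lemma card_isos V W (H : graph D W) (G : graph D V) :
  #|isos H G| = ((forest_class H == forest_class G) * sigma (forest_class G))%N.
Proof.
case: eqP => [e|n]; last first.
  apply/eqP; rewrite cards_eq0; apply/eqP/setP=> g; rewrite [RHS]inE.
  by apply/isosP => -[bg hg]; apply: n; exact: forest_class_iso hg.
rewrite mul1n -card_isos_rep; have [g bg hg] := rep_of_class G.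
rewrite -(card_isos_l H bg hg) card_isosC.
have [k bk hk] := rep_of_class H; move: k bk hk; rewrite e => k bk hk.
by rewrite (card_isos_l _ bk hk).
Qed.

End Classes.

(** * Maps over a set of parts *)

Section Over.
Variables (R : comPzSemiRingType) (I V W X : finType) (rW : W -> I) (rV : V -> I).

Local Notation fibre i := {ffun {w | rW w == i} -> {v | rV v == i} * X}.

Definition glue (f : fprod (fun i => fibre i)) : {ffun W -> V * X} :=
  [ffun w => let u := f (rW w) (exist _ w (eqxx _)) in (val u.1, u.2)].

Lemma glueE f i (w : {w | rW w == i}) : glue f (val w) = (val (f i w).1, (f i w).2).
Proof.
case: w => w hw /=; rewrite ffunE; move/eqP: (hw) => e; subst i.
by rewrite (eq_irrelevance hw (eqxx _)).
Qed.

Lemma glue_inj : injective glue.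
Proof.
move=> f g e; apply/fprodP => i; apply/ffunP => w.
have := congr1 (fun h : {ffun W -> V * X} => h (val w)) e; rewrite /= !glueE.
case: (f i w) (g i w) => [a x] [b y] /= [ab ->].
by rewrite (val_inj ab).
Qed.

Lemma glue_image : glue @: setT = [set phi : {ffun W -> V * X} | [forall w, rV (phi w).1 == rW w]].
Proof.
apply/setP=> phi; rewrite inE; apply/imsetP/forallP => [[f _ ->] w|h].
  by rewrite ffunE; exact: (valP (f _ _).1).
have hv i (w : {w | rW w == i}) : rV (phi (val w)).1 == i.
  by rewrite (eqP (h _)); exact: (valP w).
pose f : fprod (fun i => fibre i) :=
  fprod_of_fun (fun i => [ffun w => (exist _ (phi (val w)).1 (hv i w), (phi (val w)).2)]).
exists f => //; apply/ffunP => w.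
by rewrite ffunE /f fprodE ffunE /=; case: (phi w).
Qed.

(** A map from W to V over I is a family of maps between the fibres, so a product
    over I of sums over such maps expands into one sum. The auxiliary type X carries
    the marks of covering structures; it is [unit] for isomorphisms. *)
Lemma big_over (F : forall i, fibre i -> R) (G : I -> {ffun W -> V * X} -> R) :
    (forall i (g : fibre i) (phi : {ffun W -> V * X}),
       (forall w, rV (phi w).1 = rW w) -> (forall w, phi (val w) = (val (g w).1, (g w).2)) ->
       F i g = G i phi) ->
  \prod_i \sum_(g : fibre i) F i g =
  \sum_(phi : {ffun W -> V * X} | [forall w, rV (phi w).1 == rW w]) \prod_i G i phi.
Proof.
move=> FG; pose P i := [ffun g : fibre i => F i g].
transitivity (\sum_(t : fprod (fun i => fibre i)) \prod_i F i (t i)).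
  transitivity (\prod_i \sum_(j in tagged_with (fun i => fibre i) i) untag 0 (P i) j).
    apply: eq_bigr => i _.
    rewrite -(big_tag (fun i g => P i g)); apply: eq_bigr => g _; by rewrite ffunE.
  rewrite bigA_distr_big_dep.
  transitivity (\sum_(t : fprod (fun i => fibre i)) \prod_i P i (t i)).
    exact/esym/big_fprod.
  by apply: eq_bigr => t _; apply: eq_bigr => i _; rewrite ffunE.
transitivity (\sum_(phi in glue @: setT) \prod_i G i phi).
  rewrite big_imset /=; last by move=> ? ? _ _; exact: glue_inj.
  apply: eq_big => [t|t _]; first by rewrite inE.
  by apply: eq_bigr => i _; apply: FG => w; rewrite ?glueE // ffunE; exact/eqP/(valP (t _ _).1).
by apply: eq_bigl => phi; rewrite glue_image inE.
Qed.

End Over.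

(** * The parts of a graph *)

Section Parts.
Variable D : finType.
Implicit Types I J U V W : finType.

Definition sever V (G : graph D V) (B : {set V}) : graph D V :=
  keep G [set e | e.1 \notin B] [set s : {set V} | [disjoint s & B]].

Lemma dec_sever V (G : graph D V) B : dec (sever G B) = dec G.
Proof. by []. Qed.

Lemma out_sever V (G : graph D V) (B : {set V}) v :
  out (sever G B) v =
  if out G v is Some p then if (v \in B) || (p.1 && (p.2 \in B)) then None else Some p
  else None.
Proof.
have hE w : ((v, w) \in edges (sever G B)) = (out G v == Some (false, w)) && (v \notin B).
  by rewrite !inE out_edge.
have hS w : ([set v; w] \in stolons (sever G B)) =
    (out G v == Some (true, w)) && ((v \notin B) && (w \notin B)).
  rewrite !inE out_stolon; congr (_ && _).
  rewrite disjoint_sym disjoints_subset; apply/subsetP/andP => [h|[h1 h2] x hx].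
    by split; apply/negP => /h; rewrite !inE eqxx ?orbT.
  by rewrite !inE; apply/norP; split; apply: contraTN hx => /eqP ->.
apply: out_unique => w; rewrite ?hE ?hS; case: (out G v) => [[[] y]|] //=.
- by case: (v \in B) => //=; case: (y \in B).
- by case: (v \in B) => //=; rewrite ?andbF ?andbT.
- case e: (v \in B) => /=; first by rewrite ?andbF.
  case e2: (y \in B) => /=; last first.
    by case: eqP => //= -[<-]; rewrite e2.
  by case: eqP => //= -[<-]; rewrite e2.
by case: (v \in B); rewrite //= andbF.
Qed.

Lemma sever_sever V (G : graph D V) (B C : {set V}) :
  B \subset C -> sever (sever G B) C = sever G C.
Proof.
move=> /subsetP sBC; apply: graph_ext => // v; rewrite !out_sever.
case: (out G v) => [[s y]|] //=.
have := sBC v; case: (v \in B) => /= [/(_ isT) -> //|_].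
have := sBC y; case: s; case: (y \in B) => //= h; by rewrite h ?orbT.
Qed.

Definition closed_at I V (r : V -> I) (G : graph D V) (v : V) : bool :=
  if out G v is Some p then r p.2 == r v else true.

Definition part I V (r : V -> I) (i : I) (G : graph D V) : graph D {v | r v == i} :=
  pull val_inj G.

Lemma part_relabels I V (r : V -> I) i (G : graph D V) :
  (forall v, r v = i -> closed_at r G v) -> relabels val (part r i G) G.
Proof.
move=> cl; apply: pull_relabels => w s y e.
have := cl (val w) (eqP (valP w)); rewrite /closed_at e /= (eqP (valP w)) => h.
by exists (exist _ y h).
Qed.

Lemma big_sig (R : Type) (idx : R) (op : Monoid.com_law idx) V (P : pred V) (F : V -> R) :
  \big[op/idx]_(v : {v | P v}) F (val v) = \big[op/idx]_(v | P v) F v.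
Proof.
rewrite [RHS](reindex_omap (val : {v | P v} -> V) insub); last first.
  by move=> v hv; rewrite insubT.
by apply: eq_bigl => v; rewrite (valP v) valK eqxx.
Qed.

(** Serves to compare parts whose vertices are the same but belong to different
    subtypes, as happens for parts of parts. *)
Lemma part_iso (I J V W : finType) (r : V -> I) i (G : graph D V) (q : W -> J) j (H : graph D W)
    (h : W -> V) :
    injective h -> (forall w, q w = j -> r (h w) = i) ->
    (forall v, r v = i -> exists2 w, q w = j & v = h w) ->
    (forall w, q w = j -> closed_at q H w) -> (forall v, r v = i -> closed_at r G v) ->
    relabels h H G ->
  forest_class (part q j H) = forest_class (part r i G).
Proof.
move=> ih hq hr cH cG hH.
have hP (w : {w | q w == j}) : r (h (val w)) == i.
  by apply/eqP/hq/eqP; exact: (valP w).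
pose g (w : {w | q w == j}) : {v | r v == i} := exist _ (h (val w)) (hP w).
have rg : relabels g (part q j H) (part r i G).
  apply: (relabels_cancel val_inj (part_relabels cG)).
  exact: relabels_comp (part_relabels cH) hH.
apply: forest_class_iso rg.
have ig : injective g by move=> x y /(congr1 val) /ih /val_inj.
apply: (inj_card_bij ig).
rewrite -(card_imset predT ig) subset_leq_card //.
apply/subsetP=> -[v hv] _; have [w qw ev] := hr _ (eqP hv).
apply/imsetP; exists (exist _ w (introT eqP qw)) => //.
by apply: val_inj; rewrite /= ev.
Qed.

(** When the fibres are unions of components, an isomorphism over I is a family of
    isomorphisms of the parts. *)
Lemma card_isos_over I V W (rW : W -> I) (rV : V -> I) (H : graph D W) (G : graph D V) :
    (forall w, closed_at rW H w) -> (forall v, closed_at rV G v) ->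
  #|[set g in isos H G | [forall w, rV (g w) == rW w]]| =
  (\prod_i #|isos (part rW i H) (part rV i G)|)%N.
Proof.
move=> cH cG.
have rH i := part_relabels (fun w (_ : rW w = i) => cH w).
have rG i := part_relabels (fun w (_ : rV w = i) => cG w).
pose F i (g : {ffun {w | rW w == i} -> {v | rV v == i} * unit}) : nat :=
  [ffun w => (g w).1] \in isos (part rW i H) (part rV i G).
pose ok (i : I) (phi : {ffun W -> V * unit}) :=
  [&& [forall w, (rW w == i) ==>
         (dec H w == dec G (phi w).1) && (out G (phi w).1 == lmap (fst \o phi) (out H w))],
      [forall w, (rW w == i) ==> [forall w', (rW w' == i) ==> (phi w == phi w') ==> (w == w')]]
    & [forall v, (rV v == i) ==> [exists w, (phi w).1 == v]]].
have FE i (g : {ffun {w | rW w == i} -> {v | rV v == i} * unit}) (phi : {ffun W -> V * unit}) :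
    (forall w, rV (phi w).1 = rW w) ->
    (forall w, phi (val w) = (val (g w).1, (g w).2)) -> F i g = ok i phi :> nat.
  move=> ov e; congr nat_of_bool.
  have r_at (w : {w | rW w == i}) :
      (dec (part rW i H) w = dec (part rV i G) (g w).1 /\
       out (part rV i G) (g w).1 = lmap (fst \o g) (out (part rW i H) w)) <->
      (dec H (val w) = dec G (phi (val w)).1 /\
       out G (phi (val w)).1 = lmap (fst \o phi) (out H (val w))).
    have /relabelsP[d1 o1] := rH i; have /relabelsP[d2 o2] := rG i.
    rewrite e /= d1 d2 o1 o2 lmap_comp.
    have -> : lmap ((fst \o phi) \o val) (out (part rW i H) w)
            = lmap val (lmap (fst \o g) (out (part rW i H) w)).
      by rewrite lmap_comp; apply: eq_lmap => x /=; rewrite e.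
    by split=> -[-> h]; split=> //; [rewrite h | apply: (lmap_inj val_inj)].
  apply/isos_ffunP/and3P.
    case=> bg /relabelsP[dg og]; split.
    - apply/forallP=> w; apply/implyP => hw.
      have [|/= -> ->] := (r_at (exist _ w hw)).1; last by rewrite !eqxx.
      by split; [exact: dg | exact: og].
    - apply/forallP=> w; apply/implyP => hw; apply/forallP => w'; apply/implyP => hw'.
      apply/implyP => /eqP ew.
      have := e (exist _ w hw); have := e (exist _ w' hw') => /=; rewrite ew => -> [h _].
      have /(bij_inj bg) /(congr1 val) /= -> // : (g (exist _ w hw)).1 = (g (exist _ w' hw')).1.
      exact: val_inj.
    - apply/forallP=> v; apply/implyP => hv; have [k kK Kk] := bg.
      apply/existsP; exists (val (k (exist _ v hv))); rewrite e /=.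
      by have /= -> := congr1 val (Kk (exist _ v hv)).
  case=> /forallP h1 /forallP h2 /forallP h3.
  have r1 w := (r_at w).2; split; last first.
    by apply/relabelsP; split=> w; case: (r1 w) => //; have := h1 (val w);
      rewrite (valP w) /= => /andP[/eqP -> /eqP ->].
  have ig : injective (fun w => (g w).1).
    move=> w w' ew; apply: val_inj.
    have := h2 (val w); rewrite (valP w) /= => /forallP /(_ (val w')).
    rewrite (valP w') /= => /implyP h; apply/eqP/h; rewrite !e ew.
    by case: (g w).2; case: (g w').2.
  apply: (inj_card_bij ig).
  rewrite -(card_imset predT ig) subset_leq_card //.
  apply/subsetP=> -[v hv] _; have := h3 v; rewrite hv /= => /existsP[w /eqP ew].
  have hw : rW w == i by rewrite -ov ew.
  apply/imsetP; exists (exist _ w hw) => //; apply: val_inj => /=.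
  by have := e (exist _ w hw); rewrite /= => h; rewrite -ew h.
have := @big_over nat I V W unit rW rV F (fun i phi => ok i phi : nat) FE.
have sF i : \sum_(g : {ffun {w | rW w == i} -> {v | rV v == i} * unit}) F i g =
    #|isos (part rW i H) (part rV i G)|.
  rewrite -sum1_card (reindex (fun g : {ffun {w | rW w == i} -> {v | rV v == i} * unit} =>
     [ffun w => (g w).1])) /=.
    by rewrite [RHS]big_mkcond; apply: eq_bigr => g _; rewrite /F; case: (_ \in _).
  apply: onW_bij; exists (fun g : {ffun _ -> _} => [ffun w => (g w, tt)]) => g; apply/ffunP=> w.
    by rewrite !ffunE; case: (g w) => a [].
  by rewrite !ffunE.
under [X in X = _ -> _]eq_bigr => i _ do rewrite sF.
move=> ->.
rewrite -sum1_card (reindex (fun g : {ffun W -> V * unit} => [ffun w => (g w).1])) /=; last first.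
  apply: onW_bij; exists (fun g : {ffun _ -> _} => [ffun w => (g w, tt)]) => g; apply/ffunP=> w.
    by rewrite !ffunE; case: (g w) => a [].
  by rewrite !ffunE.
rewrite big_mkcond [RHS]big_mkcond; apply: eq_bigr => phi _.
rewrite inE; under eq_forallb => w do rewrite ffunE.
have [/forallP ov|_] := boolP [forall w, rV (phi w).1 == rW w]; last by rewrite andbF.
rewrite andbT; case: ifP => [/isos_ffunP[bg /relabelsP[dg og]]|ni].
  rewrite big1 // => i _; suff -> : ok i phi by [].
  apply/and3P; split.
  - by apply/forallP=> w; apply/implyP => _; rewrite dg og !eqxx.
  - apply/forallP=> w; apply/implyP => hw; apply/forallP => w'; apply/implyP => hw'.
    by apply/implyP => /eqP ew; apply/eqP/(bij_inj bg); rewrite ew.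
  - apply/forallP=> v; apply/implyP => hv; have [k kK Kk] := bg.
    by apply/existsP; exists (k v); rewrite Kk.
case: (boolP [forall i, ok i phi]) => [/forallP h|/forallPn[i nok]]; last first.
  by rewrite (bigD1 i) //= (negbTE nok) mul0r.
case/negP: ni; apply/isos_ffunP; split; last first.
  by apply/relabelsP; split=> w; have /and3P[/forallP /(_ w) + _ _] := h (rW w);
    rewrite eqxx /= => /andP[/eqP dg /eqP og].
have ig : injective (fun w => (phi w).1).
  move=> w w' ew.
  have /and3P[_ /forallP /(_ w) + _] := h (rW w); rewrite eqxx /= => /forallP /(_ w').
  have -> /= : rW w' == rW w by rewrite -(eqP (ov w)) -(eqP (ov w')) ew.
  by move/implyP => H1; apply/eqP/H1; move: ew; case: (phi w) (phi w') => [a []] [c []] /= ->.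
apply: (inj_card_bij ig).
rewrite -(card_imset predT ig) subset_leq_card //.
apply/subsetP=> v _; have /and3P[_ _ /forallP /(_ v)] := h (rV v); rewrite eqxx /=.
by case/existsP=> w /eqP ew; apply/imsetP; exists w.
Qed.

End Parts.

(** * Covering structures *)

Section Covers.
Variable D : finType.
Implicit Types I U V W : finType.

Definition marked I W (c : {ffun W -> I * bool}) : {set W} := [set w | (c w).2].

Lemma in_marked I W (c : {ffun W -> I * bool}) w : (w \in marked c) = (c w).2.
Proof. by rewrite inE. Qed.

Definition base I W (c : {ffun W -> I * bool}) (w : W) : I := (c w).1.

(** In [link_ok q c H], c sends each vertex of H to a part, an element of I, and marks
    some vertices; q prescribes the links between the parts. The links of marked
    vertices realise q, all other links stay inside a part. A stolon between two parts
    has to join two marked vertices, since it becomes a stolon between the parts. *)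
Definition link_ok I W (q : I -> option (bool * I)) (c : {ffun W -> I * bool}) (H : graph D W) (w : W) :=
  if out H w is Some p then
    if (c w).2 then (q (c w).1 == Some (p.1, (c p.2).1)) && (p.1 ==> (c p.2).2)
    else (c p.2).1 == (c w).1
  else (c w).2 && (q (c w).1 == None).

Definition rooted I W (c : {ffun W -> I * bool}) (i : I) : bool :=
  #|[set w | (c w).2 & (c w).1 == i]| == 1%N.

(** The parts without a prescribed link may have any number of marked vertices: they
    are arbitrary forests, whose roots remain roots of H. *)
Definition assembles I W (q : I -> option (bool * I)) (c : {ffun W -> I * bool}) (H : graph D W) : bool :=
  [forall w, link_ok q c H w] && [forall i, (q i != None) ==> rooted c i].

(** With one marked vertex in every part, c exhibits H as the result of inserting an
    aromatic tree at each vertex of Q, and the marked vertices are the roots of the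
    inserted trees. *)
Definition covers I W (Q : graph D I) (c : {ffun W -> I * bool}) (H : graph D W) : bool :=
  [forall w, link_ok (out Q) c H w] && [forall i, rooted c i].

Lemma rootedP I W (c : {ffun W -> I * bool}) i :
  reflect (exists2 w, (c w).2 /\ (c w).1 = i & forall w', (c w').2 -> (c w').1 = i -> w' = w)
          (rooted c i).
Proof.
apply: (iffP cards1P) => [[w e]|[w [h1 h2] u]].
  have : w \in [set w] by rewrite inE.
  rewrite -e inE => /andP[h1 /eqP h2]; exists w => // w' h3 h4.
  by apply/set1P; rewrite -e inE h3 h4 eqxx.
exists w; apply/setP=> w'; rewrite !inE; apply/andP/eqP => [[h3 /eqP h4]|->]; first exact: u.
by rewrite h1 h2.
Qed.

Lemma link_ok_closed I W (q : I -> option (bool * I)) (c : {ffun W -> I * bool}) (H : graph D W) w :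
  link_ok q c H w -> closed_at (base c) (sever H (marked c)) w.
Proof.
rewrite /link_ok /closed_at out_sever; case: (out H w) => // p.
by rewrite inE; case: (c w).2 => //=; case: (_ && _).
Qed.

Lemma lmap_eqE (V W : eqType) (g : V -> W) l l' :
  injective g -> (lmap g l == lmap g l') = (l == l').
Proof. by move=> ig; apply: inj_eq; exact: lmap_inj. Qed.

Variables (R : comPzSemiRingType) (b : D -> aforest D -> R).

Definition weight I W (Q : graph D I) (c : {ffun W -> I * bool}) (H : graph D W) : R :=
  \prod_i b (dec Q i) (forest_class (part (base c) i (sever H (marked c)))).

Definition cover_sum I W (Q : graph D I) (H : graph D W) : R :=
  \sum_(c : {ffun W -> I * bool} | covers Q c H) weight Q c H.

(** Covering is a condition on each vertex of H and on each vertex of G, and the weight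
    is a product over the vertices of G; so everything factors over the parts. *)
Lemma cover_sum_parts I V W (rW : W -> I) (rV : V -> I) (H : graph D W) (G : graph D V) :
    (forall w, closed_at rW H w) -> (forall v, closed_at rV G v) ->
  \prod_i cover_sum (part rV i G) (part rW i H) =
  \sum_(c : {ffun W -> V * bool} | covers G c H && [forall w, rV (c w).1 == rW w])
    weight G c H.
Proof.
move=> cH cG.
have rH i := part_relabels (fun w (_ : rW w = i) => cH w).
have rG i := part_relabels (fun w (_ : rV w = i) => cG w).
pose F i (g : {ffun {w | rW w == i} -> {v | rV v == i} * bool}) : R :=
  if covers (part rV i G) g (part rW i H) then weight (part rV i G) g (part rW i H) else 0.
pose ok (i : I) (c : {ffun W -> V * bool}) :=
  [forall w, (rW w == i) ==> link_ok (out G) c H w] && [forall v, (rV v == i) ==> rooted c v].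
pose wt v (c : {ffun W -> V * bool}) :=
  b (dec G v) (forest_class (part (base c) v (sever H (marked c)))).
pose G_ i (c : {ffun W -> V * bool}) : R := if ok i c then \prod_(v | rV v == i) wt v c else 0.
have FE i (g : {ffun {w | rW w == i} -> {v | rV v == i} * bool}) (c : {ffun W -> V * bool}) :
    (forall w, rV (c w).1 = rW w) ->
    (forall w, c (val w) = (val (g w).1, (g w).2)) -> F i g = G_ i c.
  move=> ov e.
  have lE w : link_ok (out (part rV i G)) g (part rW i H) w = link_ok (out G) c H (val w).
    have /relabelsP[_ o1] := rH i; have /relabelsP[_ o2] := rG i.
    rewrite /link_ok o1; case: (out _ w) => [[s y]|] /=; rewrite !e /= o2.
      case: (g w).2 => //; congr (_ && _).
      by rewrite -(lmap_eqE _ _ val_inj).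
    by rewrite -(lmap_eqE _ _ val_inj).
  have rE v : rooted g v = rooted c (val v).
    rewrite /rooted -(card_imset _ val_inj); congr (_ == _%N).
    apply: eq_card => w; apply/imsetP/idP => [[w']|].
      by rewrite !inE => /andP[h /eqP h2] ->; rewrite e /= h h2 eqxx.
    rewrite inE => /andP[h /eqP h2].
    have hw : rW w == i by rewrite -ov h2; exact: (valP v).
    exists (exist _ w hw) => //; rewrite inE.
    have := e (exist _ w hw) => /= ew; move: h h2; rewrite ew /= => -> h2.
    by apply/eqP/val_inj.
  have okE : covers (part rV i G) g (part rW i H) = ok i c.
    congr (_ && _).
      apply/forallP/forallP => h w; last by rewrite lE; apply: (implyP (h _)); exact: (valP w).
      by apply/implyP => hw; have := h (exist _ w hw); rewrite lE.
    apply/forallP/forallP => h v; last by rewrite rE; apply: (implyP (h _)); exact: (valP v).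
    by apply/implyP => hv; have := h (exist _ v hv); rewrite rE.
  rewrite /F /G_ okE; case: ifP => // okc.
  rewrite -big_sig; apply: eq_bigr => v _; rewrite /wt.
  have /relabelsP[dG _] := rG i; rewrite dG; congr (b _ _).
  move: (okc) => /andP[/forallP okw _]; move: okE; rewrite okc => /andP[/forallP okw' _].
  have /relabelsP[dH oH] := rH i.
  apply: (@part_iso _ _ _ _ _ _ _ _ _ _ _ val val_inj) => /=.
  - by move=> w; rewrite /base e /= => ->.
  - move=> w; rewrite /base => ew.
    have hw : rW w == i by rewrite -ov ew; exact: (valP v).
    exists (exist _ w hw) => //; apply: val_inj; rewrite /= -ew.
    by have /= -> := e (exist _ w hw).
  - by move=> w _; apply: link_ok_closed (okw' w).
  - move=> w ew; suff /link_ok_closed : link_ok (out G) c H w by []; apply: (implyP (okw w)).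
    by rewrite -ov -/(base c w) ew; exact: (valP v).
  - apply/relabelsP; split=> w; first by rewrite !dec_sever dH.
    rewrite !out_sever oH; case: (out _ w) => [[s y]|] //=.
    by rewrite !inE !e /=; case: ifP.
transitivity (\prod_i \sum_(g : {ffun {w | rW w == i} -> {v | rV v == i} * bool}) F i g).
  by apply: eq_bigr => i _; rewrite [LHS]big_mkcond.
rewrite (big_over FE) [LHS]big_mkcond [RHS]big_mkcond; apply: eq_bigr => c _.
rewrite andbC; case: ifP => //= _.
have -> : covers G c H = [forall i, ok i c].
  apply/andP/forallP => [[/forallP h1 /forallP h2] i|h].
    by apply/andP; split; apply/forallP => x; apply/implyP.
  split; apply/forallP => x.
    by have /andP[/forallP /(_ x)] := h (rW x); rewrite eqxx.
  by have /andP[_ /forallP /(_ x)] := h (rV x); rewrite eqxx.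
case: (boolP [forall i, ok i c]) => [/forallP h|/forallPn[i nok]]; last first.
  by rewrite (bigD1 i) //= /G_ (negbTE nok) mul0r.
rewrite /weight (partition_big rV predT) //=; apply: eq_bigr => i _.
by rewrite /G_ h.
Qed.

End Covers.

(** * Associativity of substitution *)

Section Assoc.
Variable D : finType.
Implicit Types I U V W : finType.

(** P is obtained from P0 by linking roots along q, where r sends a vertex to its part:
    the links of P that are not links of P0 start from the roots of P0. *)
Definition joined I V (q : I -> option (bool * I)) (r : V -> I) (P0 P : graph D V) : bool :=
  (sever P (roots P0) == P0) && assembles q [ffun v => (r v, v \in roots P0)] P.

Section Fix.
Variables (I V W : finType) (q : I -> option (bool * I)) (r : V -> I) (P0 : graph D V) (H : graph D W).
Variable c : {ffun W -> V * bool}.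

Let c' : {ffun W -> I * bool} := [ffun w => (r (c w).1, (c w).2 && ((c w).1 \in roots P0))].

Let rootsE v : (v \in roots P0) = (out P0 v == None).
Proof. by rewrite out_root. Qed.

Lemma joined_out P : joined q r P0 P -> forall v, out P0 v =
  if out P v is Some p then
    if (v \in roots P0) || (p.1 && (p.2 \in roots P0)) then None else Some p
  else None.
Proof. by case/andP=> /eqP e _ v; rewrite -{1}e out_sever. Qed.

(** If H covers P, and P is joined from P0, then H is assembled in the same way: its
    marks are the roots of the trees inserted at the roots of P0. *)
Lemma joined_covers P : joined q r P0 P -> covers P c H ->
  assembles q c' H && covers P0 c (sever H (marked c')).
Proof.
move=> jP; have oP := joined_out jP; case/andP: jP => _ /andP[/forallP as1 /forallP as2].
case/andP=> /forallP lk /forallP rt.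
have as1' v := as1 v; rewrite /link_ok in as1'.
have lk' w := lk w; rewrite /link_ok in lk'.
apply/andP; split; apply/andP; split; apply/forallP.
- move=> w; rewrite /link_ok !ffunE /=.
  have := lk' w; case eH: (out H w) => [[s y]|] /=.
    rewrite !ffunE /=.
    case cw: (c w).2 => /=.
      case/andP=> /eqP eP hs; have := as1' (c w).1; rewrite eP !ffunE /=.
      case: ifP => // _ /andP[/eqP -> hs']; rewrite eqxx /=.
      by case: (s) hs hs' => //= -> ->.
    by move/eqP=> ->.
  case/andP=> -> /eqP eP; have := as1' (c w).1; rewrite eP !ffunE /=.
  by case/andP=> -> ->.
- move=> i; apply/implyP => nQ; have /rootedP[v [h1 h2] u] := implyP (as2 i) nQ.
  rewrite !ffunE /= in h1 h2.
  have /rootedP[w [h3 h4] u'] := rt v; apply/rootedP; exists w.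
    by rewrite ffunE /= h3 h4.
  move=> w'; rewrite ffunE /= => /andP[h5 h6] h7; apply: u' => //.
  by apply: u; rewrite ffunE.
- move=> w; rewrite /link_ok out_sever !in_marked !ffunE /=.
  have := lk' w; case eH: (out H w) => [[s y]|] /=; last first.
    by case/andP=> -> /eqP eP /=; rewrite oP eP.
  rewrite !in_marked !ffunE; case cw: (c w).2 => /=.
    case/andP=> /eqP eP hs; rewrite oP eP /=.
    have -> : s && ((c y).2 && ((c y).1 \in roots P0)) = s && ((c y).1 \in roots P0).
      by case: (s) hs => //= ->.
    by case: ifP => // _; rewrite eqxx.
  move=> ec; case: ifP => //= /andP[es /andP[cy cyr]].
  rewrite /is_true in es; subst s; have := lk' y; rewrite (out_sym eH) cy /= => /andP[_]; by rewrite cw.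
- exact: rt.
Qed.

(** The links of P are the images of the links of the marked vertices of H. *)
Lemma joined_unique P P' :
  joined q r P0 P -> covers P c H -> joined q r P0 P' -> covers P' c H -> P = P'.
Proof.
move=> jP /andP[/forallP lP /forallP rP] jP' /andP[/forallP lP' _].
apply: graph_ext => v.
  case/andP: jP => /eqP e _; case/andP: jP' => /eqP e' _.
  by rewrite -(dec_sever P (roots P0)) -(dec_sever P' (roots P0)) e e'.
have /rootedP[w [h1 <-] _] := rP v; have := lP w; have := lP' w; rewrite /link_ok h1.
by case: (out H w) => [[s y]|] /= => [/andP[/eqP -> _] /andP[/eqP -> _]|/eqP -> /eqP ->].
Qed.

(** The marks are forced: they are the roots that appear when the links between the
    parts are severed, and these lie over the roots of P0. *)
Lemma assembled_unique (chi : {ffun W -> I * bool}) :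
    assembles q chi H -> covers P0 c (sever H (marked chi)) ->
    (forall w, r (c w).1 = (chi w).1) ->
  chi = c'.
Proof.
case/andP=> /forallP as1 _ /andP[/forallP lk _] ov; apply/ffunP=> w.
rewrite ffunE ov [LHS]surjective_pairing; congr (_, _).
have := lk w; rewrite /link_ok out_sever in_marked.
have := as1 w; rewrite /link_ok; case eH: (out H w) => [[s y]|] /=; last first.
  by case/andP=> -> _ /andP[-> h]; rewrite rootsE h.
rewrite in_marked; case cw: (chi w).2 => /=.
  by move=> _ /andP[-> h]; rewrite rootsE h.
move=> _; case: ifP => [/andP[es cy]|_].
  rewrite /is_true in es; subst s; have := as1 y; rewrite /link_ok (out_sym eH) cy /=.
  by rewrite cw andbF.
by case: (c w).2 => //=; rewrite rootsE => /andP[/eqP -> _].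
Qed.

Hypothesis asQ : assembles q c' H.
Hypothesis cov : covers P0 c (sever H (marked c')).

Let stolon_marked w y : (c w).2 -> out H w = Some (true, y) -> (c y).2.
Proof.
move=> cw eH; case/andP: asQ => /forallP as1 _; case/andP: cov => /forallP lk _.
have := as1 w; rewrite /link_ok eH !ffunE /= cw /=.
case: ifP => [_ /andP[_ /andP[] //]|nr _].
have := lk w; rewrite /link_ok out_sever eH !in_marked !ffunE cw nr /=.
by case: ifP => [/andP[] //|_ /= /andP[_]].
Qed.

Let root_at v : exists2 w, (c w).2 /\ (c w).1 = v & forall w', (c w').2 -> (c w').1 = v -> w' = w.
Proof. by case/andP: cov => _ /forallP /(_ v) /rootedP. Qed.

(** The links that a graph covered by H must have. *)
Let lnk v : option (bool * V) :=
  if [pick w | (c w).2 && ((c w).1 == v)] is Some w then lmap (base c) (out H w) else None.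

Let lnkE w : (c w).2 -> lnk (c w).1 = lmap (base c) (out H w).
Proof.
move=> cw; rewrite /lnk; case: pickP => [w' /andP[h1 /eqP h2]|/(_ w)]; last first.
  by rewrite cw eqxx.
have [x _ u] := root_at (c w).1.
by rewrite (u w' h1 h2) (u w cw).
Qed.

Let lnk_sym v z : lnk v = Some (true, z) -> (v != z) /\ lnk z = Some (true, v).
Proof.
have [x [h1 <-] u] := root_at v; rewrite lnkE //.
case eH: (out H x) => [[[] y]|] //= [<-]; have cy := stolon_marked h1 eH.
split; last by rewrite lnkE // (out_sym eH).
apply: contra (out_irr eH) => /eqP e; apply/eqP/esym/u => //.
Qed.

Lemma joined_exists : exists2 P, joined q r P0 P & covers P c H.
Proof.
case/andP: asQ => /forallP as1 /forallP as2; case/andP: (cov) => /forallP lk /forallP rt.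
pose P := build (dec P0) lnk_sym.
have oP w : (c w).2 -> out P (c w).1 = lmap (base c) (out H w).
  by move=> cw; rewrite out_build lnkE.
exists P.
  apply/andP; split; last (apply/andP; split; apply/forallP).
  - apply/eqP/graph_ext => v; first by rewrite dec_sever dec_build.
    have [w [h1 <-] _] := root_at v; rewrite out_sever oP //.
    have := lk w; rewrite /link_ok out_sever !in_marked !ffunE h1 /=.
    case eH: (out H w) => [[s y]|] /=; last by move/eqP->.
    rewrite !in_marked !ffunE; case: ifP => /= h; last first.
      case/andP=> /eqP -> hs; rewrite ifN //.
      move/negbT: h; rewrite !negb_or => /andP[-> /=].
      by case: (s) hs => //= ->.
    move=> e; rewrite ifT ?(eqP e) //.
    by case/orP: h => [->//|/andP[-> /andP[_ ->]]]; rewrite orbT.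
  - move=> v; have [w [h1 <-] _] := root_at v; rewrite /link_ok oP // !ffunE /=.
    have := as1 w; rewrite /link_ok !ffunE h1 /=; case eH: (out H w) => [[s y]|] /=.
      rewrite !ffunE /=; case: ifP => // _ /andP[-> /=].
      by case: (s) => //= /andP[].
    by case/andP=> -> ->.
  - move=> i; apply/implyP => nQ; have /rootedP[w [h1 h2] u] := implyP (as2 i) nQ.
    rewrite !ffunE /= in h1 h2; case/andP: h1 => h1 h3.
    apply/rootedP; exists (c w).1; first by rewrite ffunE.
    move=> v; rewrite ffunE /= => hv rv; have [w' [h4 h5] _] := root_at v.
    by rewrite -h5; congr (c _).1; apply: u; rewrite ffunE /= h5 ?h4.
apply/andP; split; apply/forallP; last exact: rt.
move=> w; rewrite /link_ok; case eH: (out H w) => [[s y]|] /=.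
  case cw: (c w).2.
    rewrite oP // eH eqxx /=; apply/implyP => es; rewrite /is_true in es; subst s.
    exact: stolon_marked eH.
  have := lk w; rewrite /link_ok out_sever eH !in_marked !ffunE cw /=.
  by case: ifP.
have := as1 w; rewrite /link_ok eH !ffunE /= => /andP[/andP[cw _] _].
by rewrite cw oP // eH.
Qed.

End Fix.

Variables (R : comPzSemiRingType) (b : D -> aforest D -> R).

(** Associativity of substitution. For a fixed covering map c, at most one joined graph
    P and at most one assembly structure chi are compatible with c, and one exists if
    and only if the other does. *)
Lemma cover_sum_joined I V W (q : I -> option (bool * I)) (r : V -> I) (P0 : graph D V) (H : graph D W) :
  \sum_(P | joined q r P0 P) cover_sum b P H =
  \sum_(chi : {ffun W -> I * bool} | assembles q chi H)
    \sum_(c : {ffun W -> V * bool} | covers P0 c (sever H (marked chi)) &&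
                                     [forall w, r (c w).1 == (chi w).1])
      weight b P0 c (sever H (marked chi)).
Proof.
rewrite /cover_sum.
transitivity (\sum_(c : {ffun W -> V * bool}) \sum_(P | joined q r P0 P && covers P c H)
   weight b P c H).
  by rewrite (exchange_big_dep predT).
rewrite [RHS](exchange_big_dep predT) //=; apply: eq_bigr => c _.
pose c' : {ffun W -> I * bool} := [ffun w => (r (c w).1, (c w).2 && ((c w).1 \in roots P0))].
have uc' (chi : {ffun W -> I * bool}) :
    assembles q chi H && (covers P0 c (sever H (marked chi)) &&
      [forall w, r (c w).1 == (chi w).1]) -> chi = c'.
  case/and3P=> h1 h2 /forallP h3; apply: assembled_unique h1 h2 _ => w; exact/eqP/h3.
case: (pickP [pred P | joined q r P0 P && covers P c H]) => [P /= /andP[jP cP]|nP].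
  have /andP[h1 h2] := joined_covers jP cP.
  rewrite (big_pred1 P); last first.
    move=> P'; apply/andP/eqP => [[jP' cP']|->//]; exact: joined_unique jP' cP' jP cP.
  rewrite (big_pred1 c'); last first.
    move=> chi; apply/idP/eqP => [|->]; first exact: uc'.
    rewrite h1 h2 /=; apply/forallP => w; by rewrite ffunE.
  rewrite /weight; apply: eq_bigr => v _.
  rewrite sever_sever; last by apply/subsetP=> w; rewrite !in_marked ffunE => /andP[].
  by case/andP: jP => /eqP <- _.
rewrite [LHS]big_pred0 // big_pred0 // => chi; apply/negP => h.
have e := uc' _ h; subst chi; case/and3P: h => h1 h2 _.
by have [P jP cP] := joined_exists h1 h2; have := nP P; rewrite /= jP cP.
Qed.

(** The gluing rule for covering sums: the graphs joined from P0 along q have the same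
    covering sums, in total, as the pieces of P0 on the pieces of H. *)
Lemma cover_sum_assembles I V W (q : I -> option (bool * I)) (r : V -> I) (P0 : graph D V) (H : graph D W) :
    (forall v, closed_at r P0 v) ->
  \sum_(P | joined q r P0 P) cover_sum b P H =
  \sum_(chi : {ffun W -> I * bool} | assembles q chi H)
    \prod_i cover_sum b (part r i P0) (part (base chi) i (sever H (marked chi))).
Proof.
move=> clP; rewrite cover_sum_joined; apply: eq_bigr => chi /andP[/forallP as1 _].
rewrite (@cover_sum_parts _ _ b _ _ _ (base chi) r) // => w.
exact: link_ok_closed (as1 w).
Qed.

End Assoc.

Section Transport.
Variable D : finType.
Implicit Types I S U V W : finType.

Lemma relabels_sever V W (g : W -> V) (H : graph D W) (G : graph D V) (B : {set W}) (C : {set V}) :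
    (forall w, (w \in B) = (g w \in C)) ->
  relabels g H G -> relabels g (sever H B) (sever G C).
Proof.
move=> e /relabelsP[d o]; apply/relabelsP; split=> w; first by rewrite !dec_sever d.
rewrite !out_sever o; case: (out H w) => [[s y]|] //=; rewrite !e.
by case: ifP.
Qed.

Lemma relabels_roots V W (g : W -> V) (H : graph D W) (G : graph D V) w :
  relabels g H G -> (g w \in roots G) = (w \in roots H).
Proof. by move=> /relabelsP[_ o]; rewrite -!out_root o; case: (out H w). Qed.

Lemma relabels_assembles I V W (q : I -> option (bool * I)) (g : W -> V) (h : V -> W)
    (H : graph D W) (G : graph D V) (c : {ffun V -> I * bool}) (c' : {ffun W -> I * bool}) :
    cancel g h -> cancel h g -> relabels g H G -> (forall w, c' w = c (g w)) ->
  assembles q c' H = assembles q c G.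
Proof.
move=> gK hK /relabelsP[_ o] e; congr (_ && _).
  have lE w : link_ok q c' H w = link_ok q c G (g w).
    by rewrite /link_ok o !e; case: (out H w) => [[s y]|] //=; rewrite !e.
  apply/forallP/forallP => l v; last by rewrite lE.
  by rewrite -[v]hK -lE.
apply: eq_forallb => i; congr (_ ==> _); rewrite /rooted; congr (_ == _%N).
rewrite -(card_imset _ (can_inj gK)); apply: eq_card => v; apply/imsetP/idP => [[w]|].
  by rewrite !inE e => ? ->.
by rewrite inE => h1; exists (h v); rewrite ?inE ?e ?hK.
Qed.

Lemma assembles_roots I W (q : I -> option (bool * I)) (c : {ffun W -> I * bool}) (H : graph D W) :
  assembles q c H -> roots (sever H (marked c)) = marked c.
Proof.
case/andP=> /forallP as1 _; apply/setP=> w; rewrite -out_root out_sever in_marked.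
have := as1 w; rewrite /link_ok; case eH: (out H w) => [[s y]|] /=; last first.
  by case/andP=> ->.
rewrite in_marked; case cw: (c w).2 => //= _.
case: ifP => // /andP[es cy]; rewrite /is_true in es; subst s.
have := as1 y; by rewrite /link_ok (out_sym eH) cy /= cw andbF.
Qed.

(** Relabelling along a bijection g onto the vertices of H leaves no choice: the joined
    graph K is the pull-back of H, and chi is the image of the parts and roots of B. *)
Lemma card_joined_isos I S W (q : I -> option (bool * I)) (r : S -> I)
    (B : graph D S) (H : graph D W) :
  (\sum_(K | joined q r B K) #|isos K H| =
   \sum_(chi : {ffun W -> I * bool} | assembles q chi H)
     #|[set g in isos B (sever H (marked chi)) | [forall s, base chi (g s) == r s]]|)%N.
Proof.
transitivity (\sum_(g : {ffun S -> W}) \sum_(K | joined q r B K && (g \in isos K H)) 1)%N.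
  rewrite [RHS](exchange_big_dep (fun K => joined q r B K)) /=; last by move=> ? ? _ /andP[].
  apply: eq_bigr => K jK; rewrite -sum1_card; apply: eq_bigl => g; by rewrite jK.
transitivity (\sum_(g : {ffun S -> W})
    \sum_(chi : {ffun W -> I * bool} | assembles q chi H &&
       (g \in [set g in isos B (sever H (marked chi)) | [forall s, base chi (g s) == r s]])) 1)%N;
  last first.
  rewrite [LHS](exchange_big_dep (fun chi => assembles q chi H)) /=; last by move=> ? ? _ /andP[].
  by apply: eq_bigr => chi jK; rewrite -sum1_card; apply: eq_bigl => g; rewrite jK.
apply: eq_bigr => g _.
case: (boolP (injectiveb g && (#|W| <= #|S|)%N)) => [/andP[/injectiveP ig0 le]|ng]; last first.
  rewrite !big_pred0 // => x; apply/negP => /andP[_]; rewrite inE.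
    by case/andP; rewrite inE => /and3P[h1 h2 _] _; rewrite h1 h2 in ng.
  by case/and3P=> h1 h2 _; rewrite h1 h2 in ng.
have bg := inj_card_bij ig0 le.
have [h gK hK] := bg; have ig := can_inj gK.
(* The only candidates for the two sums. *)
pose K0 := pull ig H; have rK0 : relabels g K0 H := pull_relabels_bij ig H hK.
pose chi0 : {ffun W -> I * bool} := [ffun w => (r (h w), h w \in roots B)].
have asE : assembles q [ffun v => (r v, v \in roots B)] K0 = assembles q chi0 H.
  by apply: (relabels_assembles q gK hK rK0) => s; rewrite !ffunE gK.
have rs : relabels g (sever K0 (roots B)) (sever H (marked chi0)).
  by apply: relabels_sever rK0 => s; rewrite in_marked ffunE gK.
have jE : joined q r B K0 = assembles q chi0 H && relabels g B (sever H (marked chi0)).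
  rewrite /joined asE andbC; congr (_ && _); apply/eqP/idP => [<- //|rB].
  exact: relabels_inj ig rs rB.
have lhs K : joined q r B K && (g \in isos K H) = (K == K0) && joined q r B K0.
  apply/andP/andP => [[jK /isosP[_ rK]]|[/eqP -> ->]]; last by split=> //; apply/isosP.
  by rewrite -(relabels_inj ig rK rK0) eqxx.
have rhs chi : assembles q chi H &&
    (g \in [set g in isos B (sever H (marked chi)) | [forall s, base chi (g s) == r s]])
    = (chi == chi0) && joined q r B K0.
  rewrite jE inE; apply/and3P/and3P; last first.
    case=> /eqP -> h1 h2; split=> //; first exact/isosP.
    by apply/forallP=> s; rewrite /base ffunE gK.
  case=> as1 /isosP[_ rB] /forallP h1.
  suff e : chi = chi0 by rewrite -e.
  apply/ffunP=> w; rewrite ffunE [LHS]surjective_pairing -[w]hK gK.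
  rewrite -(relabels_roots _ rB) (assembles_roots as1) in_marked.
  by have /eqP := h1 (h w); rewrite /base => ->.
rewrite (eq_bigl _ _ lhs) (eq_bigl _ _ rhs).
by case: (joined _ _ _ _); [under eq_bigl do rewrite andbT; under [RHS]eq_bigl do rewrite andbT;
  rewrite !big_pred1_eq | rewrite !big_pred0 // => x; rewrite andbF].
Qed.

End Transport.

(** * Gluing classes and gluing labelled graphs *)

Section Models.
Variable D : finType.
Implicit Types I S U V W : finType.

Lemma joined_relabels I S V (q : I -> option (bool * I)) (g : S -> V) (h : V -> S)
    (r : S -> I) (r' : V -> I) (B K : graph D S) (P0 P : graph D V) :
    cancel g h -> cancel h g -> relabels g B P0 -> relabels g K P ->
    (forall s, r' (g s) = r s) ->
  joined q r B K = joined q r' P0 P.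
Proof.
move=> gK hK rB rK e; congr (_ && _); last first.
  by apply: (relabels_assembles q gK hK rK) => s; rewrite !ffunE e (relabels_roots _ rB).
have rs : relabels g (sever K (roots B)) (sever P (roots P0)).
  by apply: relabels_sever rK => s; rewrite (relabels_roots _ rB).
apply/eqP/eqP => e'.
  by apply: (relabels_surj hK rs); rewrite e'.
by apply: (relabels_inj (can_inj gK) rs); rewrite e'.
Qed.

Lemma sigma_gt0 (p : aforest D) : (0 < sigma p)%N.
Proof.
rewrite -card_isos_rep; apply/card_gt0P; exists [ffun x => x].
apply/isos_ffunP; split; [by exists id | exact: relabels_id].
Qed.

(** A sum over joined graphs depends only on the classes of the parts: graphs with
    isomorphic parts are isomorphic over I, because by [card_isos_over] the number of
    isomorphisms over I is a product of positive numbers. *)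
Lemma big_joined_iso (M : Type) (idx : M) (op : Monoid.com_law idx) I S V
    (q : I -> option (bool * I)) (r : S -> I) (r' : V -> I) (B : graph D S) (P0 : graph D V)
    (F : aforest D -> M) :
    (forall s, closed_at r B s) -> (forall v, closed_at r' P0 v) ->
    (forall i, forest_class (part r i B) = forest_class (part r' i P0)) ->
  \big[op/idx]_(K | joined q r B K) F (forest_class K) =
  \big[op/idx]_(P | joined q r' P0 P) F (forest_class P).
Proof.
move=> cB cP e.
have /card_gt0P[g] : (0 < #|[set g in isos B P0 | [forall s, r' (g s) == r s]]|)%N.
  rewrite card_isos_over // prodn_gt0 // => i.
  by rewrite card_isos e eqxx mul1n sigma_gt0.
rewrite inE => /andP[/isosP[[h gK hK] rB] /forallP ov].
have ig := can_inj gK; have ih := can_inj hK.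
have rg (P : graph D V) : relabels g (pull ig P) P := pull_relabels_bij ig P hK.
have rh (K : graph D S) : relabels h (pull ih K) K := pull_relabels_bij ih K gK.
rewrite (reindex (fun P => pull ig P)) /=.
  apply: eq_big => [P|P _].
    by apply: (joined_relabels q gK hK rB (rg P)) => s; apply/eqP.
  by congr F; apply: forest_class_iso (rg P); exists h.
apply: onW_bij; exists (fun K => pull ih K) => K.
  apply: (relabels_inj ih (rh _)); exact: relabels_can (rg K).
apply: (relabels_inj ig (rg _)); exact: relabels_can (rh K).
Qed.

Variable R : realType.

Lemma of_upto_inj N : injective (@of_upto D N).
Proof.
move=> [[n hn] p] [[m hm] p']; rewrite /of_upto /= => e.
have e1 : n = m by have := congr1 (@tag _ _) e.
subst m; rewrite (eq_irrelevance hn hm) in p p' e *.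
by rewrite (eq_from_Tagged e).
Qed.

Lemma of_uptoP N (h : aforest D) : (nvertices h <= N)%N -> exists q : upto D N, of_upto q = h.
Proof.
rewrite -ltnS => hN; case: h hN => n p hN.
by exists (Tagged (fun n : 'I_N.+1 => forest D n) (i := Ordinal hN) p).
Qed.

Lemma nvertices_upto N (q : upto D N) : (nvertices (of_upto q) <= N)%N.
Proof. by case: q => [[n hn] p]. Qed.

Lemma sum_upto N (h : aforest D) (F : aforest D -> R) :
  \sum_(q : upto D N) F (of_upto q) * (of_upto q == h)%:R =
  if (nvertices h <= N)%N then F h else 0.
Proof.
case: ifP => [/of_uptoP[q0 <-]|hN].
  rewrite (bigD1 q0) //= eqxx mulr1 big1 ?addr0 // => q nq.
  by rewrite (inj_eq (@of_upto_inj N)) (negbTE nq) mulr0.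
rewrite big1 // => q _; case: eqP => [e|]; last by rewrite mulr0.
by have := nvertices_upto q; rewrite e hN.
Qed.

Section Model.
Variables (I : finType) (S : (I -> aforest D) -> finType).
Variables (r : forall p, S p -> I) (B : forall p, graph D (S p)).
Arguments r : clear implicits.
Hypothesis clB : forall p s, closed_at (r p) (B p) s.
Hypothesis ptB : forall p i, forest_class (part (r p) i (B p)) = p i.

Definition forests N (f : {ffun I -> upto D N}) (i : I) : aforest D := of_upto (f i).

(** Replaces sums over families of classes, weighted by the number of ways to join
    them into H, by sums over the ways to decompose the labelled graph H. Each family
    of classes is counted with the automorphisms of its members, which turns the
    coefficients [X i p] into [X i p * sigma p]. *)
Lemma sum_joined_classes (q : I -> option (bool * I)) (X : I -> aforest D -> R) W (H : graph D W) :
  (\sum_(f : {ffun I -> upto D #|W|}) (\prod_i X i (of_upto (f i))) *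
     \sum_(K | joined q (r (forests f)) (B (forests f)) K)
        (forest_class H == forest_class K)%:R) * (sigma (forest_class H))%:R =
  \sum_(chi : {ffun W -> I * bool} | assembles q chi H)
    \prod_i (X i (forest_class (part (base chi) i (sever H (marked chi)))) *
             (sigma (forest_class (part (base chi) i (sever H (marked chi)))))%:R).
Proof.
rewrite mulr_suml.
pose h (chi : {ffun W -> I * bool}) i := forest_class (part (base chi) i (sever H (marked chi))).
(* The families that decompose H are those of the classes of its own parts. *)
have step (f : {ffun I -> upto D #|W|}) :
   (\sum_(K | joined q (r (forests f)) (B (forests f)) K)
        (forest_class H == forest_class K)%:R) * (sigma (forest_class H))%:R =
   \sum_(chi : {ffun W -> I * bool} | assembles q chi H)
      \prod_i ((of_upto (f i) == h chi i)%:R * (sigma (h chi i))%:R) :> R.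
  rewrite mulr_suml.
  transitivity ((\sum_(K | joined q (r (forests f)) (B (forests f)) K) #|isos K H|)%N%:R : R).
    rewrite natr_sum; apply: eq_bigr => K _; rewrite card_isos natrM eq_sym.
    by case: eqP.
  rewrite card_joined_isos natr_sum; apply: eq_bigr => chi /andP[/forallP as1 _].
  rewrite card_isos_over //; last by move=> w; exact: link_ok_closed (as1 w).
  rewrite natr_prod; apply: eq_bigr => i _; rewrite card_isos natrM ptB.
  by rewrite /h.
under eq_bigr => f _ do rewrite -mulrA step mulr_sumr.
rewrite exchange_big /=; apply: eq_bigr => chi _.
under eq_bigr => f _ do rewrite -big_split /=.
rewrite -(bigA_distr_bigA (fun i (x : upto D #|W|) =>
  X i (of_upto x) * ((of_upto x == h chi i)%:R * (sigma (h chi i))%:R))).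
apply: eq_bigr => i _; rewrite -/(h chi i).
under eq_bigr => x _ do rewrite mulrA.
rewrite -mulr_suml sum_upto nvertices_class ifT //.
by rewrite card_sig max_card.
Qed.

Variable A : aforest D -> formal_series R D.

(** The normalisation under which multilinear extensions become sums over the
    decompositions of a labelled graph, by [sum_joined_classes]. *)
Definition coefA V W (P : graph D V) (H : graph D W) : R :=
  A (forest_class P) (forest_class H) * (sigma (forest_class H))%:R.

(** The gluing rule of A for the pattern q: A commutes with the operation that joins
    forests along q. Here [B p] stands for the disjoint union of the family p, since
    the elementary operations use two different constructions of it. *)
Definition preserves_assembly (q : I -> option (bool * I)) (t : I -> aforest D) : Prop :=
  forall h, \sum_(K | joined q (r t) (B t) K) A (forest_class K) h =
    \sum_(f : {ffun I -> upto D (nvertices h)}) (\prod_i A (t i) (of_upto (f i))) *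
      \sum_(K | joined q (r (forests f)) (B (forests f)) K) (h == forest_class K)%:R.

(** The same rule on labelled graphs; it has the shape of [cover_sum_assembles]. *)
Lemma coefA_assembles V W (q : I -> option (bool * I)) (r' : V -> I) (P0 : graph D V) (H : graph D W) :
    (forall v, closed_at r' P0 v) ->
    preserves_assembly q (fun i => forest_class (part r' i P0)) ->
  \sum_(P | joined q r' P0 P) coefA P H =
  \sum_(chi : {ffun W -> I * bool} | assembles q chi H)
    \prod_i coefA (part r' i P0) (part (base chi) i (sever H (marked chi))).
Proof.
move=> cP pA; have := sum_joined_classes q (fun i => A (forest_class (part r' i P0))) H.
move=> <-; rewrite -mulr_suml; congr (_ * _).
apply: etrans (pA (forest_class H)).
apply/esym/(@big_joined_iso _ _ +%R _ _ _ q _ r' _ P0 (fun p => A p (forest_class H))) => //.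
by move=> i; rewrite ptB.
Qed.

End Model.
End Models.

(** * Links of the elementary operations *)

Section OutOfOperations.
Variable D : finType.
Implicit Types I S U V W : finType.

Lemma out_attach V (G : graph D V) (A : {set V}) (t : V -> V) v :
  out (attach G A t) v = if (v \in roots G) && (v \in A) then Some (false, t v) else out G v.
Proof.
apply: out_unique => w.
  rewrite inE -out_edge; case: ifP => [/andP[vr vA]|n].
    have -> : out G v = None by apply/eqP; rewrite out_root.
    apply/imsetP/eqP => [[x _ [-> ->]] //|[<-]].
    by exists v => //; apply/setIP.
  rewrite orb_idr // => /imsetP[x /setIP[h1 h2] [e _]].
  by rewrite e h1 h2 in n.
rewrite -[stolons _]/(stolons G) -out_stolon; case: ifP => // /andP[vr vA].
by have /eqP -> : out G v == None by rewrite out_root.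
Qed.

Lemma out_link V (G : graph D V) v :
  out (link G) v =
  if (v \in roots G) && (#|roots G| == 2%N) then
    omap (pair true) [pick w | (w \in roots G) && (w != v)] else out G v.
Proof.
have hr w : (w \in roots G) -> out G w = None by rewrite -out_root => /eqP.
case: ifP => [/andP[vr /eqP c2]|n].
  have /cards2P[x [y [nxy e]]] : #|roots G| == 2%N by rewrite c2.
  have [z [zv rz]] : exists z, z != v /\ roots G = [set v; z].
    move: vr; rewrite e !inE => /orP[]/eqP ->; [exists y|exists x].
      by rewrite eq_sym.
    by rewrite setUC.
  have rzE w : (w \in roots G) = (w == v) || (w == z) by rewrite rz !inE.
  case: pickP => [z' /andP[h1 h2]|/(_ z)]; last by rewrite /= rzE eqxx orbT /= => /negbT; rewrite negbK => /eqP ez; case/eqP: zv.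
  have -> /= : z' = z by apply/eqP; move: h1; rewrite rzE (negbTE h2).
  apply: out_unique => w.
    by rewrite -[edges _]/(edges G) -out_edge hr.
  have vz : v != z by rewrite eq_sym.
  rewrite inE -out_stolon hr //= !inE rz cards2.
  apply/andP/eqP => [[/eqP/setP ew _]|[<-]]; last by rewrite vz eqxx.
  have := ew z; rewrite !inE eqxx orbT (negbTE zv) /=.
  by move/eqP->.
apply: out_unique => w.
  by rewrite -[edges _]/(edges G) -out_edge.
rewrite inE -out_stolon orb_idr // !inE => /andP[/eqP ew c2].
have vr : v \in roots G by rewrite -ew !inE eqxx.
by rewrite vr -ew c2 in n.
Qed.

Lemma lmap_neq (X Y : eqType) (g : X -> Y) l s y :
  (forall x, g x != y) -> (lmap g l == Some (s, y)) = false.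
Proof. by move=> h; apply/eqP; case: l => [[t x]|] //= [_ e]; have := h x; rewrite e eqxx. Qed.

Lemma lmap_eq_some (X Y : eqType) (g : X -> Y) l s y :
  injective g -> (lmap g l == Some (s, g y)) = (l == Some (s, y)).
Proof. exact: (@lmap_eqE _ _ g l (Some (s, y))). Qed.

Lemma inl_inj (X Y : Type) : injective (@inl X Y).
Proof. by move=> ? ? []. Qed.

Lemma inr_inj (X Y : Type) : injective (@inr X Y).
Proof. by move=> ? ? []. Qed.

Lemma gsum_inl V W (G : graph D V) (H : graph D W) : relabels inl G (gsum G H).
Proof.
apply/relabelsP; split=> v; first by rewrite /dec ffunE.
apply: out_unique => w.
  case: w => w.
    rewrite (lmap_eq_some _ _ _ (@inl_inj V W)).
    rewrite out_edge inE; apply/orP/idP => [[]|h]; last by left; apply/imsetP; exists (v, w).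
      by case/imsetP=> [[x y] h [-> ->]].
    by case/imsetP=> [[x y] h []].
  rewrite lmap_neq //.
  by apply/negP; rewrite inE => /orP[] /imsetP[[x y] _ []].
case: w => w.
  rewrite (lmap_eq_some _ _ _ (@inl_inj V W)).
  rewrite out_stolon inE; apply/orP/idP => [[]|h].
  - case/imsetP=> s hs e; suff -> : [set v; w] = s by [].
    by apply: (@imset_inj _ _ (@inl V W)); [exact: inl_inj| rewrite -e imsetU1 imset_set1].
  - case/imsetP=> s hs /setP /(_ (inl v)); rewrite !inE eqxx => /esym/imsetP[? _ //].
  - by left; apply/imsetP; exists [set v; w]; rewrite // imsetU1 imset_set1.
rewrite lmap_neq //.
apply/negP; rewrite inE => /orP[] /imsetP[s _ /setP e].
  by have := e (inr w); rewrite !inE eqxx orbT => /esym/imsetP[? _ //].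
by have := e (inl v); rewrite !inE eqxx => /esym/imsetP[? _ //].
Qed.

Lemma gsum_inr V W (G : graph D V) (H : graph D W) : relabels inr H (gsum G H).
Proof.
apply/relabelsP; split=> v; first by rewrite /dec ffunE.
apply: out_unique => w.
  case: w => w.
    rewrite lmap_neq //.
    by apply/negP; rewrite inE => /orP[] /imsetP[[x y] _ []].
  rewrite (lmap_eq_some _ _ _ (@inr_inj V W)).
  rewrite out_edge inE; apply/orP/idP => [[]|h]; last by right; apply/imsetP; exists (v, w).
    by case/imsetP=> [[x y] h []].
  by case/imsetP=> [[x y] h [-> ->]].
case: w => w.
  rewrite lmap_neq //.
  apply/negP; rewrite inE => /orP[] /imsetP[s _ /setP e].
    by have := e (inr v); rewrite !inE eqxx => /esym/imsetP[? _ //].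
  by have := e (inl w); rewrite !inE eqxx orbT => /esym/imsetP[? _ //].
rewrite (lmap_eq_some _ _ _ (@inr_inj V W)).
rewrite out_stolon inE; apply/orP/idP => [[]|h].
- case/imsetP=> s hs /setP /(_ (inr v)); rewrite !inE eqxx => /esym/imsetP[? _ //].
- case/imsetP=> s hs e; suff -> : [set v; w] = s by [].
  by apply: (@imset_inj _ _ (@inr V W)); [exact: inr_inj| rewrite -e imsetU1 imset_set1].
- by right; apply/imsetP; exists [set v; w]; rewrite // imsetU1 imset_set1.
Qed.

Lemma bigsum_Tagged I (V : I -> finType) (G : forall i, graph D (V i)) i :
  relabels (Tagged V (i := i)) (G i) (bigsum G).
Proof.
have iT j : injective (@Tagged I j V) by exact: eq_from_Tagged.
apply/relabelsP; split=> v; first by rewrite /dec ffunE.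
apply: out_unique => -[j w].
  apply/bigcupP/eqP => [[k _ /imsetP[[x y] h e]]|].
    have /= e1 := congr1 fst e; have /= e2 := congr1 snd e.
    have ik : i = k by have := congr1 tag e1.
    subst k; have ex := iT _ _ _ e1; subst x.
    have ij : j = i by have := congr1 tag e2.
    subst j; have /= -> := iT i w y e2.
    by move: h; rewrite -out_edge => /eqP ->.
  case eG: (out (G i) v) => [[s y]|] //= /(@Some_inj _) e.
have /= es := congr1 fst e; have /= ey := congr1 snd e; subst s.
  exists i => //; apply/imsetP; exists (v, y); last by rewrite /= -ey.
  by rewrite -out_edge eG.
apply/bigcupP/eqP => [[k _ /imsetP[s hs e]]|].
  have [x _ ex] : exists2 x, x \in s & Tagged V v = Tagged V x.
    by apply/imsetP; rewrite -e !inE eqxx.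
  have [y _ ey] : exists2 y, y \in s & existT _ j w = Tagged V y.
    by apply/imsetP; rewrite -e !inE eqxx orbT.
  have ik : i = k by have := congr1 tag ex.
  subst k; have ej : j = i by have := congr1 tag ey.
  subst j; have /eqP -> // : out (G i) v == Some (true, w).
  rewrite out_stolon; suff -> : [set v; w] = s by [].
  by apply: (imset_inj (iT i)); rewrite -e imsetU1 imset_set1.
case eG: (out (G i) v) => [[s y]|] //= /(@Some_inj _) e.
have /= es := congr1 fst e; have /= ey := congr1 snd e; subst s.
exists i => //; apply/imsetP; exists [set v; y]; first by rewrite -out_stolon eG.
by rewrite -ey imsetU1 imset_set1.
Qed.

End OutOfOperations.

(** * Gluing patterns *)

Section JoinedOps.
Variable D : finType.
Implicit Types I S U V W : finType.

(** Joining only adds links at the roots of B, and q determines between which parts. *)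
Lemma joinedP I S (q : I -> option (bool * I)) (r : S -> I) (B K : graph D S) :
    (forall s, closed_at r B s) ->
  reflect [/\ dec K =1 dec B, forall s, s \notin roots B -> out K s = out B s,
              forall s, s \in roots B -> lmap r (out K s) = q (r s) /\
                 (forall y, out K s = Some (true, y) -> y \in roots B)
            & forall i, q i != None -> rooted [ffun v => (r v, v \in roots B)] i]
          (joined q r B K).
Proof.
move=> clB; apply: (iffP idP) => [jK|[dK oN oR rt]].
  have oB := joined_out jK; case/andP: (jK) => /eqP eB /andP[/forallP as1 /forallP as2].
  split=> [s|s nr|s sr|i]; last by move/(implyP (as2 i)).
  - by rewrite -eB.
  - have := oB s; rewrite (negbTE nr) /=; case: (out K s) => [p|//].
    by case: ifP => // _ e; move: nr; rewrite -out_root e.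
  - have := as1 s; rewrite /link_ok !ffunE sr /=; case: (out K s) => [[t y]|] /=.
      rewrite !ffunE /= => /andP[/eqP -> h]; split=> // y' [et <-].
      by move: h; rewrite et.
    by move/eqP->.
apply/andP; split.
  apply/eqP/graph_ext => s; first by rewrite dec_sever dK.
  rewrite out_sever; have [sr|nr] := boolP (s \in roots B).
    have /eqP -> : out B s == None by rewrite out_root.
    by case: (out K s) => [p|].
  rewrite oN //; case eB: (out B s) => [[[] y]|] //=.
  case: ifP => //; rewrite -out_root; by rewrite (out_sym eB).
apply/andP; split; apply/forallP; last by move=> i; apply/implyP/rt.
move=> s; rewrite /link_ok !ffunE /=; have [sr|nr] := boolP (s \in roots B).
  have [<- h] := oR _ sr; case eK: (out K s) => [[t y]|] //=.
  rewrite !ffunE /= eqxx /=; apply/implyP => et; apply: h; by rewrite eK et.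
rewrite oN //; have := clB s; rewrite /closed_at; case eB: (out B s) => [[t y]|] //=.
  by rewrite ffunE.
by move: nr; rewrite -out_root eB.
Qed.

Lemma big_joined_param (M : Type) (idx : M) (op : Monoid.com_law idx) I S (O : finType)
    (q : I -> option (bool * I)) (r : S -> I) (B : graph D S) (g : O -> graph D S)
    (F : graph D S -> M) :
    injective g -> (forall o, joined q r B (g o)) ->
    (forall K, joined q r B K -> exists o, K = g o) ->
  \big[op/idx]_(K | joined q r B K) F K = \big[op/idx]_o F (g o).
Proof.
move=> ig jg sg; transitivity (\big[op/idx]_(K in g @: setT) F K).
  apply: eq_bigl => K; apply/idP/imsetP => [/sg[o ->]|[o _ ->] //]; by exists o.
rewrite big_imset /=; last by move=> ? ? _ _; exact: ig.
by apply: eq_bigl => o; rewrite inE.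
Qed.

Lemma is_tree_class V (G : graph D V) : is_tree (forest_class G) = (#|roots G| == 1%N).
Proof.
rewrite /is_tree; have [g bg rg] := rep_of_class G; congr (_ == _%N).
rewrite -(card_imset _ (bij_inj bg)); apply: eq_card => v; apply/imsetP/idP => [[x hx ->]|hv].
  by rewrite (relabels_roots _ rg).
have [h gK hK] := bg; exists (h v); rewrite ?hK //.
by rewrite -(relabels_roots _ rg) hK.
Qed.

Lemma rooted_part I V (r : V -> I) (G : graph D V) i : (forall v, closed_at r G v) ->
  rooted [ffun v => (r v, v \in roots G)] i = is_tree (forest_class (part r i G)).
Proof.
move=> cl; have rp := part_relabels (fun v (_ : r v = i) => cl v).
rewrite is_tree_class /rooted -(card_imset _ val_inj); congr (_ == _%N); apply: eq_card => v.
apply/idP/imsetP => [|[x hx ->]].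
  rewrite inE ffunE /= => /andP[vr /eqP hv].
  exists (exist _ v (introT eqP hv)) => //.
  by rewrite -(relabels_roots _ rp).
rewrite inE ffunE /= -(relabels_roots _ rp) in hx *.
by rewrite hx (valP x).
Qed.

(** The links between the parts in a concatenation, in a stolon product, in a grafting
    of the part [true] on the part [false], and in an elementary trace. *)
Definition apart (i : bool) : option (bool * bool) := None.
Definition tied (i : bool) : option (bool * bool) := Some (true, ~~ i).
Definition grafted (i : bool) : option (bool * bool) := if i then Some (false, false) else None.
Definition cycled k (i : 'I_k.+1) : option (bool * 'I_k.+1) := Some (false, ordS i).

Section Gsum.
Variable p : bool -> aforest D.

Definition pair_vertices : finType := ('I_(nvertices (p true)) + 'I_(nvertices (p false)))%type.
Definition pair_side (s : pair_vertices) : bool := if s is inl _ then true else false.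
Definition pair_graph : graph D pair_vertices := gsum (rep (p true)) (rep (p false)).

Lemma pair_closed s : closed_at pair_side pair_graph s.
Proof.
rewrite /closed_at; case: s => x.
  have /relabelsP[_ ->] := gsum_inl (rep (p true)) (rep (p false)).
  by case: (out _ x).
have /relabelsP[_ ->] := gsum_inr (rep (p true)) (rep (p false)).
by case: (out _ x).
Qed.

Lemma pair_part i : forest_class (part pair_side i pair_graph) = p i.
Proof.
have rp j := part_relabels (fun v (_ : pair_side v = j) => pair_closed v).
case: i; [rewrite -[RHS]forest_classK|rewrite -[RHS]forest_classK]; symmetry.
  pose g (x : 'I_(nvertices (p true))) : {s | pair_side s == true} := exist _ (inl x) (eqxx true).
  apply: (@forest_class_iso _ _ _ _ _ g).
    exists (fun s => match val s as u return (pair_side u == true -> 'I_(nvertices (p true))) with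
      inl x => fun _ => x | inr _ => fun e => False_rect _ (notF e) end (valP s)) => //.
    by case=> [[x|x] hx] //; apply: val_inj.
  apply: (relabels_cancel val_inj (rp true)); exact: gsum_inl.
pose g (x : 'I_(nvertices (p false))) : {s | pair_side s == false} := exist _ (inr x) (eqxx false).
apply: (@forest_class_iso _ _ _ _ _ g).
  exists (fun s => match val s as u return (pair_side u == false -> 'I_(nvertices (p false))) with
    inr x => fun _ => x | inl _ => fun e => False_rect _ (notF e) end (valP s)) => //.
  by case=> [[x|x] hx] //; apply: val_inj.
apply: (relabels_cancel val_inj (rp false)); exact: gsum_inr.
Qed.

Lemma pair_root_true x : (inl x \in roots pair_graph) = (x \in roots (rep (p true))).
Proof. exact: relabels_roots (gsum_inl _ _). Qed.

Lemma pair_root_false x : (inr x \in roots pair_graph) = (x \in roots (rep (p false))).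
Proof. exact: relabels_roots (gsum_inr _ _). Qed.

Lemma pair_rooted i : rooted [ffun v => (pair_side v, v \in roots pair_graph)] i = is_tree (p i).
Proof. by rewrite rooted_part ?pair_part //; exact: pair_closed. Qed.

Lemma big_apart (M : Type) (idx : M) (op : Monoid.com_law idx) (F : graph D pair_vertices -> M) :
  \big[op/idx]_(K | joined apart pair_side pair_graph K) F K = F pair_graph.
Proof.
rewrite (big_joined_param (O := unit) op (g := fun _ => pair_graph)) //.
- by rewrite (big_pred1 tt) //; case.
- by case=> [] [].
- move=> _; apply/(joinedP _ _ pair_closed); split=> // s.
  by rewrite -out_root => /eqP ->.
move=> K /(joinedP _ _ pair_closed)[dK oN oR _]; exists tt; apply: graph_ext => // s.
have [sr|/oN //] := boolP (s \in roots pair_graph); have [h _] := oR _ sr.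
have /eqP -> : out pair_graph s == None by rewrite out_root.
by case: (out K s) h.
Qed.

Lemma tree_root (t : aforest D) : is_tree t -> exists2 x, x \in roots (rep t) &
  forall y, y \in roots (rep t) -> y = x.
Proof.
case/cards1P=> x e; exists x; first by rewrite e inE.
by move=> y; rewrite e => /set1P.
Qed.

Lemma big_grafted (M : Type) (idx : M) (op : Monoid.com_law idx) (F : graph D pair_vertices -> M) :
  is_tree (p true) ->
  \big[op/idx]_(K | joined grafted pair_side pair_graph K) F K =
  \big[op/idx]_(v : 'I_(nvertices (p false)))
     F (attach pair_graph [set inl x | x : 'I_(nvertices (p true))] (fun => inr v)).
Proof.
move=> tp; have [x0 rx0 ux0] := tree_root tp.
pose A : {set pair_vertices} := [set inl x | x : 'I_(nvertices (p true))].
have inA (s : pair_vertices) : (s \in A) = pair_side s.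
  case: s => x; first by rewrite imset_f.
  by apply/imsetP => -[].
have [r0 n0] : (inl x0 \in roots pair_graph) /\ out pair_graph (inl x0) = None.
  by split; [|apply/eqP; rewrite out_root]; rewrite pair_root_true.
apply: big_joined_param.
- move=> v v' /(congr1 (fun K => out K (inl x0))).
  by rewrite !out_attach r0 inA /= => -[].
- move=> v; apply/(joinedP _ _ pair_closed); split=> //.
  + by move=> s nr; rewrite out_attach (negbTE nr).
  + move=> s sr; rewrite out_attach sr inA; case: s sr => x sr //=.
    by have /eqP -> : out pair_graph (inr x) == None by rewrite out_root.
  + by case=> // _; rewrite pair_rooted.
move=> K /(joinedP _ _ pair_closed)[dK oN oR _].
have [] := oR _ r0; case eK: (out K _) => [[s [x|v]]|] //= -[es] _; subst s.
exists v; apply: graph_ext => // s; rewrite out_attach inA.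
have [sr|/oN //] := boolP (s \in roots pair_graph).
case: s sr => x sr /=; first by rewrite -eK (ux0 x) // -pair_root_true.
have [+ _] := oR _ sr; case: (out K _) => // _.
by apply/esym/eqP; rewrite out_root.
Qed.

Lemma big_tied (M : Type) (idx : M) (op : Monoid.com_law idx) (F : graph D pair_vertices -> M) :
  is_tree (p true) -> is_tree (p false) ->
  \big[op/idx]_(K | joined tied pair_side pair_graph K) F K = F (link pair_graph).
Proof.
move=> t1 t2; have [x rx ux] := tree_root t1; have [y ry uy] := tree_root t2.
have rE s : (s \in roots pair_graph) = (s == inl x) || (s == inr y).
  case: s => z; rewrite ?pair_root_true ?pair_root_false.
    by rewrite orbF; apply/idP/eqP => [/ux -> //|[->]].
  by apply/idP/eqP => [/uy -> //|[->]].
have c2 : #|roots pair_graph| == 2%N.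
  suff -> : roots pair_graph = [set inl x; inr y] by rewrite cards2.
  by apply/setP=> s; rewrite rE in_set2.
have lx : out (link pair_graph) (inl x) = Some (true, inr y).
  rewrite out_link rE eqxx c2 /=; case: pickP => [s|/(_ (inr y))]; last by rewrite rE eqxx.
  by rewrite rE => /andP[/orP[/eqP ->|/eqP -> //]]; rewrite eqxx.
have ly : out (link pair_graph) (inr y) = Some (true, inl x).
  rewrite out_link rE eqxx c2 /=; case: pickP => [s|/(_ (inl x))]; last by rewrite rE eqxx.
  by rewrite rE => /andP[/orP[/eqP -> //|/eqP ->]]; rewrite eqxx.
rewrite (big_joined_param (O := unit) op (g := fun _ => link pair_graph)) //.
- by rewrite (big_pred1 tt) //; case.
- by case=> [] [].
- move=> _; apply/(joinedP _ _ pair_closed); split=> //.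
  + by move=> s nr; rewrite out_link (negbTE nr).
  + by move=> s; rewrite rE => /orP[]/eqP->; rewrite ?lx ?ly; split=> // z [<-]; rewrite rE eqxx.
  + by case=> // _; rewrite pair_rooted.
move=> K /(joinedP _ _ pair_closed)[dK oN oR _]; exists tt; apply: graph_ext => // s.
have [|nr] := boolP (s \in roots pair_graph); last by rewrite oN // out_link (negbTE nr).
move=> sr; have [] := oR _ sr; move: sr; rewrite rE => /orP[]/eqP->; rewrite ?lx ?ly.
  by case: (out K _) => [[t [z|z]]|] //= [->] /(_ _ erefl); rewrite rE /= => /eqP ->.
by case: (out K _) => [[t [z|z]]|] //= [->] /(_ _ erefl); rewrite rE orbF => /eqP ->.
Qed.
End Gsum.

Section Bigsum.
Variables (k : nat) (p : 'I_k.+1 -> aforest D).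

Definition family_vertices : finType := {i : 'I_k.+1 & 'I_(nvertices (p i))}.
Definition family_side (s : family_vertices) : 'I_k.+1 := tag s.
Definition family_graph : graph D family_vertices := bigsum (fun i => rep (p i)).

Lemma family_closed s : closed_at family_side family_graph s.
Proof.
rewrite /closed_at; case: s => i x.
have /relabelsP[_ ->] := bigsum_Tagged (fun i => rep (p i)) i.
by case: (out _ x) => [[]|] //=.
Qed.

Lemma family_part i : forest_class (part family_side i family_graph) = p i.
Proof.
have rp := part_relabels (fun v (_ : family_side v = i) => family_closed v).
rewrite -[RHS]forest_classK; symmetry.
pose g (x : 'I_(nvertices (p i))) : {s | family_side s == i} :=
  exist _ (Tagged (fun i => 'I_(nvertices (p i))) x) (eqxx i).
apply: (@forest_class_iso _ _ _ _ _ g).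
  have ig : injective g by move=> x y /(congr1 val) e; exact: eq_from_Tagged e.
  apply: (inj_card_bij ig); rewrite -(card_imset predT ig) subset_leq_card //.
  apply/subsetP=> -[[j x] hj] _; have e : j = i := eqP hj.
  subst j.
  by apply/imsetP; exists x => //; apply: val_inj.
apply: (relabels_cancel val_inj rp); exact: bigsum_Tagged.
Qed.

Lemma family_root i x :
  (Tagged (fun i => 'I_(nvertices (p i))) x \in roots family_graph) = (x \in roots (rep (p i))).
Proof. exact: relabels_roots (bigsum_Tagged _ _). Qed.

Lemma family_rooted i :
  rooted [ffun v => (family_side v, v \in roots family_graph)] i = is_tree (p i).
Proof. by rewrite rooted_part ?family_part //; exact: family_closed. Qed.

Lemma big_cycled (M : Type) (idx : M) (op : Monoid.com_law idx) (F : graph D family_vertices -> M) :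
  (forall i, is_tree (p i)) ->
  \big[op/idx]_(K | joined (@cycled k) family_side family_graph K) F K =
  \big[op/idx]_(v : {dffun forall i : 'I_k.+1, 'I_(nvertices (p i))})
     F (attach family_graph setT
         (fun u => Tagged (fun i => 'I_(nvertices (p i))) (v (ordS (tag u))))).
Proof.
move=> tp; have xP i := tree_root (tp i).
have rE i : exists2 s, s \in roots family_graph /\ tag s = i &
    forall s', s' \in roots family_graph -> tag s' = i -> s' = s.
  have [x rx ux] := xP i; exists (Tagged (fun i => 'I_(nvertices (p i))) x).
    by rewrite family_root.
  by case=> j y + /= e; subst j; rewrite family_root => /ux ->.
apply: big_joined_param.
- move=> v v' e; apply/ffunP => i; have [s [sr ts] _] := rE (ord_pred i).
  have := congr1 (fun K => out K s) e; rewrite !out_attach sr in_setT /=.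
  move/(@Some_inj _) => /(congr1 snd) /=; rewrite ts ord_predK; exact: eq_from_Tagged.
- move=> v; apply/(joinedP _ _ family_closed); split=> //.
  + by move=> s nr; rewrite out_attach (negbTE nr).
  + by move=> s sr; rewrite out_attach sr in_setT.
  + by move=> i _; rewrite family_rooted.
move=> K /(joinedP _ _ family_closed)[dK oN oR _].
have vP i : exists y : 'I_(nvertices (p i)), [forall s, (s \in roots family_graph) ==>
    (ordS (tag s) == i) ==> (out K s == Some (false, Tagged (fun i => 'I_(nvertices (p i))) y))].
  have [s [sr ts] us] := rE (ord_pred i).
  have [] := oR _ sr; case eK: (out K s) => [[t [j y]]|] //= [et ej] _.
  rewrite /family_side /= in ej; rewrite ts ord_predK in ej; subst t j; exists y.
  apply/forallP => s'; apply/implyP => sr'; apply/implyP => /eqP e'.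
  by rewrite (us s') ?eK // -e' ordSK.
exists [ffun i => xchoose (vP i)]; apply: graph_ext => // s; rewrite out_attach in_setT andbT.
have [sr|/oN //] := boolP (s \in roots family_graph); rewrite ffunE.
by have /forallP/(_ s) := xchooseP (vP (ordS (tag s))); rewrite sr eqxx => /eqP.
Qed.
End Bigsum.

End JoinedOps.

(** * Tracial morphisms respect gluing *)

Section Tracial.
Variables (R : realType) (D : finType) (A : aforest D -> formal_series R D).
Hypothesis trA : tracial_morphism A.

(** A forest with more vertices than h is missed by the truncated sum, but A does not
    have h in its image either. *)
Lemma lin_ext_basis (O : finType) (g : O -> aforest D) h :
  lin_ext A (fun x => \sum_o basis R (g o) x) h = \sum_o A (g o) h.
Proof.
rewrite /lin_ext; under eq_bigr => x _ do rewrite mulr_suml.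
rewrite exchange_big /=; apply: eq_bigr => o _.
transitivity (\sum_(q : upto D (nvertices h)) A (of_upto q) h * (of_upto q == g o)%:R).
  by apply: eq_bigr => q _; rewrite mulrC /basis.
rewrite (sum_upto _ (g o) (fun q => A q h)); case: ifP => // /negbT.
by rewrite -ltnNge => /(tr_filtered trA).
Qed.

Lemma bilin_ext_family (F : aforest D -> aforest D -> formal_series R D) (x y : formal_series R D) h :
  bilin_ext F x y h = \sum_(f : {ffun bool -> upto D (nvertices h)})
    (x (of_upto (f true)) * y (of_upto (f false))) * F (of_upto (f true)) (of_upto (f false)) h.
Proof.
rewrite /bilin_ext pair_big /=.
rewrite (reindex (fun f : {ffun bool -> upto D (nvertices h)} => (f true, f false))) //=.
apply: onW_bij; exists (fun u : upto D (nvertices h) * upto D (nvertices h) =>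
  [ffun i : bool => if i then u.1 else u.2]) => [f|[u v]].
  by apply/ffunP => -[]; rewrite ffunE.
by rewrite !ffunE.
Qed.

Local Notation pairs := (preserves_assembly (fun p s => @pair_side D p s) (@pair_graph D) A).

Lemma preserves_apart t : pairs apart t.
Proof.
move=> h; rewrite big_apart -/(concat (t true) (t false)) (tr_concat trA) bilin_ext_family.
apply: eq_bigr => f _; rewrite big_bool big_apart; congr (_ * _).
Qed.

(** A sends trees to series of trees, so the families that are joined along the pattern
    are the only ones to contribute; the same holds for stolons and traces. *)
Lemma preserves_grafted t : is_tree (t true) -> pairs grafted t.
Proof.
move=> tt h; rewrite big_grafted //.
have -> : \sum_(v : 'I_(nvertices (t false))) A (graft_at (t true) v) h = lin_ext A (graft R (t true) (t false)) h.
  by apply/esym; exact: (lin_ext_basis (fun v : 'I_(nvertices (t false)) => graft_at (t true) v) h).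
rewrite (tr_graft trA) // bilin_ext_family; apply: eq_bigr => f _; rewrite big_bool /=.
have [tf|nf] := boolP (is_tree (of_upto (f true))).
  by rewrite big_grafted.
by rewrite (tr_tree trA tt nf) !mul0r.
Qed.

Lemma preserves_tied t : is_tree (t true) -> is_tree (t false) -> pairs tied t.
Proof.
move=> tt tf h; rewrite big_tied // -/(stolon (t true) (t false)) (tr_stolon trA) //.
rewrite bilin_ext_family; apply: eq_bigr => f _; rewrite big_bool /=.
have [ft|nf] := boolP (is_tree (of_upto (f true))); last by rewrite (tr_tree trA tt nf) !mul0r.
have [ff|nf] := boolP (is_tree (of_upto (f false))); last by rewrite (tr_tree trA tf nf) !(mul0r, mulr0).
by rewrite big_tied.
Qed.

Lemma preserves_cycled k (t : 'I_k.+1 -> aforest D) : (forall i, is_tree (t i)) ->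
  preserves_assembly (fun p s => @family_side D k p s) (@family_graph D k) A (@cycled k) t.
Proof.
move=> tt h; rewrite big_cycled //.
have -> : \sum_(v : {dffun forall i : 'I_k.+1, 'I_(nvertices (t i))}) A (cycle_at v) h =
    lin_ext A (elem_trace R t) h.
  by apply/esym; exact: (lin_ext_basis (@cycle_at D k.+1 t) h).
rewrite (tr_trace trA) // /multilin_ext; apply: eq_bigr => f _.
have [ff|/forallPn[i nf]] := boolP [forall i, is_tree (of_upto (f i))].
  by rewrite big_cycled //; move=> i; apply: (forallP ff).
by rewrite (bigD1 i) //= (tr_tree trA (tt i) nf) !mul0r.
Qed.

Lemma coefA_pairs (q : bool -> option (bool * bool)) (V W : finType) (r : V -> bool) (P0 : graph D V)
    (H : graph D W) :
    (forall v, closed_at r P0 v) -> pairs q (fun i => forest_class (part r i P0)) ->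
  \sum_(P | joined q r P0 P) coefA A P H =
  \sum_(chi : {ffun W -> bool * bool} | assembles q chi H)
    \prod_i coefA A (part r i P0) (part (base chi) i (sever H (marked chi))).
Proof. by apply: coefA_assembles; [exact: pair_closed | exact: pair_part]. Qed.

Lemma coefA_cycle k (V W : finType) (r : V -> 'I_k.+1) (P0 : graph D V) (H : graph D W) :
    (forall v, closed_at r P0 v) -> (forall i, is_tree (forest_class (part r i P0))) ->
  \sum_(P | joined (@cycled k) r P0 P) coefA A P H =
  \sum_(chi : {ffun W -> 'I_k.+1 * bool} | assembles (@cycled k) chi H)
    \prod_i coefA A (part r i P0) (part (base chi) i (sever H (marked chi))).
Proof.
move=> cl tr; have pA := preserves_cycled tr.
exact: (coefA_assembles (@family_closed D k) (@family_part D k) H cl pA).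
Qed.

End Tracial.

(** * Every graph is the lowest term of a gluing *)

Section Sizes.
Variable D : finType.
Implicit Types I U V W : finType.

Definition linked V (P : graph D V) : {set V} := [set v | out P v != None].

(** The first of the two quantities of the induction: pieces have fewer vertices or
    fewer links than the graph joined from them, and all graphs joined from the same
    pieces have the same size. *)
Definition gsize V (P : graph D V) : nat := (#|V| + #|linked P|)%N.

Definition arc V (P : graph D V) : rel V := [rel x y | out P x == Some (false, y)].

Lemma arcE V (P : graph D V) x y : arc P x y = (out P x == Some (false, y)).
Proof. by []. Qed.

(** The second quantity of the induction: it separates the graphs joined from the same
    pieces. Arcs lead towards the root, so a branch that is attached farther from the
    root has more vertices on its way. *)
Definition reach V (P : graph D V) : nat := #|[set e : V * V | connect (arc P) e.1 e.2]|.

Lemma reach_lt V (P P' : graph D V) x y :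
    (forall u v, arc P u v -> connect (arc P') u v) ->
    connect (arc P') x y -> ~~ connect (arc P) x y ->
  (reach P < reach P')%N.
Proof.
move=> sub c nc; apply/proper_card/properP; split.
  by apply/subsetP=> -[u v]; rewrite !inE /= => h; exact: connect_sub h.
by exists (x, y); rewrite !inE.
Qed.

Lemma joined_linked I V (q : I -> option (bool * I)) (r : V -> I) (P0 P P' : graph D V) :
    (forall v, closed_at r P0 v) -> joined q r P0 P -> joined q r P0 P' ->
  linked P = linked P'.
Proof.
move=> cl /(joinedP _ _ cl)[_ n1 r1 _] /(joinedP _ _ cl)[_ n2 r2 _].
apply/setP=> v; rewrite !inE; have [vr|nr] := boolP (v \in roots P0); last by rewrite n1 ?n2.
have [h1 _] := r1 v vr; have [h2 _] := r2 v vr.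
have : lmap r (out P v) = lmap r (out P' v) by rewrite h1 h2.
by case: (out P v) (out P' v) => [?|] [?|].
Qed.

Lemma gsize_part I V (q : I -> option (bool * I)) (r : V -> I) (P0 P : graph D V) i v :
    (forall v, closed_at r P0 v) -> joined q r P0 P ->
    r v != i \/ (v \in roots P0 /\ out P v != None) ->
  (gsize (part r i P0) < gsize P)%N.
Proof.
move=> cl /(joinedP _ _ cl)[_ nP rP _] hv.
have rp := part_relabels (fun v (_ : r v = i) => cl v).
have lE : #|linked (part r i P0)| = #|[set v | (r v == i) & (v \in linked P0)]|.
  rewrite -(card_imset _ val_inj); apply: eq_card => x; apply/imsetP/idP => [[w]|].
    rewrite !inE => h ->; rewrite (valP w); move/relabelsP: rp => [_ ->].
    by case: (out _ w) h.
  rewrite !inE => /andP[rx h]; exists (exist _ x rx) => //; rewrite inE.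
  move/relabelsP: rp => [_ /(_ (exist _ x rx))] /= e; rewrite e in h.
  by case: (out _ _) h.
have sub : linked P0 \subset linked P.
  apply/subsetP=> x; rewrite !inE => h; rewrite nP //.
  by apply: contra h; rewrite -out_root.
have cF : #|{: {v | r v == i}}| = #|[set v | r v == i]|.
  by rewrite card_sig; apply: eq_card => x; rewrite !inE.
rewrite /gsize lE cF; case: hv => [nv|[vr nl]].
  rewrite -addSn leq_add //.
    rewrite -cardsT; apply/proper_card/properP; split; first exact: subsetT.
    by exists v; rewrite ?inE.
  by apply: subset_leq_card; apply/subsetP=> x; rewrite inE => /andP[_ /(subsetP sub)].
rewrite -addnS leq_add ?max_card //; apply/proper_card/properP; split.
  by apply/subsetP=> x; rewrite inE => /andP[_ /(subsetP sub)].
exists v; first by rewrite inE.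
by rewrite !inE; move: vr; rewrite -out_root => /eqP ->; rewrite eqxx andbF.
Qed.

Lemma arc_connect_closed V (P : graph D V) u x y s : x != u -> out P x = Some (s, y) ->
  s = false -> connect (arc P) x u = connect (arc P) y u.
Proof.
move=> nxu e es; subst s; apply/idP/idP => [/connectP[[|z p] /= pt el]|].
- by rewrite el eqxx in nxu.
- by case/andP: pt => /eqP; rewrite e => -[->] pt; apply/connectP; exists p.
by move=> h; apply: (connect_trans (connect1 _) h); rewrite arcE e.
Qed.

Lemma connect_noarc V (P : graph D V) u x : (forall y, out P u != Some (false, y)) ->
  connect (arc P) u x -> x = u.
Proof.
move=> h /connectP[[|z p] //= /andP[/eqP e _] _].
by have := h z; rewrite e eqxx.
Qed.

End Sizes.

Section Decompose.
Variable D : finType.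
Implicit Types I U V W : finType.

(** P is the term of least [reach] among the graphs joined from P0, so that the gluing
    rule expresses P through graphs that come earlier in the induction. *)
Definition triangular I V (q : I -> option (bool * I)) (r : V -> I) (P0 P : graph D V) : Prop :=
  [/\ forall v, closed_at r P0 v, joined q r P0 P,
      forall i, (gsize (part r i P0) < gsize P)%N
    & forall P', joined q r P0 P' -> P' != P -> (reach P < reach P')%N].

Section Graph.
Variables (V : finType) (P : graph D V).

Definition component_closed (C : {set V}) : bool :=
  [forall v, if out P v is Some p then (v \in C) == (p.2 \in C) else true].

Lemma component_closedP (C : {set V}) :
  reflect (forall v s y, out P v = Some (s, y) -> (v \in C) = (y \in C)) (component_closed C).
Proof.
apply: (iffP forallP) => [h v s y e|h v].
  by have := h v; rewrite e => /eqP.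
by case e: (out P v) => [[s y]|] //; apply/eqP/h/e.
Qed.

(** A disconnected graph is a concatenation, and nothing else can be obtained from its
    two pieces. *)
Lemma triangular_apart (C : {set V}) : component_closed C -> C != set0 -> C != setT ->
  triangular apart (fun v => v \in C) P P.
Proof.
move=> /component_closedP cC n0 nT.
have cl v : closed_at (fun v => v \in C) P v.
  by rewrite /closed_at; case e: (out P v) => [[s y]|] //=; rewrite (cC _ _ _ e).
have jP : joined apart (fun v => v \in C) P P.
  apply/(joinedP _ _ cl); split=> // s; by rewrite -out_root => /eqP ->.
split=> //.
- case/set0Pn: n0 => x xC; have /set0Pn[y] : ~: C != set0.
    by apply: contra nT => /eqP e; rewrite -[C]setCK e setC0.
  rewrite inE => yC; case.
    by apply: (gsize_part (v := y)) cl jP _; left; rewrite (negbTE yC).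
  by apply: (gsize_part (v := x)) cl jP _; left; rewrite xC.
move=> P' /(joinedP _ _ cl)[dP nP rP _]; case/negP; apply/eqP/graph_ext => // v.
have [vr|/nP //] := boolP (v \in roots P); have [h _] := rP _ vr.
have /eqP -> : out P v == None by rewrite out_root.
by case: (out P' v) h.
Qed.

Hypothesis indec : forall C : {set V}, component_closed C -> C = set0 \/ C = setT.

Lemma indec_full (C : {set V}) x : component_closed C -> x \in C -> forall v, v \in C.
Proof. by move=> /indec[]-> //; rewrite inE. Qed.

(** A connected graph with a stolon consists of the descendants of the two ends, and
    these two trees can only be linked in one way. *)
Lemma triangular_tied u w : out P u = Some (true, w) ->
  exists r P0, triangular tied r P0 P /\ forall i, is_tree (forest_class (part r i P0)).
Proof.
move=> uw; have wu := out_sym uw; have nuw := out_irr uw.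
have noarc x y z : out P x = Some (true, y) -> connect (arc P) x z -> z = x.
  by move=> h; apply: connect_noarc => t; rewrite h.
pose C := [set x | connect (arc P) x u || connect (arc P) x w].
have full v : v \in C.
  apply: (indec_full (x := u)); last by rewrite inE connect0.
  apply/component_closedP => x [] y e; rewrite !inE.
    apply/idP/idP => h.
      by case/orP: h => /(noarc _ _ _ e) h; subst x; move: e; rewrite ?uw ?wu => -[<-];
        rewrite connect0 ?orbT.
    by case/orP: h => /(noarc _ _ _ (out_sym e)) h; subst y; move: (out_sym e);
      rewrite ?uw ?wu => -[<-]; rewrite connect0 ?orbT.
  have [xu|nxu] := eqVneq x u; first by rewrite xu uw in e.
  have [xw|nxw] := eqVneq x w; first by rewrite xw wu in e.
  by rewrite (arc_connect_closed nxu e) // (arc_connect_closed nxw e).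
(* The two parts are the vertices that lead to u and those that lead to w. *)
pose r v := connect (arc P) v u; pose B : {set V} := [set u; w].
have rw : r w = false by apply/negP => /(noarc _ _ _ wu) e; rewrite e eqxx in nuw.
have ru : r u by exact: connect0.
pose P0 := sever P B.
have oP0 x : out P0 x = if x \in B then None else out P x.
  rewrite out_sever; case: ifP => [xB|nB]; first by case: (out P x).
  case e: (out P x) => [[[] y]|] //=; case: ifP => //.
  rewrite !inE => /orP[] /eqP ey; subst y; move: nB; rewrite !inE.
    by move: (out_sym e); rewrite uw => -[->]; rewrite eqxx orbT.
  by move: (out_sym e); rewrite wu => -[->]; rewrite eqxx.
have rB x : (x \in roots P0) = (x \in B).
  rewrite -out_root oP0; case: ifP => // /negbT; rewrite !inE negb_or => /andP[xu xw].
  apply/eqP => e; have := full x; rewrite inE => /orP[] /connectP[[|z p] /=].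
  - by move=> _ h; rewrite h eqxx in xu.
  - by rewrite arcE e.
  - by move=> _ h; rewrite h eqxx in xw.
  - by rewrite arcE e.
have cl x : closed_at r P0 x.
  rewrite /closed_at oP0; case: ifP => //; rewrite !inE => /negbT; rewrite negb_or => /andP[xu xw].
  case e: (out P x) => [[s y]|] //=; case: s e => e; last by rewrite /r (arc_connect_closed xu e).
  have := full x; rewrite inE => /orP[] /(noarc _ _ _ e) h; by rewrite h eqxx in xu xw.
have root1 i : rooted [ffun v => (r v, v \in roots P0)] i.
  apply/rootedP; exists (if i then u else w).
    by rewrite ffunE rB /=; case: i; rewrite ?ru ?rw !inE eqxx ?orbT.
  move=> x; rewrite ffunE rB /= !inE => /orP[] /eqP ->; rewrite ?ru ?rw; by case: i.
have jP : joined tied r P0 P.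
  apply/(joinedP _ _ cl); split=> //.
    by move=> s; rewrite rB oP0 => /negbTE ->.
  move=> s; rewrite rB !inE => /orP[] /eqP ->; rewrite ?uw ?wu /= ?ru ?rw; split=> // y [<-];
    by rewrite rB !inE eqxx ?orbT.
exists r, P0; split; last by move=> i; rewrite -rooted_part.
split=> //.
  by case; [apply: (gsize_part (v := w)) cl jP _ | apply: (gsize_part (v := u)) cl jP _];
    left; rewrite ?ru ?rw.
move=> P' /(joinedP _ _ cl)[dP nP rP _]; case/negP; apply/eqP/graph_ext => // v.
have [|nv] := boolP (v \in roots P0); last first.
  by rewrite nP // oP0; move: nv; rewrite rB => /negbTE ->.
move=> vr; have [] := rP _ vr; move: vr; rewrite rB !inE => /orP[] /eqP ->.
  rewrite uw ru; case: (out P' u) => [[s y]|] //= -[-> ry] /(_ y erefl).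
  by rewrite rB !inE => /orP[] /eqP e; [move: ry; rewrite e ru | rewrite e].
rewrite wu rw; case: (out P' w) => [[s y]|] //= -[-> ry] /(_ y erefl).
by rewrite rB !inE => /orP[] /eqP e; [rewrite e | move: ry; rewrite e rw].
Qed.

Hypothesis nostolon : forall v w, out P v != Some (true, w).

Lemma out_nostolon v : out P v = None \/ exists w, out P v = Some (false, w).
Proof.
case e: (out P v) => [[[] w]|]; [|by right; exists w|by left].
by have := nostolon v w; rewrite e eqxx.
Qed.

Lemma out_sever_nostolon B v : out (sever P B) v = if v \in B then None else out P v.
Proof.
rewrite out_sever; case: (out_nostolon v) => [->|[w ->]] /=; first by case: ifP.
by rewrite orbF.
Qed.

(** A tree with more than one vertex is obtained by grafting the branch at a child u of
    the root t on the rest. In the other grafted trees u is attached to some v other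
    than t; then u still reaches t, on a path through v. *)
Lemma triangular_grafted t x : out P t = None -> x != t ->
  exists r P0, triangular grafted r P0 P /\ is_tree (forest_class (part r true P0)).
Proof.
move=> ot nxt.
have full v : connect (arc P) v t.
  suff : v \in [set v | connect (arc P) v t] by rewrite inE.
  apply: (indec_full (x := t)); last by rewrite inE connect0.
  apply/component_closedP => z s y e; rewrite !inE.
  have es : s = false by case: s e => // e; have := nostolon z y; rewrite e eqxx.
  by rewrite (arc_connect_closed _ e es) //; apply: contraTneq isT => h; rewrite h ot in e.
have [u ut] : exists u, out P u = Some (false, t).
  have /connectP[p pt el] := full x; case/lastP: p pt el => [|p z].
    by move=> _ /= e; rewrite e eqxx in nxt.
  rewrite rcons_path last_rcons => /andP[_ h] e; exists (last x p).
  by apply/eqP; rewrite e.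
have nut : u != t by apply: contraTneq isT => h; rewrite h ot in ut.
(* The part [true] is the branch at u, which is cut off by severing the link of u. *)
pose r v := connect (arc P) v u; pose P0 := sever P [set u].
have ru : r u by exact: connect0.
have rt : r t = false.
  apply/negP => /connect_noarc h; move: nut; rewrite h ?eqxx // => y; by rewrite ot.
have oP0 v : out P0 v = if v == u then None else out P v by rewrite out_sever_nostolon inE.
have rB v : (v \in roots P0) = (v == u) || (v == t).
  rewrite -out_root oP0; have [//|nvu /=] := eqVneq v u.
  apply/idP/idP => /eqP e; last by rewrite e ot.
  by rewrite eq_sym; apply/eqP; apply: connect_noarc (full v) => y; rewrite e.
have cl v : closed_at r P0 v.
  rewrite /closed_at oP0; case: eqP => // /eqP nvu; case: (out_nostolon v) => [->|[y e]] //.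
  by rewrite e /= /r (arc_connect_closed nvu e).
have rt1 : rooted [ffun v => (r v, v \in roots P0)] true.
  apply/rootedP; exists u; first by rewrite ffunE /= rB eqxx.
  by move=> v; rewrite ffunE /= rB => /orP[]/eqP-> //; rewrite rt.
have jP : joined grafted r P0 P.
  apply/(joinedP _ _ cl); split=> //.
  - by move=> v; rewrite rB oP0 negb_or => /andP[/negbTE ->].
  - by move=> v; rewrite rB => /orP[]/eqP->; rewrite ?ut ?ot /= ?ru ?rt.
  - by case.
exists r, P0; split; last by rewrite -rooted_part.
split=> //.
  by case; [apply: (gsize_part (v := t)) cl jP _ | apply: (gsize_part (v := u)) cl jP _];
    left; rewrite ?ru ?rt.
move=> P' /(joinedP _ _ cl)[dP nP rP _] neq.
have ot' : out P' t = None.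
  have [|+ _] := rP t; first by rewrite rB eqxx orbT.
  by rewrite rt; case: (out P' t).
have oP' v : v != u -> out P' v = out P v.
  move=> nvu; have [->|nvt] := eqVneq v t; first by rewrite ot ot'.
  by rewrite nP ?oP0 ?(negbTE nvu) // rB negb_or nvu.
have [v uv rv] : exists2 v, out P' u = Some (false, v) & r v = false.
  have [|+ _] := rP u; first by rewrite rB eqxx.
  by rewrite ru; case: (out P' u) => [[s v]|] //= -[-> rv]; exists v.
have to_t p : forall z, r z = false -> path (arc P) z p -> t = last z p -> connect (arc P') z t.
  elim: p => [|y p IH] z rz /=; first by move=> _ ->; exact: connect0.
  case/andP=> zy pt el; have nzu : z != u by apply: contraFneq rz => ->.
  have ez : out P z = Some (false, y) by apply/eqP.
  apply: (connect_trans (y := y)).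
    by apply: connect1; rewrite arcE oP' // ez.
  by apply: IH => //; rewrite -rz /r (arc_connect_closed nzu ez).
(* Hence P' keeps the connection of u to t that the arc from u to t gives in P. *)
have vt : connect (arc P') v t by have /connectP[p pt el] := full v; exact: to_t rv pt el.
apply: (@reach_lt _ _ _ _ u v).
- move=> y z; rewrite arcE; have [->|nyu] := eqVneq y u.
    rewrite ut => /eqP[<-]; apply: connect_trans vt; apply: connect1; by rewrite arcE uv.
  by move=> h; apply: connect1; rewrite arcE oP'.
- by apply: connect1; rewrite arcE uv.
apply/negP => /connectP[[|z [|z' p]] /=].
- by move=> _ e; rewrite e ru in rv.
- rewrite arcE ut andbT => /eqP[ez] e; subst v z; case/negP: neq; apply/eqP/graph_ext => // z.
  by have [->|/oP' //] := eqVneq z u; rewrite uv ut.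
- by rewrite !arcE ut => /and3P[/eqP[<-]]; rewrite ot.
Qed.

Hypothesis noroot : forall v, out P v != None.

Let f v : V := if out P v is Some p then p.2 else v.

Let outf v : out P v = Some (false, f v).
Proof.
have := noroot v; rewrite /f; case: (out_nostolon v) => [->|[w ->]] //.
Qed.

Let connect_iter m v : connect (arc P) v (iter m f v).
Proof.
elim: m => [|m IH]; first exact: connect0.
by apply: connect_trans IH (connect1 _); rewrite arcE outf.
Qed.

Let connect_iterP v w : connect (arc P) v w -> exists m, iter m f v = w.
Proof.
case/connectP=> p; elim: p v => [|y p IH] v /=; first by move=> _ ->; exists 0%N.
rewrite arcE outf => /andP[/eqP[<-]] pt el; have [m h] := IH _ pt el.
by exists m.+1; rewrite iterSr.
Qed.

(** Iterating the successor map from any vertex enters a cycle, by the pigeonhole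
    principle. By connectedness every vertex leads to this cycle, since the vertices
    that do so form a union of components. *)
Lemma exists_cycle (x : V) : exists k (c : 'I_k.+1 -> V),
  [/\ injective c, forall i, f (c i) = c (ordS i) & forall v, exists m, iter m f v = c ord0].
Proof.
(* Two of the first #|V| + 1 iterates coincide. *)
have [x0 [m0 [pm0 hm0]]] : exists x0 m, (0 < m)%N /\ iter m f x0 = x0.
  have /injectivePn[i [j nij e]] : ~~ injectiveb (fun i : 'I_#|V|.+1 => iter i f x).
    by apply/injectiveP => /leq_card; rewrite card_ord ltnn.
  wlog ltij : i j nij e / (i < j)%N => [wl|].
    by case: (ltngtP i j) => [h|h|/ord_inj h]; [exact: wl nij e h| apply: (wl j i) h; rewrite 1?eq_sym|
      rewrite h eqxx in nij].
  exists (iter i f x), (j - i)%N; rewrite subn_gt0 ltij; split=> //.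
  by rewrite -iterD subnK ?(ltnW ltij).
have exm : exists m, (0 < m)%N && (iter m f x0 == x0) by exists m0; rewrite pm0 hm0 eqxx.
have [[//|k] /andP[_ /eqP hk] mink] := ex_minnP exm.
exists k, (fun i => iter i f x0); split.
- suff lt (i j : 'I_k.+1) : iter i f x0 = iter j f x0 -> ~~ (i < j)%N.
    move=> i j /= e; apply: ord_inj; apply/eqP; rewrite eqn_leq (leqNgt i) (leqNgt j).
    by rewrite (lt _ _ e) (lt _ _ (esym e)).
  move=> e; apply/negP => ij.
  have h : iter (k.+1 - j + i) f x0 = x0 by rewrite iterD e -iterD subnK // ltnW.
  have /mink : (0 < k.+1 - j + i)%N && (iter (k.+1 - j + i) f x0 == x0).
    by rewrite h eqxx andbT addn_gt0 subn_gt0 ltn_ord.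
  have lt : (k.+1 - j + i < k.+1 - j + j)%N by rewrite ltn_add2l.
  by rewrite leqNgt; rewrite subnK ?(ltnW (ltn_ord j)) // in lt; rewrite lt.
- move=> i; rewrite -iterS /=; have [ik|] := ltnP i k; first by rewrite modn_small.
  move=> ki; have -> : (i : nat) = k by apply/eqP; rewrite eqn_leq ki -ltnS ltn_ord.
  by rewrite modnn.
move=> v; apply: connect_iterP.
suff : v \in [set v | connect (arc P) v x0] by rewrite inE.
apply: (indec_full (x := x0)); last by rewrite inE connect0.
apply/component_closedP => z s y; rewrite outf => -[_ <-]; rewrite !inE.
have [->|nz] := eqVneq z x0; last by rewrite (arc_connect_closed nz (outf z)).
rewrite connect0; apply/esym; rewrite -{2}hk iterSr; exact: connect_iter.
Qed.

(** A connected graph without roots and stolons is a cycle of rooted trees, hence a term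
    of an elementary trace. In the other terms of this trace some root is attached to a
    vertex other than the next root, so the cycle gets longer: all old connections
    remain, and there is a new one. *)
Lemma triangular_cycled (x : V) :
  exists k (r : V -> 'I_k.+1) P0, triangular (@cycled k) r P0 P /\
    forall i, is_tree (forest_class (part r i P0)).
Proof.
have [k [c [ic fc hc]]] := exists_cycle x.
pose cyc : {set V} := [set c i | i : 'I_k.+1].
have exm v : exists m, iter m f v \in cyc by have [m h] := hc v; exists m; rewrite h imset_f.
(* hit v is the first vertex of the cycle on the way of v, and r v its index. *)
pose hit v := iter (ex_minn (exm v)) f v.
have hit_cyc v : hit v \in cyc by rewrite /hit; case: ex_minnP.
have hit_id v : v \in cyc -> hit v = v.
  by rewrite /hit => h; case: ex_minnP => m _ /(_ 0%N h); rewrite leqn0 => /eqP ->.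
have hit_f v : v \notin cyc -> hit (f v) = hit v.
  rewrite /hit => nv; case: ex_minnP => m hm minm; case: ex_minnP => m' hm' minm'.
  case: m' hm' minm' => [h|m' hm' minm']; first by rewrite h in nv.
  rewrite iterSr in hm' *; congr (iter _ f _); apply/eqP.
  by rewrite eqn_leq minm //= -ltnS minm' // iterSr.
pose r v : 'I_k.+1 := odflt ord0 [pick i | c i == hit v].
have cr v : c (r v) = hit v.
  rewrite /r; case: pickP => [i /eqP //|n]; have /imsetP[i _ e] := hit_cyc v.
  by have := n i; rewrite e eqxx.
have rc i : r (c i) = i by apply: ic; rewrite cr hit_id // imset_f.
have rf v : v \notin cyc -> r (f v) = r v by move=> nv; apply: ic; rewrite !cr hit_f.
pose P0 := sever P cyc.
have oP0 v : out P0 v = if v \in cyc then None else out P v by rewrite out_sever_nostolon.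
have rB v : (v \in roots P0) = (v \in cyc).
  by rewrite -out_root oP0; case: ifP => // _; apply/negbTE/noroot.
have cl v : closed_at r P0 v.
  by rewrite /closed_at oP0; case: ifP => // /negbT nv; rewrite outf /= rf.
have rt i : rooted [ffun v => (r v, v \in roots P0)] i.
  apply/rootedP; exists (c i); first by rewrite ffunE rB /= rc imset_f.
  by move=> v; rewrite ffunE rB /= => /imsetP[j _ ->]; rewrite rc => ->.
have jP : joined (@cycled k) r P0 P.
  apply/(joinedP _ _ cl); split=> //.
    by move=> v; rewrite rB oP0 => /negbTE ->.
  by move=> v; rewrite rB => /imsetP[i _ ->]; rewrite outf /= fc !rc.
exists k, r, P0; split; last by move=> i; rewrite -rooted_part.
split=> //.
  by move=> i; apply: (gsize_part (v := c ord0)) cl jP _; right; rewrite rB imset_f // outf.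
move=> P' /(joinedP _ _ cl)[dP nP rP _] neq.
have oP' v : v \notin cyc -> out P' v = out P v.
  by move=> nv; rewrite nP ?rB // oP0 (negbTE nv).
have to_root v : connect (arc P') v (c (r v)).
  rewrite cr /hit; case: ex_minnP => m; elim: m v => [|m IH] v hm minm; first exact: connect0.
  have nv : v \notin cyc by apply/negP => h; have := minm 0%N h.
  rewrite iterSr; apply: (connect_trans (y := f v)).
    by apply: connect1; rewrite arcE oP' // outf.
  by apply: IH; [rewrite -iterSr | move=> m' h; rewrite -ltnS minm // iterSr].
have yP i : exists2 y, out P' (c i) = Some (false, y) & r y = ordS i.
  have [|+ _] := rP (c i); first by rewrite rB imset_f.
  by rewrite rc; case: (out P' _) => [[s y]|] //= -[-> e]; exists y.
have [i ni] : exists i, out P' (c i) != out P (c i).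
  apply/existsP; apply: contraNT neq => /existsPn h; apply/eqP/graph_ext => // v.
  have [/imsetP[i _ ->]|/oP' //] := boolP (v \in cyc); by have := h i; rewrite negbK => /eqP.
have [y oy ry] := yP i; apply: (@reach_lt _ _ _ _ (c i) y).
- move=> u v; rewrite arcE; have [/imsetP[j _ ->]|nu] := boolP (u \in cyc); last first.
    by move=> h; apply: connect1; rewrite arcE oP'.
  rewrite outf fc => /eqP[<-]; have [z oz <-] := yP j.
  by apply: connect_trans (to_root z); apply: connect1; rewrite arcE oz.
- by apply: connect1; rewrite arcE oy.
apply/negP => /connect_iterP[m e].
(* In P, nothing but the cycle can be reached from the cycle, and y is not on it. *)
have : y \in cyc.
  rewrite -e; elim: m {e} => [|m IH]; first exact: imset_f.
  by rewrite iterS; case/imsetP: IH => j _ ->; rewrite fc imset_f.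
case/imsetP=> j _ ey; case/negP: ni; rewrite oy outf fc ey; apply/eqP; congr (Some (_, c _)).
by rewrite -ry ey rc.
Qed.

End Graph.
End Decompose.

(** * The coefficients of the substitution morphism *)

Section Identify.
Variables (R : realType) (D : finType) (A : aforest D -> formal_series R D).
Variable b : D -> formal_series R D.
Hypothesis trA : tracial_morphism A.
Hypothesis A_vertex : forall d, A (vertex d) = delta_sigma (b d).
Hypothesis b_tree : forall d p, ~~ is_tree p -> b d p = 0.
Implicit Types I U V W : finType.

Lemma sigma_neq0 (p : aforest D) : (sigma p)%:R != 0 :> R.
Proof. by rewrite pnatr_eq0 -lt0n sigma_gt0. Qed.

Lemma coefA_empty V W (P : graph D V) (H : graph D W) :
  #|V| = 0%N -> coefA A P H = cover_sum b P H.
Proof.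
move=> V0; have noV (v : V) : False by have := fintype0 v V0.
have -> : coefA A P H = (#|W| == 0%N)%:R.
  rewrite /coefA.
  have -> : forest_class P = empty_forest.
    apply: (@forest_class_iso _ _ _ _ _ (fun v => match noV v with end)).
      by exists (fun v : void => match v with end) => v //; case: (noV v).
    by apply/relabelsP; split=> v; case: (noV v).
  rewrite (tr_unit trA) /basis; have [W0|nW] := eqVneq #|W| 0%N; last first.
    rewrite [_ == _]negbTE ?mul0r //; apply: contra nW => /eqP /(congr1 (@nvertices D)).
    by rewrite !nvertices_class card_void => ->.
  have -> : forest_class H = empty_forest.
    have noW (v : W) : False by have := fintype0 v W0.
    apply: (@forest_class_iso _ _ _ _ _ (fun v => match noW v with end)).
      by exists (fun v : void => match v with end) => v //; case: (noW v).
    by apply/relabelsP; split=> v; case: (noW v).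
  rewrite eqxx mul1r; congr (_%:R); apply/eqP; rewrite eqn_leq sigma_gt0 andbT.
  rewrite -card_isos_rep (leq_trans (max_card _)) // card_ffun.
  by rewrite [#|'I__|]card_ord nvertices_class card_void.
have [W0|nW] := eqVneq #|W| 0%N; last first.
  rewrite /cover_sum big_pred0 // => c; move: nW; rewrite -lt0n => /card_gt0P[w _].
  by case: (noV (c w).1).
have noW (v : W) : False by have := fintype0 v W0.
pose c0 : {ffun W -> V * bool} := [ffun w => match noW w with end].
rewrite /cover_sum (big_pred1 c0).
  by rewrite /weight big1 // => v; case: (noV v).
move=> c; have -> : c = c0 by apply/ffunP => w; case: (noW w).
rewrite /= eqxx; apply/andP; split; apply/forallP; [move=> w; case: (noW w)|move=> v; case: (noV v)].
Qed.

(** Over a single vertex without loop, H can only be covered by marking its roots. *)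
Lemma coefA_single V W (P : graph D V) (H : graph D W) v0 :
  (forall v, v = v0) -> out P v0 = None -> coefA A P H = cover_sum b P H.
Proof.
move=> uV oP.
have -> : coefA A P H = b (dec P v0) (forest_class H).
  rewrite /coefA; have -> : forest_class P = vertex (dec P v0).
    symmetry; apply: (@forest_class_iso _ _ _ _ _ (fun _ => v0)).
      by exists (fun _ => tt) => [[]|v].
    apply/relabelsP; split=> -[]; first by rewrite /dec ffunE.
    rewrite oP; apply/esym; rewrite (_ : out _ _ = None) //.
    by apply: out_unique => w; rewrite inE.
  by rewrite A_vertex /delta_sigma divfK // sigma_neq0.
pose c0 : {ffun W -> V * bool} := [ffun w => (v0, w \in roots H)].
have covE c : covers P c H = (c == c0) && is_tree (forest_class H).
  rewrite is_tree_class.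
  have rE : [forall v, rooted c0 v] = (#|roots H| == 1%N).
    have e : rooted c0 v0 = (#|roots H| == 1%N).
      rewrite /rooted; congr (_ == _%N); apply: eq_card => w.
      by rewrite inE ffunE /= eqxx andbT.
    by apply/forallP/idP => [/(_ v0)|h v]; rewrite ?(uV v) e.
  apply/andP/andP => [[/forallP l rt]|[/eqP -> h]]; last first.
    split; last by rewrite rE.
    apply/forallP => w; rewrite /link_ok !ffunE /= oP -out_root.
    by case: (out H w) => [p|] //=; rewrite ffunE.
  have e : c = c0.
    apply/ffunP => w; rewrite ffunE [LHS]surjective_pairing (uV (c w).1) -out_root.
    congr (_, _); have := l w; rewrite /link_ok (uV (c w).1) oP.
    by case: (out H w) => [p|] /=; case: (c w).2.
  by rewrite -rE -e eqxx.
have [tH|nt] := boolP (is_tree (forest_class H)); last first.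
  rewrite b_tree // /cover_sum big_pred0 // => c; by rewrite covE (negbTE nt) andbF.
rewrite /cover_sum (big_pred1 c0); last by move=> c; rewrite covE tH andbT.
rewrite /weight (big_pred1 v0); last by move=> v; rewrite /= (uV v) eqxx.
have mE : marked c0 = roots H by apply/setP => w; rewrite in_marked ffunE.
have sE : sever H (marked c0) = H.
  apply: graph_ext => // w; rewrite out_sever mE -!out_root; case e: (out H w) => [[s y]|] //=.
  by case: s e => //= /out_sym e; by rewrite -out_root e.
rewrite sE; congr (b _ _).
have cl v : closed_at (base c0) H v.
  by rewrite /closed_at /base ffunE; case: (out H v) => // p; rewrite ffunE.
symmetry; apply: (@forest_class_iso _ _ _ _ _ val); last first.
  by apply: part_relabels => v _; exact: cl.
have hw (w : W) : base c0 w == v0 by rewrite /base ffunE.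
by exists (fun w => exist _ w (hw w)) => w //; apply: val_inj.
Qed.

(** Both kinds of coefficients satisfy the gluing rule; once they agree on the pieces
    and on all other terms, they agree on P. *)
Lemma coefA_joined I V W (q : I -> option (bool * I)) (r : V -> I) (P0 P : graph D V)
    (H : graph D W) :
    triangular q r P0 P ->
    \sum_(P' | joined q r P0 P') coefA A P' H =
    \sum_(chi : {ffun W -> I * bool} | assembles q chi H)
      \prod_i coefA A (part r i P0) (part (base chi) i (sever H (marked chi))) ->
    (forall U (G : graph D U) (W' : finType) (H' : graph D W'), (gsize G < gsize P)%N ->
       coefA A G H' = cover_sum b G H') ->
    (forall P' : graph D V, gsize P' = gsize P -> (reach P < reach P')%N ->
       coefA A P' H = cover_sum b P' H) ->
  coefA A P H = cover_sum b P H.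
Proof.
case=> cl jP sm more eqA IH1 IH2.
have : \sum_(P' | joined q r P0 P') coefA A P' H = \sum_(P' | joined q r P0 P') cover_sum b P' H.
  rewrite eqA cover_sum_assembles //; apply: eq_bigr => chi _; apply: eq_bigr => i _.
  exact: IH1.
rewrite (bigD1 P) //= [in RHS](bigD1 P) //=.
rewrite (eq_bigr (fun P' => cover_sum b P' H)); first by move/addIr.
move=> P' /andP[jP' nP']; apply: IH2; last exact: more.
by rewrite /gsize (joined_linked cl jP' jP).
Qed.

(** The coefficients of the substitution morphism count, with weights, the ways to see H
    as an insertion of trees into P. The induction is on [gsize], then downwards on
    [reach], which is bounded by the number of pairs of vertices. *)
Theorem coefA_cover_sum V W (P : graph D V) (H : graph D W) : coefA A P H = cover_sum b P H.
Proof.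
have [n] := ubnP (gsize P); elim: n V W P H => [//|n IH] V W P H.
rewrite ltnS => szP.
have [m] := ubnP (#|{: V * V}| - reach P); elim: m P szP => [//|m IHm] P szP; rewrite ltnS => rcP.
have IH1 U (G : graph D U) (W' : finType) (H' : graph D W') : (gsize G < gsize P)%N ->
    coefA A G H' = cover_sum b G H'.
  by move=> h; apply: IH; apply: leq_trans h szP.
have IH2 (P' : graph D V) : gsize P' = gsize P -> (reach P < reach P')%N -> coefA A P' H = cover_sum b P' H.
  move=> e h; apply: IHm; first by rewrite e.
  apply: leq_trans rcP; apply: ltn_sub2l (h); apply: leq_trans h _; exact: max_card.
have [/existsP[C /and3P[h1 h2 h3]]|/existsPn noC] :=
    boolP [exists C, [&& component_closed P C, C != set0 & C != setT]].
  have tr := triangular_apart h1 h2 h3; apply: coefA_joined (tr) _ IH1 IH2.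
  by apply: coefA_pairs; [case: tr | exact: preserves_apart].
have indec C : component_closed P C -> C = set0 \/ C = setT.
  by move=> h; have := noC C; rewrite h /= -negb_or negbK => /orP[]/eqP; [left|right].
have [/existsP[u /existsP[w /eqP uw]]|/existsPn nst] :=
    boolP [exists u, exists w, out P u == Some (true, w)].
  have [r [P0 [tr tt]]] := triangular_tied indec uw; apply: coefA_joined (tr) _ IH1 IH2.
  apply: coefA_pairs; first by case: tr.
  exact: preserves_tied.
have nostolon u w : out P u != Some (true, w) by have /existsPn := nst u; exact.
have [/existsP[t /eqP ot]|/existsPn noroot] := boolP [exists t, out P t == None].
  have [/existsP[x nxt]|/existsPn single] := boolP [exists x, x != t].
    have [r [P0 [tr tt]]] := triangular_grafted indec nostolon ot nxt.
    apply: coefA_joined (tr) _ IH1 IH2.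
    apply: coefA_pairs; first by case: tr.
    exact: preserves_grafted.
  apply: coefA_single ot => v; apply/eqP; by have := single v; rewrite negbK.
have [V0|[x _]] : #|V| = 0%N \/ exists x : V, true.
- have [->|n0] := eqVneq #|V| 0%N; [by left | right].
  by move: n0; rewrite -lt0n => /card_gt0P[x _]; exists x.
- exact: coefA_empty.
have [k [r [P0 [tr tt]]]] := triangular_cycled indec nostolon noroot x.
apply: coefA_joined (tr) _ IH1 IH2; apply: (coefA_cycle trA) => //; by case: tr.
Qed.

End Identify.

(** * Covering structures as coloured cuts *)

Section Cuts.
Variables (D : finType) (W : finType) (G : graph D W).

Section OneCut.
Variable c : cut G.

Definition owners : {set W} := [set w | own c w == w].

Lemma roots_kept : roots (kept c) = owners.
Proof.
have [_ _ hown hfix _] := cutP c; apply/setP=> w; rewrite [RHS]inE.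
by apply/idP/eqP => [/hfix //|<-].
Qed.

Lemma out_kept w p : out (kept c) w = Some p -> out G w = Some p.
Proof.
case: p => [[] y] /eqP; rewrite ?out_stolon ?out_edge => h; apply/eqP.
  by rewrite out_stolon; move: h => /setIP[].
by rewrite out_edge; move: h => /setIP[].
Qed.

(** The chosen links are those that do not start from a root of the kept graph; a cut is
    thus determined by its map to the roots, see [cut_ext]. *)
Lemma kept_sever : kept c = sever G owners.
Proof.
apply: graph_ext => // w; rewrite out_sever -roots_kept -out_root.
case e: (out (kept c) w) => [[s y]|]; last by case: (out G w).
rewrite (out_kept e) /=; case: s e => //= /out_sym e; by rewrite -out_root e.
Qed.

Lemma own_kept w s y : out (kept c) w = Some (s, y) -> own c y = own c w.
Proof.
have [_ _ _ _ [hE hS]] := cutP c; case: s => /eqP.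
  rewrite out_stolon => /setIP[_ hs].
  by apply: hS hs _ _; rewrite !inE eqxx ?orbT.
by rewrite out_edge => /setIP[_ /hE].
Qed.

Lemma own_own w : own c (own c w) = own c w.
Proof. by have [_ _ hown hfix _] := cutP c; apply: hfix. Qed.

Lemma owner_stolon w y : own c w = w -> out G w = Some (true, y) -> own c y = y.
Proof.
move=> ow e; have : out (kept c) y == None.
  rewrite kept_sever out_sever (out_sym e) /= [w \in _]inE ow eqxx orbT.
  by [].
by rewrite out_root roots_kept inE => /eqP.
Qed.

Lemma blk_proof w : own c w \in roots (kept c).
Proof. by have [_ _ hown _ _] := cutP c. Qed.

Definition blk w : blocks c := exist _ (own c w) (blk_proof w).

Lemma blk_val (r : blocks c) : blk (val r) = r.
Proof.
have [_ _ _ hfix _] := cutP c; apply: val_inj => /=; exact: hfix (valP r).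
Qed.

Lemma own_val (r : blocks c) : own c (val r) = val r.
Proof. by have /(congr1 val) := blk_val r. Qed.

(** Every link that is not chosen starts from a root of the kept graph. *)
Lemma out_quotient (k : {ffun blocks c -> D}) r :
  out (quotient k) r = lmap blk (out G (val r)).
Proof.
have kN : out (kept c) (val r) = None by apply/eqP; rewrite out_root; exact: valP.
apply: out_unique => r'.
  rewrite inE; apply/existsP/eqP => [[w /and3P[]]|].
    rewrite -out_edge => /eqP -> _ /eqP e /=; congr (Some (_, _)); exact: val_inj.
  case e: (out G (val r)) => [[s y]|] //= -[es er]; subst s; exists y.
  rewrite -out_edge e eqxx -er /= eqxx andbT.
  apply: contraTN isT => h; have : out (kept c) (val r) == Some (false, y).
    by rewrite out_edge inE h -out_edge e eqxx.
  by rewrite kN.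
rewrite inE imsetU1 imset_set1 inE -out_stolon andbC.
apply/andP/eqP => [[/eqP -> _ /=]|].
  by rewrite blk_val.
case e: (out G (val r)) => [[s y]|] //= -[es er]; subst s.
have oy := owner_stolon (own_val r) e; rewrite -er /= oy eqxx; split=> //.
apply: contraTN isT => h; have : out (kept c) (val r) == Some (true, y).
  by rewrite out_stolon inE h -out_stolon e eqxx.
by rewrite kN.
Qed.

End OneCut.

Lemma cut_ext (c c' : cut G) : own c = own c' -> c = c'.
Proof.
move=> e; have ek : kept c = kept c' by rewrite !kept_sever /owners e.
have eE (d : cut G) : edges (kept d) = chosen_edges d.
  by apply/setIidPr; case: (cutP d).
have eS (d : cut G) : stolons (kept d) = chosen_stolons d.
  by apply/setIidPr; case: (cutP d).
have e1 : chosen_edges c = chosen_edges c' by rewrite -!eE ek.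
have e2 : chosen_stolons c = chosen_stolons c' by rewrite -!eS ek.
apply: val_inj; move: e e1 e2; clear; case: c => [[[E T] o] p]; case: c' => [[[E' T'] o'] p'].
by rewrite /own /chosen_edges /chosen_stolons /= => -> -> ->.
Qed.

Section Cover.
Variables (V : finType) (P : graph D V).

(** The cut c contracts the fibres of chi, and the marks of chi are the roots of c. *)
Definition compatible (c : cut G) (chi : {ffun W -> V * bool}) : bool :=
  [forall w, ((chi w).2 == (own c w == w)) && ((chi w).1 == (chi (own c w)).1)].

Lemma compatible_unique c c' chi : covers P chi G -> compatible c chi -> compatible c' chi -> c = c'.
Proof.
case/andP=> _ /forallP rt /forallP h /forallP h'; apply: cut_ext; apply/ffunP => w.
have /rootedP[x _ u] := rt (chi w).1.
have own_x (d : cut G) : (forall w, ((chi w).2 == (own d w == w)) && ((chi w).1 == (chi (own d w)).1)) ->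
    own d w = x.
  move=> hd; apply: u; last by have /andP[_ /eqP <-] := hd w.
  by have /andP[/eqP -> _] := hd (own d w); rewrite own_own.
by rewrite (own_x c) // (own_x c').
Qed.

Lemma compatible_exists chi : covers P chi G -> exists c, compatible c chi.
Proof.
case/andP=> /forallP lk /forallP rt.
have as1 : assembles (out P) chi G.
  by apply/andP; split; apply/forallP => // v; apply/implyP.
(* o sends a vertex to the marked vertex of its fibre. *)
pose o : {ffun W -> W} := [ffun w => odflt w [pick x | (chi x).2 && ((chi x).1 == (chi w).1)]].
have oP w : (chi (o w)).2 /\ (chi (o w)).1 = (chi w).1.
  rewrite ffunE; case: pickP => [x /andP[? /eqP]//|n].
  by have /rootedP[x [h1 h2] _] := rt (chi w).1; have := n x; rewrite h1 h2 eqxx.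
have oI w w' : (chi w).1 = (chi w').1 -> o w = o w'.
  move=> e; have /rootedP[x _ u] := rt (chi w).1.
  have [h1 h2] := oP w; have [h3 h4] := oP w'.
  by rewrite (u (o w)) // (u (o w')) // h4.
have ofix w : (chi w).2 -> o w = w.
  move=> mw; have /rootedP[x _ u] := rt (chi w).1; have [h1 h2] := oP w.
  by rewrite (u (o w)) // (u w).
pose K := sever G (marked chi).
have KE : keep G (edges K) (stolons K) = K.
  by apply: val_inj; rewrite /= /keep_pre /edges /stolons /= !setIA !setIid.
have rK : roots K = marked chi := assembles_roots as1.
have lK w s y : out K w = Some (s, y) -> o w = o y.
  rewrite out_sever in_marked; have := lk w; rewrite /link_ok; case: (out G w) => [[t z]|] //=.
  by case: (chi w).2 => //= /eqP e; case: ifP => // _ [_ <-]; apply: oI.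
have ic : is_cut G (edges K, stolons K, o).
  rewrite /is_cut KE rK; apply/and5P; split.
  - exact: subsetIl.
  - exact: subsetIl.
  - by apply/forallP => w; rewrite in_marked; case: (oP w).
  - by apply/forall_inP => w; rewrite in_marked => /ofix ->.
  apply/andP; split.
    apply/forall_inP => -[v w]; rewrite -out_edge => /eqP /lK /= ->; exact: eqxx.
  apply/forall_inP => s /stolonsP[v [w [-> h]]].
  have e := lK _ _ _ h.
  by apply/forall_inP => x; rewrite !inE => hx; apply/forall_inP => y; rewrite !inE => hy;
    move: hx hy => /orP[]/eqP-> /orP[]/eqP->; rewrite ?e.
exists (exist (fun c => is_cut G c) _ ic); apply/forallP => w; rewrite /own /=.
have [h1 h2] := oP w; rewrite h2 eqxx andbT; apply/eqP.
by apply/idP/eqP => [/ofix //|<-].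
Qed.

Variables (R : comPzSemiRingType) (b : D -> aforest D -> R).

Section PerCut.
Variable c : cut G.

(** An identification of the vertices of the quotient with those of P yields a covering
    map; [covers_cover_of] shows that the covering structures correspond to the
    isomorphisms. *)
Definition cover_of (psi : {ffun blocks c -> V}) : {ffun W -> V * bool} :=
  [ffun w => (psi (blk c w), own c w == w)].

Lemma marked_cover_of psi : marked (cover_of psi) = owners c.
Proof. by apply/setP => w; rewrite in_marked ffunE inE. Qed.

Lemma covers_cover_of (psi : {ffun blocks c -> V}) :
  covers P (cover_of psi) G =
  (psi \in isos (quotient ([ffun r => dec P (psi r)] : {ffun blocks c -> D})) P).
Proof.
set k := finfun _.
have lkE w : link_ok (out P) (cover_of psi) G w =
   (if own c w == w then out P (psi (blk c w)) == lmap psi (out (quotient k) (blk c w)) else true).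
  rewrite /link_ok !ffunE /=; case: ifP => [/eqP ow|/eqP now].
    rewrite out_quotient /= ow; case e: (out G w) => [[s y]|] //=; rewrite !ffunE /=.
    rewrite andb_idr // => _; apply/implyP => es; rewrite /is_true in es; subst s.
    by rewrite (owner_stolon ow e).
  have : w \notin roots (kept c) by rewrite roots_kept inE; apply/eqP.
  rewrite -out_root; case e: (out (kept c) w) => [[s y]|] // _.
  rewrite (out_kept e) !ffunE /=; apply/eqP; congr (psi _); apply: val_inj => /=.
  exact: own_kept e.
have rtE v : rooted (cover_of psi) v = (#|[set r | psi r == v]| == 1%N).
  rewrite /rooted -[in RHS](card_imset _ val_inj); congr (_ == _%N); apply: eq_card => w.
  rewrite inE !ffunE /=; apply/andP/imsetP => [[/eqP ow pw]|[r]].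
    by exists (blk c w); rewrite ?inE.
  by rewrite inE => pr ->; rewrite own_val blk_val eqxx.
apply/andP/isosP => [[/forallP lk /forallP rt]|[bp /relabelsP[_ op]]]; split.
(* One marked vertex per fibre means that psi is a bijection. *)
- have pr v : exists2 r, psi r = v & forall r', psi r' = v -> r' = r.
    have := rt v; rewrite rtE => /cards1P[r e]; exists r.
      by apply/eqP; have := set11 r; rewrite -e inE.
    by move=> r' h; apply/set1P; rewrite -e inE h.
  have ip : injective psi by move=> r r' e; have [x _ u] := pr (psi r'); rewrite (u r) // (u r').
  apply: (inj_card_bij ip); rewrite -(card_imset predT ip) subset_leq_card //.
  by apply/subsetP => v _; have [r <- _] := pr v; apply: imset_f.
- apply/relabelsP; split=> r; first by rewrite [LHS]ffunE.
  by have := lk (val r); rewrite lkE own_val eqxx blk_val => /eqP.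
- apply/forallP => w; rewrite lkE; case: ifP => // _; by rewrite op.
apply/forallP => v; rewrite rtE; have [h hK Kh] := bp.
apply/cards1P; exists (h v); apply/setP => r; rewrite !inE.
by apply/eqP/eqP => [<-|->].
Qed.

Lemma weight_cover_of (psi : {ffun blocks c -> V}) : bijective psi ->
  weight b P (cover_of psi) G = \prod_r b (dec P (psi r)) (forest_class (block r)).
Proof.
move=> bp; rewrite /weight (reindex psi); last exact: onW_bij.
apply: eq_bigr => r _; congr (b _ _); rewrite marked_cover_of -kept_sever.
have cl1 w : closed_at (own c) (kept c) w.
  by rewrite /closed_at; case e: (out _ w) => [[s y]|] //=; rewrite (own_kept e).
have cl2 w : closed_at (base (cover_of psi)) (kept c) w.
  rewrite /closed_at; case e: (out _ w) => [[s y]|] //=; rewrite /base !ffunE /=.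
  apply/eqP; congr (psi _); apply: val_inj; exact: own_kept e.
symmetry; apply: (@part_iso _ _ _ _ _ _ _ _ (own c) (val r) _ id) => //.
- move=> w ow; rewrite /base ffunE /=; congr (psi _); exact: val_inj.
- move=> w; rewrite /base ffunE /= => /(bij_inj bp) e; exists w => //.
  by rewrite -e.
exact: relabels_id.
Qed.

Lemma cover_of_inj : injective cover_of.
Proof.
move=> p p' e; apply/ffunP => r; have := congr1 (fun h : {ffun W -> V * bool} => (h (val r)).1) e.
by rewrite !ffunE /= blk_val.
Qed.

Lemma cover_of_image chi : compatible c chi -> exists psi, chi = cover_of psi.
Proof.
move/forallP=> h; exists [ffun r => (chi (val r)).1]; apply/ffunP => w; rewrite !ffunE.
by have /andP[/eqP <- /eqP e] := h w; rewrite [LHS]surjective_pairing e.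
Qed.

Lemma compatible_cover_of psi : compatible c (cover_of psi).
Proof.
apply/forallP => w; rewrite !ffunE /= eqxx /=; apply/eqP; congr (psi _).
by apply: val_inj; rewrite /= own_own.
Qed.

Lemma sum_compatible :
  \sum_(chi : {ffun W -> V * bool} | covers P chi G && compatible c chi) weight b P chi G =
  \sum_(k : {ffun blocks c -> D}) (\prod_r b (k r) (forest_class (block r))) *+ #|isos (quotient k) P|.
Proof.
transitivity (\sum_(psi | covers P (cover_of psi) G) weight b P (cover_of psi) G).
  transitivity (\sum_(chi in cover_of @: setT | covers P chi G) weight b P chi G).
    apply: eq_bigl => chi; rewrite andbC; congr (_ && _).
    apply/idP/imsetP => [/cover_of_image[psi ->]|[psi _ ->]]; first by exists psi.
    exact: compatible_cover_of.
  rewrite big_imset_cond; last by move=> ? ? _ _; exact: cover_of_inj.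
  by apply: eq_bigl => psi; rewrite inE.
transitivity (\sum_(k : {ffun blocks c -> D}) \sum_(psi in isos (quotient k) P)
    \prod_r b (k r) (forest_class (block r))); last first.
  by apply: eq_bigr => k _; rewrite sumr_const.
rewrite (exchange_big_dep predT) //= [LHS]big_mkcond /=; apply: eq_bigr => psi _.
pose k0 : {ffun blocks c -> D} := [ffun r => dec P (psi r)].
have kE k : (psi \in isos (quotient k) P) = (k == k0) && (psi \in isos (quotient k0) P).
  apply/idP/andP => [|[/eqP -> //]]; suff : psi \in isos (quotient k) P -> k = k0.
    by move=> h /[dup] /h -> ->.
  case/isosP => _ /relabelsP[d _]; apply/ffunP => r; by rewrite ffunE; exact: (d r).
rewrite (eq_bigl _ _ kE) covers_cover_of; case: ifP => [hp|_]; last first.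
  by rewrite big_pred0 // => k; rewrite andbF.
under eq_bigl do rewrite andbT; rewrite big_pred1_eq weight_cover_of; last by case/isosP: hp.
by apply: eq_bigr => r _; rewrite ffunE.
Qed.

End PerCut.

(** A covering structure of G over P is a cut of G together with a colouring of its
    blocks and an isomorphism from the coloured quotient to P. *)
Lemma cover_sum_cuts :
  cover_sum b P G = \sum_(c : cut G) \sum_(k : {ffun blocks c -> D})
    (\prod_r b (k r) (forest_class (block r))) *+ #|isos (quotient k) P|.
Proof.
transitivity (\sum_(c : cut G)
    \sum_(chi : {ffun W -> V * bool} | covers P chi G && compatible c chi) weight b P chi G).
  rewrite (exchange_big_dep (fun chi => covers P chi G)) /=; last by move=> ? ? _ /andP[].
  apply: eq_bigr => chi cov; have [c cc] := compatible_exists cov.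
  rewrite (big_pred1 c) // => c'; rewrite /= cov /=.
  by apply/idP/eqP => [cc'|->//]; exact: compatible_unique cov cc' cc.
by apply: eq_bigr => c _; exact: sum_compatible.
Qed.

End Cover.
End Cuts.

(** * Substitution and the convolution product *)

Section Star.
Variables (R : realType) (D : finType) (b0 : D -> atree D -> R).

Lemma extend_tree0 (b : atree D -> R) p : ~~ is_tree p -> extend_tree b p = 0.
Proof. by move=> np; rewrite /extend_tree insubN. Qed.

Lemma tensor_character_cem W (G : graph D W) (c : cut G) (k : {ffun blocks c -> D}) :
  tensor_character b0 (cem_term k).1 =
  \prod_r extend_tree (b0 (k r)) (forest_class (block r)).
Proof.
rewrite /tensor_character (partition_big k predT) //=; apply: eq_bigr => d _.
rewrite /tree_character ffunE (perm_big _ (perm_eq_seq_mset _)) big_map big_filter big_enum_cond /=.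
apply: eq_bigr => r /eqP ->; rewrite /extend_tree -[forest_class _]/(val (block_tree r)).
by rewrite valK.
Qed.

Lemma star_cuts (a : formal_series R D) p :
  star (tensor_character b0) a p =
  \sum_(c : cut (rep p)) \sum_(k : {ffun blocks c -> D})
    (\prod_r extend_tree (b0 (k r)) (forest_class (block r))) * a (forest_class (quotient k)).
Proof.
rewrite /star /Delta_CEM big_allpairs_dep big_enum /=; apply: eq_bigr => c _.
by rewrite big_enum /=; apply: eq_bigr => k _; rewrite tensor_character_cem.
Qed.

Variables (A : aforest D -> formal_series R D) (AP : substitution_morphism (phi_of b0) A).

(** On the left, p is covered by the representatives of all forests q, with weights
    [a q / sigma q]. For each coloured cut of p the quotient is isomorphic to exactly one
    of them, in [sigma q] ways; what remains is the sum that defines the star product. *)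
Theorem substitution_star (a : formal_series R D) p :
  lin_ext A (delta_sigma a) p = delta_sigma (star (tensor_character b0) a) p.
Proof.
case: AP => trA vA; pose b d := extend_tree (b0 d).
have bt d q : ~~ is_tree q -> b d q = 0 by exact: extend_tree0.
rewrite /lin_ext {2}/delta_sigma; apply: (canRL (mulfK (sigma_neq0 R p))).
rewrite mulr_suml.
transitivity (\sum_(q : upto D (nvertices p)) delta_sigma a (of_upto q) *
    cover_sum b (rep (of_upto q)) (rep p)).
  apply: eq_bigr => q _; rewrite -mulrA; congr (_ * _).
  by rewrite -(coefA_cover_sum trA vA bt) /coefA !forest_classK.
under eq_bigr => q _ do rewrite cover_sum_cuts mulr_sumr.
rewrite exchange_big star_cuts /=; apply: eq_bigr => c _.
under eq_bigr => q _ do rewrite mulr_sumr.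
rewrite exchange_big /=; apply: eq_bigr => k _.
have le : (nvertices (forest_class (quotient k)) <= nvertices p)%N.
  by rewrite nvertices_class card_sig (leq_trans (max_card _)) // card_ord.
have := sum_upto (nvertices p) (forest_class (quotient k)) a; rewrite le => <-.
rewrite mulr_sumr; apply: eq_bigr => q _; rewrite card_isos (forest_classK (of_upto q)) eq_sym.
rewrite -mulr_natr natrM /delta_sigma [LHS]mulrCA; congr (_ * _).
case: eqP => _; last by rewrite !(mul0r, mulr0).
by rewrite mul1r mulr1 divfK // sigma_neq0.
Qed.

End Star.

From mathcomp Require Import all_classical all_reals all_analysis.

Theorem theorem4p21 (R : realType) (D : finType) (n : nat)
    (f : D -> 'rV[R]_n -> 'rV[R]_n) (f_smooth : forall d : D, smooth_field (f d))
    (a : aforest D -> R) (b0 : D -> atree D -> R)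
    (A_phi : aforest D -> formal_series R D)
    (A_phiP : substitution_morphism (phi_of b0) A_phi) :
  forall (N : nat) (psi : 'rV[R]_n -> R), smooth psi ->
    S_subst f A_phi a N psi = S_series f (star (tensor_character b0) a) N psi.
Proof.
move=> N psi _; apply: funext => x; apply: eq_bigr => p _.
by rewrite (substitution_star A_phiP).
Qed.
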